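(* Let $\mathcal{G}_1=(\mathcal{E}_1,\mathcal{V}_1,m_1)$ and $\mathcal{G}_2=(\mathcal{E}_2,\mathcal{V}_2,m_2)$ be graphs with magnetic potentials $\theta_1,\theta_2$, let $\mathcal{I}\subset\mathcal{V}_2$ with $|\mathcal{I}|>0$, and let $\mathcal{G}:=\mathcal{G}_1\times_{\mathcal{I}}\mathcal{G}_2$ with its product magnetic potential $\theta$. Assume that $m_1(x)\to0$ as $|x|\to\infty$, that $\mathcal{G}_2$ is finite, and that $\mathrm{Hol}_{\theta_2}\neq0$. Then $\Delta_{\mathcal{G},\theta}$ has compact resolvent, and \[\mathcal{N}_\lambda\big(m_1^{-1}(\cdot)\otimes\Delta_{\mathcal{G}_2,\theta_2}\big)\ge\mathcal{N}_\lambda(\Delta_{\mathcal{G},\theta})\quad\text{for all }\lambda\ge0.\]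
   Context: A (weighted) graph is a triple $\mathcal{G}=(\mathcal{E},\mathcal{V},m)$ with $\mathcal{V}$ a countable set, $\mathcal{E}:\mathcal{V}\times\mathcal{V}\to[0,\infty)$ symmetric, and $m:\mathcal{V}\to(0,\infty)$. Write $x\sim y$ if $\mathcal{E}(x,y)>0$. All graphs are locally finite, connected, and without loops ($\mathcal{E}(x,x)=0$). $\ell^2(\mathcal{V},m)$ is the Hilbert space of $f:\mathcal{V}\to\mathbb{C}$ with $\sum_x m(x)|f(x)|^2<\infty$; $\mathcal{C}_c(\mathcal{V})$ denotes finitely supported functions. In (H1)-type limits, $|x|$ is the combinatorial graph distance in $\mathcal{G}_1$ from $x$ to a fixed vertex. A magnetic potential is a map $\theta:\mathcal{V}\times\mathcal{V}\to\mathbb{R}/2\pi\mathbb{Z}$ with $\theta_{x,y}=-\theta_{y,x}$ and $\theta_{x,y}=0$ if $\mathcal{E}(x,y)=0$. The magnetic Laplacian $\Delta_{\mathcal{G},\theta}$ is the Friedrichs extension in $\ell^2(\mathcal{V},m)$ of $(\Delta_{\mathcal{G},\theta}f)(x)=\frac1{m(x)}\sum_{y}\mathcal{E}(x,y)(f(x)-e^{i\theta_{x,y}}f(y))$ on $\mathcal{C}_c(\mathcal{V})$; it is the non-negative self-adjoint operator associated with the closure of the form $Q_{\mathcal{G},\theta}(f)=\frac12\sum_{x,y}\mathcal{E}(x,y)|f(x)-e^{i\theta_{x,y}}f(y)|^2$ on $\mathcal{C}_c(\mathcal{V})$. The holonomy of $\theta$ assigns to each cycle (closed walk) $(x_0,\dots,x_N=x_0)$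 with $x_i\sim x_{i+1}$ the element $\theta_{x_0,x_1}+\dots+\theta_{x_{N-1},x_N}\in\mathbb{R}/2\pi\mathbb{Z}$; $\mathrm{Hol}_\theta=0$ means that this vanishes for every cycle, and $\mathrm{Hol}_\theta\ne0$ otherwise. Product through $\mathcal{I}$: $\mathcal{G}_1\times_{\mathcal{I}}\mathcal{G}_2=(\mathcal{E},\mathcal{V},m)$ has $\mathcal{V}=\mathcal{V}_1\times\mathcal{V}_2$, $m(x,y)=m_1(x)m_2(y)$, $\mathcal{E}((x,y),(x',y'))=\mathcal{E}_1(x,x')\delta_{y,y'}1_{\mathcal{I}}(y)+\delta_{x,x'}\mathcal{E}_2(y,y')$, and $\theta((x,y),(x',y'))=\theta_1(x,x')\delta_{y,y'}+\delta_{x,x'}\theta_2(y,y')$ (values on non-edges play no role and are set to $0$). One identifies $\ell^2(\mathcal{V},m)\simeq\ell^2(\mathcal{V}_1,m_1)\otimes\ell^2(\mathcal{V}_2,m_2)$; $m_1^{-1}(\cdot)$ denotes multiplication by $1/m_1$ and the tensor product of self-adjoint operators is the usual self-adjoint one. For a self-adjoint operator $H$, $\mathcal{N}_\lambda(H)=\dim\operatorname{ran}1_{]-\infty,\lambda]}(H)$. *)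

(* Defs.v *)
From HB Require Import structures.
From mathcomp Require Import all_boot all_order all_algebra.
From mathcomp Require Import ring_quotient complex.
From mathcomp Require Import all_classical all_reals all_analysis.

Set Implicit Arguments.
Unset Strict Implicit.
Unset Printing Implicit Defensive.

Import Order.TTheory GRing.Theory Num.Theory.
Import numFieldNormedType.Exports.

Local Open Scope classical_set_scope.
Local Open Scope ring_scope.
Local Open Scope complex_scope.

Section Angle.
Variable R : realType.

Definition twopiZ : {pred R} := fun a => `[< exists k : int, a = k%:~R * (2 * pi) >].

Lemma twopiZ_zmod_closed : zmod_closed twopiZ.
Proof.
split=> [|a b /asboolP[k ->] /asboolP[l ->]]; apply/asboolP.
  by exists 0; rewrite mul0r.
by exists (k - l); rewrite intrB mulrBl.
Qed.

HB.instance Definition _ := GRing.isZmodClosed.Build R twopiZ twopiZ_zmod_closed.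

Notation angle := {ideal_quot twopiZ}.

(* e^{i a} *)
Definition expi (a : angle) : R[i] := cos (repr a) +i* sin (repr a).

End Angle.

Notation angle R := {ideal_quot (@twopiZ R)}.

Section L2.
Variables (R : realType) (V : countType) (m : V -> R).

Definition cfun := V -> R[i].

Definition esumsq (f : cfun) : \bar R :=
  \esum_(x in [set: V]) (m x * Normc.normc (f x) ^+ 2)%:E.

Definition l2 : set cfun := [set f | (esumsq f < +oo)%E].

Definition l2norm (f : cfun) : R := Num.sqrt (fine (esumsq f)).

(* Sums of absolutely summable families; meaningless otherwise. *)
Definition rsum (a : V -> R) : R :=
  fine (\esum_(x in [set: V]) (Num.max (a x) 0)%:E)
  - fine (\esum_(x in [set: V]) (Num.max (- a x) 0)%:E).

Definition csum (a : cfun) : R[i] :=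
  rsum (fun x => complex.Re (a x)) +i* rsum (fun x => complex.Im (a x)).

Definition inner (f g : cfun) : R[i] := csum (fun x => (m x)%:C * f x * conjc (g x)).

Definition l2_cvg (u : nat -> cfun) (f : cfun) : Prop :=
  [/\ forall n, l2 (u n), l2 f & l2norm (u n \- f) @[n --> \oo] --> (0 : R)].

(* An operator is identified with its graph: [T (f, g)] means that f is in the
   domain of T and that T f = g. *)
Definition operator := set (cfun * cfun).

Definition mult_op (a : V -> R) : operator :=
  [set p | [/\ l2 p.1, l2 p.2 & forall x, p.2 x = (a x)%:C * p.1 x]].

Definition op_closure (T : operator) : operator :=
  [set p | exists2 u : nat -> cfun * cfun, forall n, T (u n) &
     l2_cvg (fun n => (u n).1) p.1 /\ l2_cvg (fun n => (u n).2) p.2].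

(* The elements [(p n).1] of the domain of S tend to f in l^2 and form a Cauchy
   sequence for the form norm of (f, h) |-> <S f, h>; [(p n).2 = S (p n).1]. *)
Definition form_approx (S : operator) (p : nat -> cfun * cfun) (f : cfun) : Prop :=
  [/\ forall n, S (p n), l2_cvg (fun n => (p n).1) f &
      forall e : R, 0 < e -> exists N, forall n k, (N <= n)%N -> (N <= k)%N ->
        Normc.normc (inner ((p n).2 \- (p k).2) ((p n).1 \- (p k).1)) < e].

Definition form_dom (S : operator) : set cfun :=
  [set f | exists p, form_approx S p f].

(* [closed_form S f h z]: the closure of the form takes the value z at (f, h).
   The value does not depend on the sequences, as the form is closable. *)
Definition closed_form (S : operator) (f h : cfun) (z : R[i]) : Prop :=
  exists p q, [/\ form_approx S p f, form_approx S q h &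
    Normc.normc (inner (p n).2 (q n).1 - z) @[n --> \oo] --> (0 : R)].

(* For S symmetric and non-negative: f is in the domain and is mapped to g iff
   the closure of the form <S f, h> is given by <g, h> for all h in its domain. *)
Definition friedrichs (S : operator) : operator :=
  [set p | [/\ form_dom S p.1, l2 p.2 &
     forall h, form_dom S h -> closed_form S p.1 h (inner p.2 h)]].

(* The graph of (H - z)^-1. *)
Definition resolvent (H : operator) (z : R[i]) : operator :=
  [set p | H (p.2, fun x => p.1 x + z * p.2 x)].

Definition bounded_op (T : operator) : Prop :=
  exists M : R, forall p, T p -> l2norm p.2 <= M * l2norm p.1.

Definition resolvent_set (H : operator) : set R[i] :=
  [set z | (forall g, l2 g -> exists! f, resolvent H z (g, f)) /\
           bounded_op (resolvent H z)].

Definition compact_op (T : operator) : Prop :=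
  forall u : nat -> cfun * cfun, (forall n, T (u n)) ->
    (exists M : R, forall n, l2norm (u n).1 <= M) ->
    exists (phi : nat -> nat) (g : cfun),
      {homo phi : n k / (n < k)%N} /\ l2_cvg (fun n => (u (phi n)).2) g.

Definition compact_resolvent (H : operator) : Prop :=
  exists2 z, resolvent_set H z & compact_op (resolvent H z).

Definition orthogonal_projection (P : cfun -> cfun) : Prop :=
  [/\ forall f, l2 f -> l2 (P f),
      forall (c : R[i]) f g, l2 f -> l2 g ->
        P (fun x => c * f x + g x) = (fun x => c * P f x + P g x),
      forall f, l2 f -> P (P f) = P f &
      forall f g, l2 f -> l2 g -> inner (P f) g = inner f (P g)].

Definition projection_valued_measure
    (E : set (measurableTypeR R) -> cfun -> cfun) : Prop :=
  [/\ forall A, measurable A -> orthogonal_projection (E A),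
      forall f, l2 f -> E [set: _] f = f &
      forall A : nat -> set (measurableTypeR R),
        (forall k, measurable (A k)) -> trivIset [set: nat] A ->
        forall f, l2 f ->
        l2_cvg (fun n x => \sum_(k < n) E (A k) f x) (E (\bigcup_k A k) f)].

Definition spectral_mass (E : set (measurableTypeR R) -> cfun -> cfun) (f : cfun)
    (A : set (measurableTypeR R)) : \bar R :=
  (complex.Re (inner (E A f) f))%:E.

(* E is the projection-valued measure with H = \int t dE(t); for self-adjoint H
   it exists and is unique on Borel sets, by the spectral theorem. *)
Definition spectral_resolution (H : operator)
    (E : set (measurableTypeR R) -> cfun -> cfun) : Prop :=
  [/\ projection_valued_measure E,
      forall f, (exists g, H (f, g)) <->
        l2 f /\ (\int[spectral_mass E f]_t (t ^+ 2)%:E < +oo)%E &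
      forall f g, H (f, g) ->
        l2 g /\ inner g f = (fine (\int[spectral_mass E f]_t t%:E))%:C].

(* 1_A(H), for Borel A. *)
Definition spectral_projection (H : operator) (A : set (measurableTypeR R)) :
    cfun -> cfun :=
  xget (fun _ _ _ => 0) [set E | spectral_resolution H E] A.

(* For a subspace W; all infinite dimensions are +oo. *)
Definition dimension (W : set cfun) : \bar R :=
  ereal_sup [set n%:R%:E | n in [set n : nat | exists v : 'I_n -> cfun,
    (forall i, W (v i)) /\
    forall c : 'I_n -> R[i],
      (forall x, \sum_(i < n) c i * v i x = 0) -> forall i, c i = 0]].

Definition counting_function (H : operator) (lambda : R) : \bar R :=
  dimension [set spectral_projection H `]-oo, lambda] f | f in l2].

End L2.

Section Tensor.
Variables (R : realType) (V1 V2 : countType) (m1 : V1 -> R) (m2 : V2 -> R).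

Definition prod_mass (p : V1 * V2) : R := m1 p.1 * m2 p.2.

Definition algebraic_tensor (A : operator R V1) (B : operator R V2) :
    operator R (V1 * V2)%type :=
  [set FG | exists n (a : 'I_n -> cfun R V1 * cfun R V1)
                   (b : 'I_n -> cfun R V2 * cfun R V2),
    [/\ forall i, A (a i) /\ B (b i),
        forall p, FG.1 p = \sum_(i < n) (a i).1 p.1 * (b i).1 p.2 &
        forall p, FG.2 p = \sum_(i < n) (a i).2 p.1 * (b i).2 p.2]].

(* For self-adjoint A and B, this closure is self-adjoint. *)
Definition tensor_op (A : operator R V1) (B : operator R V2) :
    operator R (V1 * V2)%type :=
  op_closure prod_mass (algebraic_tensor A B).

End Tensor.

Record wgraph (R : realType) (V : countType) := WGraph {
  edge : V -> V -> R;
  mass : V -> R;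
  edge_ge0 : forall x y, 0 <= edge x y;
  edge_sym : forall x y, edge x y = edge y x;
  mass_gt0 : forall x, 0 < mass x }.

Section Graph.
Variables (R : realType) (V : countType) (G : wgraph R V).

Definition adj : rel V := fun x y => 0 < edge G x y.

Definition locally_finite := forall x, finite_set [set y | adj x y].

Definition loopless := forall x, edge G x x = 0.

Definition walk (x y : V) (n : nat) : Prop :=
  exists p : seq V, [/\ path adj x p, last x p = y & size p = n].

Definition connected_graph := forall x y, exists n, walk x y n.

Definition gdist (x y : V) : nat :=
  xget 0%N [set n | walk x y n /\ forall k, walk x y k -> (n <= k)%N].

(* The limit |x| -> oo, with |x| the distance from x to o. *)
Definition graph_infinity (o : V) : set_system V :=
  filter_from [set: nat] (fun r => [set x | (r <= gdist o x)%N]).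

Record potential := Potential {
  theta :> V -> V -> angle R;
  theta_anti : forall x y, theta x y = - theta y x;
  theta_off : forall x y, edge G x y = 0 -> theta x y = 0 }.

Variable th : potential.

(* The holonomy of the walk x :: p. *)
Definition holonomy (x : V) (p : seq V) : angle R :=
  \sum_(e <- zip (x :: p) p) th e.1 e.2.

Definition trivial_holonomy :=
  forall x p, path adj x p -> last x p = x -> holonomy x p = 0.

(* The sum has finite support when G is locally finite. *)
Definition laplacian (f : cfun R V) : cfun R V := fun x =>
  (mass G x)^-1%:C *
  \sum_(y \in [set: V]) (edge G x y)%:C * (f x - expi (th x y) * f y).

Definition laplacian_Cc : operator R V :=
  [set p | finite_set [set x | p.1 x != 0] /\ p.2 = laplacian p.1].

Definition magnetic_laplacian : operator R V := friedrichs (mass G) laplacian_Cc.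

End Graph.

Section Product.
Variables (R : realType) (V1 V2 : countType).
Variables (G1 : wgraph R V1) (G2 : wgraph R V2) (I : set V2).

Definition prod_edge (p q : V1 * V2) : R :=
  edge G1 p.1 q.1 * (p.2 == q.2)%:R * (p.2 \in I)%:R
  + (p.1 == q.1)%:R * edge G2 p.2 q.2.

Lemma prod_edge_ge0 p q : 0 <= prod_edge p q.
Proof. by rewrite addr_ge0 ?mulr_ge0 ?edge_ge0 ?ler0n. Qed.

Lemma prod_edge_sym p q : prod_edge p q = prod_edge q p.
Proof.
rewrite /prod_edge (edge_sym G1) (edge_sym G2) (eq_sym p.1) (eq_sym p.2).
by case: eqP => [->|]; rewrite ?mulr0 ?mul0r.
Qed.

Lemma prod_mass_gt0 p : 0 < prod_mass (mass G1) (mass G2) p.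
Proof. by rewrite mulr_gt0 ?mass_gt0. Qed.

Definition prod_graph : wgraph R (V1 * V2)%type :=
  WGraph prod_edge_ge0 prod_edge_sym prod_mass_gt0.

Variables (th1 : potential G1) (th2 : potential G2).

(* The test sets the potential to 0 on non-edges, which exist over y outside I. *)
Definition prod_theta (p q : V1 * V2) : angle R :=
  if prod_edge p q == 0 then 0
  else th1 p.1 q.1 *+ (p.2 == q.2) + th2 p.2 q.2 *+ (p.1 == q.1).

Lemma prod_theta_anti p q : prod_theta p q = - prod_theta q p.
Proof.
rewrite /prod_theta (prod_edge_sym p); case: ifP => _; first by rewrite oppr0.
rewrite (theta_anti th1) (theta_anti th2) (eq_sym p.1) (eq_sym p.2).
by rewrite !mulNrn -opprD.
Qed.

Lemma prod_theta_off p q : edge prod_graph p q = 0 -> prod_theta p q = 0.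
Proof. by rewrite /prod_theta /= => ->; rewrite eqxx. Qed.

Definition prod_potential : potential prod_graph :=
  Potential prod_theta_anti prod_theta_off.

End Product.

(* Main.v *)
(* The form of the product dominates its part along the fibres {x} x V2: with
   K := m1^-1 (x) Delta_2, Q_G(u) >= <K u, u> for u finitely supported, as the edges
   of G1 contribute non-negatively and the mass m1 cancels in m1 * m1^-1.
   In a finite graph, a zero mode of Delta_2 is parallel, so its transport around a
   cycle is multiplication by the holonomy; hence Hol <> 0 makes all eigenvalues mu_k
   of Delta_2 positive. With phi_k an eigenbasis, K is diagonal in the basis
   delta_x (x) phi_k, with eigenvalues mu_k / m1(x).
   Compactness: ||f||^2 off the finite set {m1 >= r} is at most
   r * max(1/mu_k) * Q_G(f), so sequences bounded for the form are tight in l2.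
   Counting: if K has fewer than N eigenvalues <= lambda, then in any N-dimensional
   space of vectors f with 1_{]-oo, lambda]}(Delta) f = f there is f <> 0 orthogonal to
   their eigenvectors; then lambda ||f||^2 < Q_G(f), a contradiction. *)
From HB Require Import structures.
From mathcomp Require Import all_boot all_order all_algebra.
From mathcomp Require Import ring_quotient complex spectral.
From mathcomp Require Import all_classical all_reals all_analysis measurable_realfun.
From mathcomp Require Import ring lra.
Require Import Defs.

Set Implicit Arguments.
Unset Strict Implicit.
Unset Printing Implicit Defensive.

Import Order.TTheory GRing.Theory Num.Theory.
Import numFieldNormedType.Exports.

Local Open Scope classical_set_scope.
Local Open Scope ring_scope.
Local Open Scope complex_scope.

(** * Absolutely summable families *)

(** [spectral_projection] picks a resolution by [xget], with the zero map as default, so only the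
    clauses of [spectral_resolution] are known of it. Two consequences of them drive the counting:
    if [E] on []-oo, lambda]] kills a nonzero [f] of the domain, then [<H f, f> > lambda ||f||^2];
    if it fixes [f], then [f] is in the domain and [<H f, f> <= lambda ||f||^2]. The second is
    delicate, since a half-line does not bound the second moment: the non-negativity of [H] first
    confines the spectral measure to [[0, lambda]]. For [K] a resolution is built by hand from the
    eigenbasis, because its counting function must be bounded below and the default would make it 0.
    For [Delta] both cases are treated: without a resolution its counting function is 0. As
    [dimension] is a supremum over free families, infinite counts are covered by a dichotomy for
    each [N]: either [N] eigenvalues of [K] up to [lambda] can be listed, or fewer than [N] exhaust
    them. The resolvent of [Delta] is taken at -1, where it is obtained by minimising an energy over
    finitely supported functions. *)

Section Sums.
Variables (R : realType) (V : countType).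
Implicit Types (a b u v : V -> R) (s : seq V) (C : R).

Definition abs_summable a := (\esum_(x in [set: V]) `|a x|%:E < +oo)%E.

Lemma esum_le_seq a C :
  (forall s, uniq s -> \sum_(x <- s) a x <= C) ->
  (\esum_(x in [set: V]) (a x)%:E <= C%:E)%E.
Proof.
move=> h; apply: ge_ereal_sup => _ [X [finX _] <-].
by rewrite fsumEFin// lee_fin fsbig_finite//; exact/h/finmap.fset_uniq.
Qed.

Lemma seq_le_esum a s : uniq s ->
  ((\sum_(x <- s) a x)%:E <= \esum_(x in [set: V]) (a x)%:E)%E.
Proof.
move=> us; rewrite fsbig_seq// -fsumEFin//; apply: ereal_sup_ubound.
by exists [set` s] => //; split => //; exact: finite_seq.
Qed.

Lemma abs_summable_le a b : (forall x, `|a x| <= b x) ->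
  (\esum_(x in [set: V]) (b x)%:E < +oo)%E -> abs_summable a.
Proof.
move=> ab; apply: le_lt_trans; apply: le_esum => x _; by rewrite lee_fin.
Qed.

Lemma abs_summable_seq a C :
  (forall s, uniq s -> \sum_(x <- s) `|a x| <= C) -> abs_summable a.
Proof. by move=> /esum_le_seq h; rewrite /abs_summable (le_lt_trans h) ?ltry. Qed.

Lemma esum_fin_ge0 u : (forall x, 0 <= u x) -> abs_summable u ->
  (fine (\esum_(x in [set: V]) (u x)%:E))%:E = \esum_(x in [set: V]) (u x)%:E.
Proof.
move=> u0 su; rewrite fineK// ge0_fin_numE.
  by move: su; rewrite /abs_summable; under eq_esum do rewrite ger0_norm//.
by apply: esum_ge0 => x _; rewrite lee_fin.
Qed.

Lemma abs_summableD a b : abs_summable a -> abs_summable b ->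
  abs_summable (fun x => a x + b x).
Proof.
move=> sa sb.
apply: (@abs_summable_le _ (fun x => `|a x| + `|b x|)) => [x|]; first exact: ler_normD.
under eq_esum do rewrite EFinD.
by rewrite esumD ?lte_add_pinfty.
Qed.

Lemma abs_summableZ (c : R) a : abs_summable a -> abs_summable (fun x => c * a x).
Proof.
move=> sa; apply: (@abs_summable_seq _
  (`|c| * fine (\esum_(x in [set: V]) `|a x|%:E))) => s us.
under eq_bigr do rewrite normrM.
rewrite -mulr_sumr ler_wpM2l// -lee_fin.
rewrite (@esum_fin_ge0 (fun x => `|a x|))// ?seq_le_esum//.
by rewrite /abs_summable; under eq_esum do rewrite normr_id.
Qed.

Lemma abs_summableN a : abs_summable a -> abs_summable (fun x => - a x).
Proof. by rewrite /abs_summable; under [in X in _ -> X]eq_esum do rewrite normrN. Qed.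

Lemma abs_summable_ge0 u C : (forall x, 0 <= u x) ->
  (forall s, uniq s -> \sum_(x <- s) u x <= C) -> abs_summable u.
Proof.
move=> u0 h; apply: (@abs_summable_seq _ C) => s us.
by under eq_bigr do rewrite ger0_norm//; exact: h.
Qed.

(** The positive and negative parts [p] and [n] of [a] satisfy [p + v = u + n]. Both sides have the
    same sum in the extended reals and all four sums are finite, so they can be rearranged.
    Additivity of [rsum] rests on this free choice of decomposition. *)
Lemma rsumBE a u v : (forall x, 0 <= u x) -> (forall x, 0 <= v x) ->
  abs_summable u -> abs_summable v -> (forall x, a x = u x - v x) ->
  rsum a = fine (\esum_(x in [set: V]) (u x)%:E)
         - fine (\esum_(x in [set: V]) (v x)%:E).
Proof.
move=> u0 v0 su sv auv.
have suv : (\esum_(x in [set: V]) (u x + v x)%:E < +oo)%E.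
  have := abs_summableD su sv; rewrite /abs_summable.
  by under eq_esum do rewrite ger0_norm ?addr_ge0//.
pose p x := Num.max (a x) 0; pose n x := Num.max (- a x) 0.
have p0 x : 0 <= p x by rewrite /p le_max lexx orbT.
have n0 x : 0 <= n x by rewrite /n le_max lexx orbT.
have sp : abs_summable p.
  apply: (abs_summable_le _ suv) => x; rewrite ger0_norm// /p ge_max auv.
  by have := u0 x; have := v0 x; lra.
have sn : abs_summable n.
  apply: (abs_summable_le _ suv) => x; rewrite ger0_norm// /n ge_max auv.
  by have := u0 x; have := v0 x; lra.
have pn x : p x - n x = a x.
  by rewrite /p /n; case: (lerP (a x) 0); case: (lerP (- a x) 0); lra.
have e : (\esum_(x in [set: V]) (p x)%:E + \esum_(x in [set: V]) (v x)%:E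
  = \esum_(x in [set: V]) (u x)%:E + \esum_(x in [set: V]) (n x)%:E)%E.
  rewrite -!esumD ?lee_fin//; try by move=> x _; rewrite lee_fin.
  by apply: eq_esum => x _; rewrite -!EFinD; have := pn x; rewrite auv => pe; congr EFin; lra.
rewrite -(esum_fin_ge0 p0 sp) -(esum_fin_ge0 v0 sv) -(esum_fin_ge0 u0 su)
  -(esum_fin_ge0 n0 sn) -!EFinD in e.
have [{}e] := e; rewrite /rsum -/(p _) -/(n _)
  -[X in X - _ = _]/(fine (\esum_(x in [set: V]) (p x)%:E))
  -[X in _ - X = _]/(fine (\esum_(x in [set: V]) (n x)%:E)).
lra.
Qed.

Lemma abs_summable_pos a : abs_summable a -> abs_summable (fun x => Num.max (a x) 0).
Proof.
apply: abs_summable_le => x; rewrite ger0_norm ?le_max ?lexx ?orbT// ge_max normr_ge0 andbT.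
exact: ler_norm.
Qed.

Lemma abs_summable_neg a : abs_summable a -> abs_summable (fun x => Num.max (- a x) 0).
Proof. by move=> /abs_summableN/abs_summable_pos. Qed.

Lemma rsum_ge0E u : (forall x, 0 <= u x) ->
  rsum u = fine (\esum_(x in [set: V]) (u x)%:E).
Proof.
move=> u0; rewrite /rsum (_ : (fun x => (Num.max (u x) 0)%:E) = EFin \o u).
  rewrite [X in _ - fine X]esum1 ?subr0//= => x _.
  by rewrite (max_idPr _)// oppr_le0.
by apply/funext => x /=; rewrite (max_idPl _).
Qed.

Lemma rsum_EFin u : (forall x, 0 <= u x) -> abs_summable u ->
  (rsum u)%:E = \esum_(x in [set: V]) (u x)%:E.
Proof. by move=> u0 su; rewrite rsum_ge0E// esum_fin_ge0. Qed.

Lemma rsum_decomp a : abs_summable a -> exists u v,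
  [/\ forall x, 0 <= u x, forall x, 0 <= v x, abs_summable u, abs_summable v &
      forall x, a x = u x - v x].
Proof.
move=> sa; exists (fun x => Num.max (a x) 0), (fun x => Num.max (- a x) 0); split.
- by move=> x; rewrite le_max lexx orbT.
- by move=> x; rewrite le_max lexx orbT.
- exact: abs_summable_pos.
- exact: abs_summable_neg.
- by move=> x; case: (lerP (a x) 0); case: (lerP (- a x) 0); lra.
Qed.

Lemma rsum_diff a u v : (forall x, 0 <= u x) -> (forall x, 0 <= v x) ->
  abs_summable u -> abs_summable v -> (forall x, a x = u x - v x) ->
  rsum a = rsum u - rsum v.
Proof. by move=> u0 v0 su sv /rsumBE -> //; rewrite (rsum_ge0E u0) (rsum_ge0E v0). Qed.

Lemma rsumD_ge0 u v : (forall x, 0 <= u x) -> (forall x, 0 <= v x) ->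
  abs_summable u -> abs_summable v -> rsum (fun x => u x + v x) = rsum u + rsum v.
Proof.
move=> u0 v0 su sv;
  suff : (rsum (fun x => u x + v x))%:E = (rsum u)%:E + (rsum v)%:E :> \bar R by case.
rewrite !rsum_EFin//; last 2 first.
- by move=> x; exact: addr_ge0.
- exact: abs_summableD.
by rewrite -esumD// => x _; rewrite lee_fin.
Qed.

Lemma rsumD a b : abs_summable a -> abs_summable b ->
  rsum (fun x => a x + b x) = rsum a + rsum b.
Proof.
move=> /rsum_decomp[u [v [u0 v0 su sv auv]]] /rsum_decomp[u' [v' [u'0 v'0 su' sv' auv']]].
rewrite (rsum_diff u0 v0 su sv auv) (rsum_diff u'0 v'0 su' sv' auv').
rewrite (@rsum_diff _ (fun x => u x + u' x) (fun x => v x + v' x)).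
- by rewrite !rsumD_ge0//; ring.
- by move=> x; exact: addr_ge0.
- by move=> x; exact: addr_ge0.
- exact: abs_summableD.
- exact: abs_summableD.
- by move=> x; rewrite auv auv'; ring.
Qed.

Lemma rsumN a : rsum (fun x => - a x) = - rsum a.
Proof.
by rewrite /rsum; under [X in _ - fine X]eq_esum do rewrite opprK; rewrite opprB.
Qed.

Lemma eq_rsum a b : a =1 b -> rsum a = rsum b.
Proof. by move=> /funext ->. Qed.

Lemma rsum_ge0 u : (forall x, 0 <= u x) -> 0 <= rsum u.
Proof. by move=> u0; rewrite rsum_ge0E// fine_ge0// esum_ge0// => x _; rewrite lee_fin. Qed.

Lemma seq_le_rsum u s : (forall x, 0 <= u x) -> abs_summable u -> uniq s ->
  \sum_(x <- s) u x <= rsum u.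
Proof. by move=> u0 su us; rewrite -lee_fin rsum_EFin// seq_le_esum. Qed.

Lemma rsum_le_seq u C : (forall x, 0 <= u x) ->
  (forall s, uniq s -> \sum_(x <- s) u x <= C) -> rsum u <= C.
Proof.
by move=> u0 h; rewrite -lee_fin rsum_EFin ?esum_le_seq//; exact: abs_summable_ge0 h.
Qed.

Lemma rsumZ (c : R) a : abs_summable a -> rsum (fun x => c * a x) = c * rsum a.
Proof.
have pos (d : R) u : 0 < d -> (forall x, 0 <= u x) -> abs_summable u ->
    rsum (fun x => d * u x) = d * rsum u.
  move=> d0 u0 su; have d0' := ltW d0; apply/eqP; rewrite eq_le; apply/andP; split.
    apply: rsum_le_seq => [x|s us]; first exact: mulr_ge0.
    by rewrite -mulr_sumr ler_pM2l// seq_le_rsum.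
  rewrite -ler_pdivlMl//; apply: rsum_le_seq => // s us.
  rewrite ler_pdivlMl// mulr_sumr seq_le_rsum// => [x|]; first exact: mulr_ge0.
  exact: abs_summableZ.
have all (d : R) b : 0 < d -> abs_summable b -> rsum (fun x => d * b x) = d * rsum b.
  move=> d0 /rsum_decomp[u [v [u0 v0 su sv auv]]]; have d0' := ltW d0.
  rewrite (rsum_diff u0 v0 su sv auv) mulrBr -!pos//; apply: rsum_diff.
  - by move=> x; exact: mulr_ge0.
  - by move=> x; exact: mulr_ge0.
  - exact: abs_summableZ.
  - exact: abs_summableZ.
  - by move=> x; rewrite auv mulrBr.
move=> sa; have [c0|c0|->] := ltgtP c 0; last first.
- rewrite mul0r; under eq_rsum do rewrite mul0r.
  by rewrite rsum_ge0E// esum1.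
- exact: all.
- have := all (- c) _ _ sa; rewrite oppr_gt0 => /(_ c0).
  by under eq_rsum do rewrite mulNr; rewrite rsumN mulNr => /oppr_inj.
Qed.

Lemma rsumB a b : abs_summable a -> abs_summable b ->
  rsum (fun x => a x - b x) = rsum a - rsum b.
Proof. by move=> sa sb; rewrite rsumD ?rsumN//; exact: abs_summableN. Qed.

Lemma le_rsum a b : abs_summable a -> abs_summable b -> (forall x, a x <= b x) ->
  rsum a <= rsum b.
Proof.
by move=> sa sb ab; rewrite -subr_ge0 -rsumB//; apply: rsum_ge0 => x; rewrite subr_ge0.
Qed.

Lemma sum_seqI u s s' : uniq s -> uniq s' -> 
  \sum_(x <- s | x \in s') u x = \sum_(x <- s' | x \in s) u x.
Proof.
move=> us us'; rewrite -big_filter -[RHS]big_filter; apply/perm_big/uniq_perm;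
  rewrite ?filter_uniq//.
by move=> x; rewrite !mem_filter andbC.
Qed.

Lemma fin_support_le u s s' : uniq s -> uniq s' -> (forall x, 0 <= u x) ->
  (forall x, x \notin s -> u x = 0) -> \sum_(x <- s') u x <= \sum_(x <- s) u x.
Proof.
move=> us us' u0 us0; rewrite (bigID (mem s))/= [X in _ + X]big1 ?addr0// sum_seqI//.
by rewrite [X in _ <= X](bigID (mem s'))/= lerDl sumr_ge0.
Qed.

Lemma abs_summable_fin a s : uniq s -> (forall x, x \notin s -> a x = 0) ->
  abs_summable a.
Proof.
move=> us as0; apply: (@abs_summable_seq _ (\sum_(x <- s) `|a x|)) => s' us'.
by apply: fin_support_le => // x /as0 ->; rewrite normr0.
Qed.

Lemma rsum_fin a s : uniq s -> (forall x, x \notin s -> a x = 0) ->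
  rsum a = \sum_(x <- s) a x.
Proof.
move=> us as0.
have pos u : (forall x, 0 <= u x) -> (forall x, x \notin s -> u x = 0) ->
    rsum u = \sum_(x <- s) u x.
  move=> u0 us0; apply/eqP; rewrite eq_le seq_le_rsum ?andbT//; last exact: abs_summable_fin us0.
  by apply: rsum_le_seq => // s' us'; exact: fin_support_le.
have [u [v [u0 v0 su sv auv]]] : exists u v,
  [/\ forall x, 0 <= u x, forall x, 0 <= v x, forall x, x \notin s -> u x = 0,
      forall x, x \notin s -> v x = 0 & forall x, a x = u x - v x].
  exists (fun x => Num.max (a x) 0), (fun x => Num.max (- a x) 0); split.
  - by move=> x; rewrite le_max lexx orbT.
  - by move=> x; rewrite le_max lexx orbT.
  - by move=> x /as0 ->; rewrite maxxx.
  - by move=> x /as0 ->; rewrite oppr0 maxxx.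
  - by move=> x; case: (lerP (a x) 0); case: (lerP (- a x) 0); lra.
rewrite (rsum_diff u0 v0 _ _ auv) ?(abs_summable_fin us)// (pos u)// (pos v)//.
by rewrite -sumrB; apply: eq_bigr.
Qed.

Lemma rsum_tail u e : (forall x, 0 <= u x) -> abs_summable u -> 0 < e ->
  exists2 s, uniq s & rsum u - e < \sum_(x <- s) u x.
Proof.
move=> u0 su e0; apply: contrapT => /forall2NP h.
have : rsum u <= rsum u - e; last by lra.
by apply: rsum_le_seq => // s us; case: (h s) => // /negP; rewrite -leNgt.
Qed.

Lemma rsum_split u s : uniq s -> abs_summable u ->
  rsum u = \sum_(x <- s) u x + rsum (fun x => if x \in s then 0 else u x).
Proof.
move=> us su.
have f0 x : x \notin s -> (if x \in s then u x else 0) = 0 by case: ifP.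
have -> : \sum_(x <- s) u x = rsum (fun x => if x \in s then u x else 0).
  rewrite (rsum_fin us f0); by apply: eq_big_seq => x ->.
rewrite -rsumD; last 2 first.
- exact: abs_summable_fin f0.
- apply: abs_summable_le su => x; by case: ifP; rewrite ?normr0.
by apply: eq_rsum => x; case: ifP; rewrite ?addr0 ?add0r.
Qed.

Lemma le_rsum1 u x : (forall x, 0 <= u x) -> abs_summable u -> u x <= rsum u.
Proof.
by move=> u0 su; rewrite (le_trans _ (@seq_le_rsum u [:: x] _ _ _))// big_seq1.
Qed.

End Sums.

(** * Complex sequences *)

Notation re := complex.Re.
Notation im := complex.Im.

Lemma cvg_epsP (R : realType) (u : nat -> R) (l : R) :
  u @ \oo --> l <->
  forall e : R, 0 < e -> exists N, forall n, (N <= n)%N -> `|u n - l| < e.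
Proof.
split=> [/cvgrPdistC_lt h e /h [N _ hN]|h]; first by exists N => n /hN.
by apply/cvgrPdistC_lt => e /h[N hN]; exists N.
Qed.

Lemma cvg_le (R : realType) (u : nat -> R) (l C : R) N :
  u @ \oo --> l -> (forall n, (N <= n)%N -> u n <= C) -> l <= C.
Proof.
move=> /cvg_epsP h uC; rewrite leNgt; apply/negP => Cl.
have /h[M hM] : 0 < l - C by rewrite subr_gt0.
have := hM _ (leq_maxr N M); have := uC _ (leq_maxl N M).
by rewrite ltr_norml => ? /andP[]; lra.
Qed.

Lemma cvg_ge (R : realType) (u : nat -> R) (l C : R) N :
  u @ \oo --> l -> (forall n, (N <= n)%N -> C <= u n) -> C <= l.
Proof.
move=> /cvgN c h; rewrite -lerN2; apply: (cvg_le (N := N) c) => n /h.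
by rewrite /= lerN2.
Qed.

Section ComplexSeq.
Variable R : realType.
Implicit Types (z w : R[i]) (u v : nat -> R[i]).

(** The squared modulus, kept as a polynomial in the two parts so that [ring] and the limit laws of
    [R] apply; square roots appear only where [normc] or [l2norm] does. *)
Definition nsq z : R := re z ^+ 2 + im z ^+ 2.

Lemma nsq_ge0 z : 0 <= nsq z. Proof. by rewrite addr_ge0 ?sqr_ge0. Qed.

Lemma normc_sq z : Normc.normc z ^+ 2 = nsq z.
Proof. by case: z => a b; rewrite /Normc.normc sqr_sqrtr ?addr_ge0 ?sqr_ge0. Qed.

Lemma normcE z : Normc.normc z = Num.sqrt (nsq z).
Proof. by case: z. Qed.

Lemma reD z w : re (z + w) = re z + re w. Proof. by case: z w => a b []. Qed.
Lemma imD z w : im (z + w) = im z + im w. Proof. by case: z w => a b []. Qed.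
Lemma reN z : re (- z) = - re z. Proof. by case: z. Qed.
Lemma imN z : im (- z) = - im z. Proof. by case: z. Qed.
Lemma reM z w : re (z * w) = re z * re w - im z * im w.
Proof. by case: z w => a b []. Qed.
Lemma imM z w : im (z * w) = re z * im w + im z * re w.
Proof. by case: z w => a b []. Qed.
Lemma reJ z : re (conjc z) = re z. Proof. by case: z. Qed.
Lemma imJ z : im (conjc z) = - im z. Proof. by case: z. Qed.
Definition ReIm := (reD, imD, reN, imN, reM, imM, reJ, imJ).

Lemma eq_c z w : re z = re w -> im z = im w -> z = w.
Proof. by case: z w => a b [c d] /= -> ->. Qed.

Lemma conjD z w : conjc (z + w) = conjc z + conjc w.
Proof. by apply: eq_c; rewrite !ReIm; ring. Qed.
Lemma conjB z w : conjc (z - w) = conjc z - conjc w.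
Proof. by apply: eq_c; rewrite !ReIm; ring. Qed.
Lemma conjM z w : conjc (z * w) = conjc z * conjc w.
Proof. by apply: eq_c; rewrite !ReIm; ring. Qed.
Lemma conjR (a : R) : conjc a%:C = a%:C.
Proof. by apply: eq_c; rewrite !ReIm /= ?oppr0. Qed.
Lemma conjK z : conjc (conjc z) = z.
Proof. by apply: eq_c; rewrite !ReIm ?opprK. Qed.
Lemma conj_sum (T : Type) (s : seq T) (F : T -> R[i]) :
  conjc (\sum_(x <- s) F x) = \sum_(x <- s) conjc (F x).
Proof.
by elim: s => [|x s ih]; rewrite ?big_nil ?conjc0// !big_cons conjD ih.
Qed.

Lemma nsqM z w : nsq (z * w) = nsq z * nsq w.
Proof. by rewrite /nsq !ReIm; ring. Qed.
Lemma nsqN z : nsq (- z) = nsq z.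
Proof. by rewrite /nsq !ReIm; ring. Qed.
Lemma nsqC (a : R) : nsq a%:C = a ^+ 2.
Proof. by rewrite /nsq /= expr0n addr0. Qed.
Lemma nsq0 : nsq 0 = 0. Proof. by rewrite /nsq /= expr0n addr0. Qed.
Lemma nsq_eq0 z : (nsq z == 0) = (z == 0).
Proof.
apply/eqP/eqP => [|->]; last exact: nsq0.
move=> /eqP; rewrite paddr_eq0 ?sqr_ge0// !sqrf_eq0 => /andP[/eqP a /eqP b].
exact: eq_c.
Qed.
Lemma mulcJ z : z * conjc z = (nsq z)%:C.
Proof. by apply: eq_c; rewrite !ReIm /= /nsq; ring. Qed.
Lemma nsqD_le z w : nsq (z + w) <= 2 * nsq z + 2 * nsq w.
Proof.
rewrite -subr_ge0.
have -> : 2 * nsq z + 2 * nsq w - nsq (z + w) = nsq (z - w).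
  by rewrite /nsq !ReIm; ring.
exact: nsq_ge0.
Qed.
Lemma re_sq_le z : re z ^+ 2 <= nsq z. Proof. by rewrite lerDl sqr_ge0. Qed.
Lemma im_sq_le z : im z ^+ 2 <= nsq z. Proof. by rewrite lerDr sqr_ge0. Qed.

Lemma re_sum (T : Type) (s : seq T) (P : pred T) (F : T -> R[i]) :
  re (\sum_(x <- s | P x) F x) = \sum_(x <- s | P x) re (F x).
Proof. by apply: (big_morph _ reD). Qed.
Lemma im_sum (T : Type) (s : seq T) (P : pred T) (F : T -> R[i]) :
  im (\sum_(x <- s | P x) F x) = \sum_(x <- s | P x) im (F x).
Proof. by apply: (big_morph _ imD). Qed.

(* The Cauchy-Schwarz inequality, when the left-hand side is the expansion of
   the form at [x + w y]: take [w] to be a multiple of [z]. *)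
Lemma discriminant_le (A C : R) z : 0 <= A -> 0 <= C ->
  (forall w, 0 <= A + 2 * re (conjc w * z) + nsq w * C) -> nsq z <= A * C.
Proof.
move=> A0 C0 h.
have ht (t : R) : 0 <= A - 2 * t * nsq z + t ^+ 2 * nsq z * C.
  have := h (- t%:C * z); rewrite nsqM nsqN nsqC.
  by rewrite /nsq !ReIm /= => H; apply: (le_trans H);
    rewrite le_eqVlt; apply/orP; left; apply/eqP; ring.
have [C00|Cn0] := eqVneq C 0.
  rewrite C00 mulr0; rewrite leNgt; apply/negP => z0.
  have := ht ((A + 1) / nsq z); rewrite C00 !mulr0 addr0 -mulrA divfK ?gt_eqF//.
  lra.
have Cp : 0 < C by rewrite lt_neqAle eq_sym Cn0.
have := ht C^-1; rewrite -(ler_pM2l Cp) mulr0 => H.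
have e : C * (A - 2 * C^-1 * nsq z + C^-1 ^+ 2 * nsq z * C) = A * C - nsq z.
  by field.
by rewrite e subr_ge0 in H.
Qed.

Definition ccvg u w := (fun n => re (u n)) @ \oo --> re w /\
                       (fun n => im (u n)) @ \oo --> im w.

Lemma ccvg_cst w : ccvg (fun=> w) w.
Proof. by split; exact: cvg_cst. Qed.

Lemma ccvgD u v z w : ccvg u z -> ccvg v w -> ccvg (fun n => u n + v n) (z + w).
Proof.
move=> [? ?] [? ?]; split; rewrite ReIm; under eq_fun do rewrite ReIm; exact: cvgD.
Qed.

Lemma ccvgN u z : ccvg u z -> ccvg (fun n => - u n) (- z).
Proof.
move=> [? ?]; split; rewrite ReIm; under eq_fun do rewrite ReIm; exact: cvgN.
Qed.

Lemma ccvgB u v z w : ccvg u z -> ccvg v w -> ccvg (fun n => u n - v n) (z - w).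
Proof. by move=> uz vw; apply: ccvgD => //; exact: ccvgN. Qed.

Lemma ccvgM u v z w : ccvg u z -> ccvg v w -> ccvg (fun n => u n * v n) (z * w).
Proof.
move=> [? ?] [? ?]; split; rewrite ReIm; under eq_fun do rewrite ReIm.
  by apply: cvgB; exact: cvgM.
by apply: cvgD; exact: cvgM.
Qed.

Lemma ccvgJ u z : ccvg u z -> ccvg (fun n => conjc (u n)) (conjc z).
Proof.
move=> [h h']; split; rewrite ReIm; first by under eq_fun do rewrite ReIm.
by under eq_fun do rewrite ReIm; exact: cvgN.
Qed.

Lemma ccvg_sum (T : Type) (s : seq T) (u : T -> nat -> R[i]) (w : T -> R[i]) :
  (forall x, ccvg (u x) (w x)) ->
  ccvg (fun n => \sum_(x <- s) u x n) (\sum_(x <- s) w x).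
Proof.
move=> h; elim: s => [|x s ih].
  rewrite big_nil (_ : (fun n => _) = fun=> 0); first exact: ccvg_cst.
  by apply/funext => n; rewrite big_nil.
rewrite big_cons (_ : (fun n => _) = fun n => u x n + \sum_(x <- s) u x n).
  exact: ccvgD.
by apply/funext => n; rewrite big_cons.
Qed.

Lemma ccvg_nsq u z : ccvg u z -> (fun n => nsq (u n)) @ \oo --> nsq z.
Proof. by move=> [? ?]; apply: cvgD; rewrite expr2; under eq_fun do rewrite expr2; exact: cvgM. Qed.

Lemma ccvg_nsqP u z : (fun n => nsq (u n - z)) @ \oo --> (0 : R) <-> ccvg u z.
Proof.
split=> [h|h].
  have s : (fun n => Num.sqrt (nsq (u n - z))) @ \oo --> (0 : R).
    by rewrite -sqrtr0; apply: continuous_cvg h => //; exact: sqrt_continuous.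
  split; apply/cvg_epsP => e e0; have /cvg_epsP/(_ e e0)[N hN] := s;
    exists N => n /hN; rewrite subr0; apply: le_lt_trans.
  - rewrite -reN -reD [X in _ <= X]ger0_norm ?sqrtr_ge0// -sqrtr_sqr ler_wsqrtr//; exact: re_sq_le.
  - rewrite -imN -imD [X in _ <= X]ger0_norm ?sqrtr_ge0// -sqrtr_sqr ler_wsqrtr//; exact: im_sq_le.
have := ccvg_nsq (ccvgB h (ccvg_cst z)); by rewrite subrr nsq0.
Qed.

Lemma ccvgP u z : Normc.normc (u n - z) @[n --> \oo] --> (0 : R) <-> ccvg u z.
Proof.
rewrite -ccvg_nsqP; split=> h.
  rewrite (_ : (fun n => _) = (fun n => Normc.normc (u n - z) * Normc.normc (u n - z))).
    by rewrite -[X in _ --> X](mulr0 (0 : R)); exact: cvgM.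
  by apply/funext => n; rewrite -normc_sq expr2.
have -> : (fun n => Normc.normc (u n - z)) = (fun n => Num.sqrt (nsq (u n - z))).
  by apply/funext => n; rewrite normcE.
by rewrite -sqrtr0; apply: continuous_cvg h => //; exact: sqrt_continuous.
Qed.

Lemma ccvg_unique u z w : ccvg u z -> ccvg u w -> z = w.
Proof.
by move=> [a b] [c d]; apply: eq_c; [move: a c|move: b d]; exact: cvg_unique.
Qed.

End ComplexSeq.

(** * The space l2 *)

Section L2theory.
Variables (R : realType) (V : countType) (m : V -> R).
Hypothesis m0 : forall x, 0 < m x.
Implicit Types (f g h : cfun R V) (s : seq V) (C e : R) (u v : nat -> cfun R V).

Let mge0 x : 0 <= m x. Proof. exact/ltW. Qed.

Definition sq_weight f x := m x * nsq (f x).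
Local Notation sqw := sq_weight.
Definition norm2 f := rsum (sqw f).

Lemma sqw_ge0 f x : 0 <= sqw f x.
Proof. by rewrite mulr_ge0// nsq_ge0. Qed.
Hint Resolve sqw_ge0 : core.

Lemma esumsqE f : esumsq m f = \esum_(x in [set: V]) (sqw f x)%:E.
Proof. by apply: eq_esum => x _; rewrite normc_sq. Qed.

Lemma l2E f : l2 m f <-> abs_summable (sqw f).
Proof.
rewrite /l2 /= esumsqE /abs_summable.
by under [in X in _ <-> X]eq_esum do rewrite ger0_norm//.
Qed.

Lemma norm2_ge0 f : 0 <= norm2 f. Proof. exact: rsum_ge0. Qed.

Lemma l2normE f : l2norm m f = Num.sqrt (norm2 f).
Proof. by rewrite /l2norm /norm2 rsum_ge0E// esumsqE. Qed.

Lemma l2norm_sq f : l2norm m f ^+ 2 = norm2 f.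
Proof. by rewrite l2normE sqr_sqrtr// norm2_ge0. Qed.

Lemma l2_dom C f g : (forall x, nsq (f x) <= C * nsq (g x)) -> l2 m g -> l2 m f.
Proof.
move=> h /l2E/(abs_summableZ C) H; apply/l2E; apply: abs_summable_le => [x|].
  by rewrite ger0_norm//; exact: lexx.
apply: le_lt_trans H; apply: le_esum => x _; rewrite lee_fin.
by rewrite (le_trans _ (ler_norm _))// /sqw mulrCA ler_wpM2l.
Qed.

Lemma norm2_dom C f g : (forall x, nsq (f x) <= C * nsq (g x)) -> l2 m g ->
  norm2 f <= C * norm2 g.
Proof.
move=> h lg; have /l2E lf := l2_dom h lg; move: lg => /l2E lg.
rewrite /norm2 -(rsumZ C lg).
apply: (le_rsum lf (abs_summableZ C lg)) => x.
by rewrite /sqw mulrCA ler_wpM2l.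
Qed.

Lemma l2D f g : l2 m f -> l2 m g -> l2 m (fun x => f x + g x).
Proof.
move=> /l2E sf /l2E sg; apply/l2E.
have := abs_summableD (abs_summableZ 2 sf) (abs_summableZ 2 sg).
rewrite /abs_summable => H; apply: le_lt_trans H; apply: le_esum => x _; rewrite lee_fin.
rewrite ger0_norm// (le_trans _ (ler_norm _))// /sqw !(mulrCA 2) -mulrDr ler_wpM2l//.
exact: nsqD_le.
Qed.

Lemma l2Z c f : l2 m f -> l2 m (fun x => c * f x).
Proof. by apply: (@l2_dom (nsq c)) => x; rewrite nsqM. Qed.

Lemma l2N f : l2 m f -> l2 m (fun x => - f x).
Proof. by apply: (@l2_dom 1) => x; rewrite nsqN mul1r. Qed.

Lemma l2B f g : l2 m f -> l2 m g -> l2 m (fun x => f x - g x).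
Proof. by move=> lf lg; apply: l2D => //; exact: l2N. Qed.

Lemma l2_fin f s : uniq s -> (forall x, x \notin s -> f x = 0) -> l2 m f.
Proof.
move=> us fs; apply/l2E; apply: (abs_summable_fin us) => x /fs.
by rewrite /sqw => ->; rewrite nsq0 mulr0.
Qed.

Lemma l2_0 : l2 m (fun=> 0). Proof. exact: (@l2_fin _ [::]). Qed.

Lemma norm2N f : norm2 (fun x => - f x) = norm2 f.
Proof. by apply: eq_rsum => x; rewrite /sqw nsqN. Qed.

Lemma norm2Z c f : l2 m f -> norm2 (fun x => c * f x) = nsq c * norm2 f.
Proof.
by move=> /l2E lf; rewrite -rsumZ//; apply: eq_rsum => x; rewrite /sqw nsqM; ring.
Qed.

Lemma norm2D_le f g : l2 m f -> l2 m g ->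
  norm2 (fun x => f x + g x) <= 2 * norm2 f + 2 * norm2 g.
Proof.
move=> lf lg; have /l2E lfg := l2D lf lg; move/l2E: lf => lf; move/l2E: lg => lg.
rewrite -!rsumZ// -rsumD; try exact: abs_summableZ.
apply: le_rsum => // [|x]; first by apply: abs_summableD; exact: abs_summableZ.
by rewrite /sqw !(mulrCA 2) -mulrDr ler_wpM2l// nsqD_le.
Qed.

Lemma norm2B_le f g : l2 m f -> l2 m g ->
  norm2 (fun x => f x - g x) <= 2 * norm2 f + 2 * norm2 g.
Proof. by move=> lf lg; rewrite (le_trans (norm2D_le _ _))// ?norm2N//; exact: l2N. Qed.

Lemma norm2_point f x : l2 m f -> nsq (f x) <= (m x)^-1 * norm2 f.
Proof.
move=> /l2E lf; rewrite ler_pdivlMl//; exact: (le_rsum1 x (sqw_ge0 f) lf).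
Qed.

Lemma norm2_eq0 f : l2 m f -> norm2 f = 0 -> forall x, f x = 0.
Proof.
move=> lf n0 x; apply/eqP; rewrite -nsq_eq0 eq_le nsq_ge0 andbT.
by rewrite (le_trans (norm2_point x lf))// n0 mulr0.
Qed.

Lemma seq_le_norm2 f s : l2 m f -> uniq s -> \sum_(x <- s) m x * nsq (f x) <= norm2 f.
Proof. by move=> /l2E lf us; exact: (seq_le_rsum (sqw_ge0 f) lf us). Qed.

Lemma norm2_le_seq f C : (forall s, uniq s -> \sum_(x <- s) m x * nsq (f x) <= C) ->
  l2 m f /\ norm2 f <= C.
Proof.
move=> h; split; last exact: (rsum_le_seq (sqw_ge0 f) h).
by apply/l2E; exact: (abs_summable_ge0 (sqw_ge0 f) h).
Qed.

Lemma norm2_fin f s : uniq s -> (forall x, x \notin s -> f x = 0) ->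
  norm2 f = \sum_(x <- s) m x * nsq (f x).
Proof. by move=> us fs; apply: rsum_fin => // x /fs; rewrite /sqw => ->; rewrite nsq0 mulr0. Qed.

Definition off s f : cfun R V := fun x => if x \in s then 0 else f x.

Lemma l2_off s f : l2 m f -> l2 m (off s f).
Proof.
by apply: (@l2_dom 1) => x; rewrite mul1r /off; case: ifP => //; rewrite nsq0 nsq_ge0.
Qed.

Lemma l2_offE s f : uniq s -> l2 m (off s f) -> l2 m f.
Proof.
move=> us lo.
have -> : f = fun x => off s f x + (if x \in s then f x else 0).
  by apply/funext => x; rewrite /off; case: ifP; rewrite ?add0r ?addr0.
by apply: l2D => //; apply: (l2_fin us) => x; case: ifP.
Qed.

Lemma norm2_split s f : uniq s -> l2 m f ->
  norm2 f = \sum_(x <- s) m x * nsq (f x) + norm2 (off s f).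
Proof.
move=> us /l2E lf; rewrite {1}/norm2 (rsum_split us lf); congr (_ + _).
by apply: eq_rsum => x; rewrite /sqw /off; case: ifP; rewrite ?nsq0 ?mulr0.
Qed.

Lemma norm2_tail f e : l2 m f -> 0 < e -> exists2 s, uniq s & norm2 (off s f) < e.
Proof.
move=> lf e0; have /l2E lf' := lf; have [s us] := rsum_tail (sqw_ge0 f) lf' e0.
rewrite -/(norm2 f) (norm2_split us lf) => h; exists s => //.
by rewrite -(ltrD2l (\sum_(x <- s) m x * nsq (f x))); move: h; rewrite ltrBlDr /sqw.
Qed.

Definition pcvg u f := forall x, ccvg (fun n => u n x) (f x).

(** Fatou's lemma for a weighted counting measure: each finite partial sum is continuous under
    pointwise convergence and therefore inherits the bound [C]. *)
Lemma fatou_norm2 u f C N : pcvg u f -> (forall n, (N <= n)%N -> l2 m (u n)) ->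
  (forall n, (N <= n)%N -> norm2 (u n) <= C) -> l2 m f /\ norm2 f <= C.
Proof.
move=> uf lu uC; apply: norm2_le_seq => s us.
have c : (fun n => \sum_(x <- s) m x * nsq (u n x)) @ \oo --> \sum_(x <- s) m x * nsq (f x).
  elim: s {us} => [|x s ih].
    by rewrite big_nil; under eq_fun do rewrite big_nil; exact: cvg_cst.
  rewrite big_cons; under eq_fun do rewrite big_cons.
  by apply: cvgD => //; apply: cvgM; [exact: cvg_cst|exact: ccvg_nsq].
apply: (cvg_le (N := N) c) => n Nn.
by rewrite (le_trans _ (uC _ Nn))// seq_le_norm2//; exact: lu.
Qed.

Lemma l2_cvgP u f : l2_cvg m u f <-> [/\ forall n, l2 m (u n), l2 m f &
  forall e, 0 < e -> exists N, forall n, (N <= n)%N -> norm2 (fun x => u n x - f x) < e].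
Proof.
have e2 n : l2norm m (u n \- f) = Num.sqrt (norm2 (fun x => u n x - f x)) by exact: l2normE.
split=> [[lu lf c]|[lu lf c]]; split => //.
  move=> e e0; have se : 0 < Num.sqrt e by rewrite sqrtr_gt0.
  move/cvg_epsP: c => /(_ _ se)[N hN]; exists N => n /hN.
  by rewrite subr0 e2 ger0_norm ?sqrtr_ge0// ltr_sqrt.
apply/cvg_epsP => e e0; have [|N hN] := c (e ^+ 2); first exact: exprn_gt0.
exists N => n /hN; rewrite subr0 e2 ger0_norm ?sqrtr_ge0// => h.
have : Num.sqrt (norm2 (fun x => u n x - f x)) < Num.sqrt (e ^+ 2).
  by rewrite ltr_sqrt// exprn_gt0.
by rewrite sqrtr_sqr gtr0_norm.
Qed.
End L2theory.

Lemma norm_dot_le (R : realType) (p q r t : R) :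
  `|p * r + q * t| <= p ^+ 2 + q ^+ 2 + (r ^+ 2 + t ^+ 2).
Proof.
have := sqr_ge0 (p + r); have := sqr_ge0 (p - r); have := sqr_ge0 (q + t).
have := sqr_ge0 (q - t); have := sqr_ge0 p; have := sqr_ge0 q; have := sqr_ge0 r.
have := sqr_ge0 t; rewrite ler_norml !expr2 => *; apply/andP; split; lra.
Qed.

(** * Inner product, convergence and completeness in l2 *)

Section Inner.
Variables (R : realType) (V : countType) (m : V -> R).
Hypothesis m0 : forall x, 0 < m x.
Implicit Types (f g h : cfun R V) (s : seq V) (C e : R) (u v : nat -> cfun R V)
  (a b : cfun R V) (c : R[i]).

Let mge0 x : 0 <= m x. Proof. exact/ltW. Qed.

Definition csummable a := abs_summable (fun x => re (a x)) /\ abs_summable (fun x => im (a x)).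

Lemma csumD a b : csummable a -> csummable b ->
  csum (fun x => a x + b x) = csum a + csum b.
Proof.
move=> [ra ia] [rb ib]; apply: eq_c; rewrite ReIm /= -rsumD//;
  by apply: eq_rsum => x; rewrite ReIm.
Qed.

Lemma csumZ c a : csummable a -> csum (fun x => c * a x) = c * csum a.
Proof.
move=> [ra ia]; apply: eq_c; rewrite ReIm /= -!rsumZ//.
  rewrite -rsumB; try exact: abs_summableZ.
  by apply: eq_rsum => x; rewrite ReIm.
rewrite -rsumD; try exact: abs_summableZ.
by apply: eq_rsum => x; rewrite ReIm.
Qed.

Lemma csumJ a : csum (fun x => conjc (a x)) = conjc (csum a).
Proof.
apply: eq_c; rewrite ReIm /=; first by apply: eq_rsum => x; rewrite reJ.
by rewrite -rsumN; apply: eq_rsum => x; rewrite imJ.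
Qed.

Lemma csum_fin a s : uniq s -> (forall x, x \notin s -> a x = 0) ->
  csum a = \sum_(x <- s) a x.
Proof.
move=> us as0; apply: eq_c; rewrite ?re_sum ?im_sum /=;
  by apply: rsum_fin => // x /as0 ->.
Qed.

Definition inner_term f g x := (m x)%:C * f x * conjc (g x).
Local Notation it := inner_term.

Lemma innerE f g : inner m f g = csum (it f g). Proof. by []. Qed.

Lemma re_it f g x : re (it f g x) = m x * (re (f x) * re (g x) + im (f x) * im (g x)).
Proof. by rewrite /it !ReIm /=; ring. Qed.
Lemma im_it f g x : im (it f g x) = m x * (im (f x) * re (g x) - re (f x) * im (g x)).
Proof. by rewrite /it !ReIm /=; ring. Qed.

Lemma summable_it f g : l2 m f -> l2 m g -> csummable (it f g).
Proof.
move=> /(l2E m0) lf /(l2E m0) lg; have := abs_summableD lf lg; rewrite /abs_summable.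
under eq_esum do rewrite ger0_norm ?addr_ge0 ?(sqw_ge0 m0)//.
move=> H; split.
  apply: abs_summable_le H => x; rewrite re_it normrM (ger0_norm (mge0 x)) /sq_weight -mulrDr.
  by rewrite ler_wpM2l// norm_dot_le.
apply: abs_summable_le H => x; rewrite im_it normrM (ger0_norm (mge0 x)) /sq_weight -mulrDr.
rewrite ler_wpM2l// -mulrN (le_trans (norm_dot_le _ _ _ _))//.
by rewrite /nsq sqrrN (addrC (_ (f x) ^+ 2)).
Qed.

Lemma innerDl f g h : l2 m f -> l2 m g -> l2 m h ->
  inner m (fun x => f x + g x) h = inner m f h + inner m g h.
Proof.
move=> lf lg lh; rewrite !innerE -csumD; [|exact: summable_it|exact: summable_it].
by congr csum; apply/funext => x; rewrite /it; ring.
Qed.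

Lemma innerZl c f g : l2 m f -> l2 m g -> inner m (fun x => c * f x) g = c * inner m f g.
Proof.
move=> lf lg; rewrite !innerE -csumZ; [|exact: summable_it].
by congr csum; apply/funext => x; rewrite /it; ring.
Qed.

Lemma innerJ f g : conjc (inner m f g) = inner m g f.
Proof.
rewrite !innerE -csumJ; congr csum; apply/funext => x.
by apply: eq_c; rewrite ?reJ ?imJ ?re_it ?im_it; ring.
Qed.

Lemma innerDr f g h : l2 m f -> l2 m g -> l2 m h ->
  inner m h (fun x => f x + g x) = inner m h f + inner m h g.
Proof. by move=> lf lg lh; rewrite -!(innerJ _ h) innerDl// rmorphD. Qed.

Lemma innerZr c f g : l2 m f -> l2 m g ->
  inner m g (fun x => c * f x) = conjc c * inner m g f.
Proof. by move=> lf lg; rewrite -!(innerJ _ g) innerZl// rmorphM. Qed.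

Lemma innerNl f g : l2 m f -> l2 m g -> inner m (fun x => - f x) g = - inner m f g.
Proof.
move=> lf lg; rewrite -[RHS]mulN1r -(innerZl (-1) lf lg); congr (inner m _ g).
by apply/funext => x; rewrite mulN1r.
Qed.

Lemma innerBl f g h : l2 m f -> l2 m g -> l2 m h ->
  inner m (fun x => f x - g x) h = inner m f h - inner m g h.
Proof. by move=> lf lg lh; rewrite innerDl ?innerNl//; exact: (l2N m0). Qed.

Lemma innerBr f g h : l2 m f -> l2 m g -> l2 m h ->
  inner m h (fun x => f x - g x) = inner m h f - inner m h g.
Proof. by move=> lf lg lh; rewrite -!(innerJ _ h) innerBl// rmorphB. Qed.

Lemma inner_self f : inner m f f = (norm2 m f)%:C.
Proof.
apply: eq_c => /=.
  by apply: eq_rsum => x; rewrite re_it /sq_weight /nsq !expr2.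
rewrite (@rsum_fin R V _ [::])// ?big_nil// => x _.
by rewrite -/(it f f x) im_it; ring.
Qed.

Lemma inner_finr f g s : uniq s -> (forall x, x \notin s -> g x = 0) ->
  inner m f g = \sum_(x <- s) (m x)%:C * f x * conjc (g x).
Proof. by move=> us gs; apply: csum_fin => // x /gs ->; rewrite conjc0 mulr0. Qed.

Lemma inner_finl f g s : uniq s -> (forall x, x \notin s -> f x = 0) ->
  inner m f g = \sum_(x <- s) (m x)%:C * f x * conjc (g x).
Proof. by move=> us fs; apply: csum_fin => // x /fs ->; rewrite mulr0 mul0r. Qed.

Lemma inner0l f : inner m (fun=> 0) f = 0.
Proof. by rewrite (@inner_finl _ _ [::])// big_nil. Qed.
Lemma inner0r f : inner m f (fun=> 0) = 0.
Proof. by rewrite (@inner_finr _ _ [::])// big_nil. Qed.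

Lemma norm2D f g c : l2 m f -> l2 m g ->
  norm2 m (fun x => f x + c * g x) =
  norm2 m f + 2 * re (conjc c * inner m f g) + nsq c * norm2 m g.
Proof.
move=> lf lg; have lcg := l2Z m0 c lg; have lfg := l2D m0 lf lcg.
have : re (inner m (fun x => f x + c * g x) (fun x => f x + c * g x)) =
   norm2 m (fun x => f x + c * g x) by rewrite inner_self.
move=> <-; rewrite innerDl// !innerDr// innerZl// !innerZr// innerZl// !inner_self.
by rewrite -(innerJ f g) /nsq !ReIm /=; ring.
Qed.

Lemma cauchy_schwarz f g : l2 m f -> l2 m g ->
  nsq (inner m f g) <= norm2 m f * norm2 m g.
Proof.
move=> lf lg; apply: discriminant_le; try exact: norm2_ge0.
by move=> w; rewrite -norm2D//; exact: norm2_ge0.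
Qed.

Lemma l2_cvg_norm u f : l2_cvg m u f -> (fun n => norm2 m (fun x => u n x - f x)) @ \oo --> (0 : R).
Proof.
move=> /(l2_cvgP m0)[lu lf h]; apply/cvg_epsP => e e0; have [N hN] := h e e0.
by exists N => n /hN; rewrite subr0 ger0_norm// norm2_ge0.
Qed.

Lemma l2_cvg_pcvg u f : l2_cvg m u f -> pcvg u f.
Proof.
move=> c x; apply/ccvg_nsqP; have [lu lf _] := c.
apply/cvg_epsP => e e0; have /cvg_epsP/(_ (m x * e))[|N hN] := l2_cvg_norm c.
  exact: mulr_gt0.
exists N => n /hN; rewrite !subr0 !ger0_norm ?norm2_ge0 ?nsq_ge0// => h.
have := norm2_point m0 x (l2B m0 (lu n) lf); move=> /le_lt_trans; apply.
by rewrite ltr_pdivrMl.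
Qed.

Lemma l2_cvg_bounded u f : l2_cvg m u f -> exists C, forall n, norm2 m (u n) <= C.
Proof.
move=> c; have [lu lf _] := c; have /cvg_epsP/(_ 1 ltr01)[N hN] := l2_cvg_norm c.
have fin k : exists C, forall n, (n < k)%N -> norm2 m (u n) <= C.
  elim: k => [|k [C hC]]; first by exists 0.
  exists (Num.max C (norm2 m (u k))) => n; rewrite ltnS leq_eqVlt => /orP[/eqP ->|/hC nC].
    by rewrite le_max lexx orbT.
  by rewrite le_max nC.
have [C hC] := fin N; exists (Num.max C (2 * 1 + 2 * norm2 m f)) => n.
have [/hC nC|Nn] := ltnP n N; first by rewrite le_max nC.
rewrite le_max; apply/orP; right.
have -> : u n = fun x => (u n x - f x) + f x by apply/funext => x; rewrite subrK.
apply: (le_trans (norm2D_le m0 (l2B m0 (lu n) lf) lf)).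
rewrite lerD2r ler_pM2l//; have := hN n Nn.
by rewrite subr0 ger0_norm ?norm2_ge0// => /ltW.
Qed.

Lemma inner_cvg u v f g : l2_cvg m u f -> l2_cvg m v g ->
  ccvg (fun n => inner m (u n) (v n)) (inner m f g).
Proof.
move=> cu cv; have [lu lf _] := cu; have [lv lg _] := cv.
have [C hC] := l2_cvg_bounded cv.
have C0 : 0 <= C by rewrite (le_trans (norm2_ge0 m0 (v 0)) (hC 0)).
apply/ccvg_nsqP.
have bound n : nsq (inner m (u n) (v n) - inner m f g) <=
   2 * (norm2 m (fun x => u n x - f x) * C) + 2 * (norm2 m f * norm2 m (fun x => v n x - g x)).
  have -> : inner m (u n) (v n) - inner m f g =
     inner m (fun x => u n x - f x) (v n) + inner m f (fun x => v n x - g x).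
    by rewrite innerBl// innerBr//; ring.
  apply: (le_trans (nsqD_le _ _)); rewrite lerD// ler_pM2l//.
    apply: (le_trans (cauchy_schwarz (l2B m0 (lu n) lf) (lv n))).
    by rewrite ler_wpM2l// norm2_ge0.
  exact: (cauchy_schwarz lf (l2B m0 (lv n) lg)).
have lim : (fun n => 2 * (norm2 m (fun x => u n x - f x) * C) +
    2 * (norm2 m f * norm2 m (fun x => v n x - g x))) @ \oo
    --> 2 * (0 * C) + 2 * (norm2 m f * 0).
  apply: cvgD; apply: cvgM; try exact: cvg_cst; apply: cvgM; try exact: cvg_cst; exact: l2_cvg_norm.
rewrite mul0r !mulr0 addr0 in lim.
apply: (squeeze_cvgr _ (cvg_cst 0) lim); apply: nearW => n.
by rewrite nsq_ge0 bound.
Qed.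

Lemma l2_cvg_cst f : l2 m f -> l2_cvg m (fun=> f) f.
Proof.
move=> lf; apply/(l2_cvgP m0); split => // e e0; exists 0%N => n _.
rewrite (@norm2_fin _ _ m _ [::])// ?big_nil// => x _; by rewrite subrr.
Qed.

Lemma l2_cvgD u v f g : l2_cvg m u f -> l2_cvg m v g ->
  l2_cvg m (fun n x => u n x + v n x) (fun x => f x + g x).
Proof.
move=> /(l2_cvgP m0)[lu lf uf] /(l2_cvgP m0)[lv lg vg].
apply/(l2_cvgP m0); split => [n||e e0]; [exact: (l2D m0)|exact: (l2D m0)|].
have e4 : 0 < e / 4 by rewrite divr_gt0.
have [N hN] := uf _ e4; have [M hM] := vg _ e4; exists (maxn N M) => n.
rewrite geq_max => /andP[/hN h1 /hM h2].
rewrite (_ : (fun x => _) = fun x => (u n x - f x) + (v n x - g x)); last first.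
  by apply/funext => x; ring.
by apply: (le_lt_trans (norm2D_le m0 (l2B m0 (lu n) lf) (l2B m0 (lv n) lg))); lra.
Qed.

Lemma l2_cvgZ c u f : l2_cvg m u f -> l2_cvg m (fun n x => c * u n x) (fun x => c * f x).
Proof.
move=> /(l2_cvgP m0)[lu lf uf].
apply/(l2_cvgP m0); split => [n||e e0]; [exact: (l2Z m0)|exact: (l2Z m0)|].
have c1 : 0 < nsq c + 1 by rewrite ltr_pwDr// nsq_ge0.
have [N hN] := uf (e / (nsq c + 1)) (divr_gt0 e0 c1); exists N => n /hN h.
rewrite (_ : (fun x => _) = fun x => c * (u n x - f x)); last first.
  by apply/funext => x; ring.
rewrite (norm2Z m0)//; last exact: (l2B m0).
rewrite ltr_pdivlMr// mulrC in h; apply: le_lt_trans h.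
by rewrite ler_wpM2r ?norm2_ge0// lerDl.
Qed.

Lemma l2_cvgN u f : l2_cvg m u f -> l2_cvg m (fun n x => - u n x) (fun x => - f x).
Proof.
move=> /(l2_cvgZ (-1)).
rewrite (_ : (fun n x => -1 * u n x) = (fun n x => - u n x)); last first.
  by apply/funext => n; apply/funext => x; rewrite mulN1r.
by rewrite (_ : (fun x => -1 * f x) = (fun x => - f x))//; apply/funext => x; rewrite mulN1r.
Qed.

Lemma l2_cvgB u v f g : l2_cvg m u f -> l2_cvg m v g ->
  l2_cvg m (fun n x => u n x - v n x) (fun x => f x - g x).
Proof. by move=> uf /l2_cvgN; exact: l2_cvgD. Qed.

(** On a finite set [s] pointwise convergence is norm convergence; off [s] the sequence is uniformly
    small by tightness, and so is the limit, by Fatou. *)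
Lemma l2_cvg_tight u f : pcvg u f -> (forall n, l2 m (u n)) ->
  (forall e, 0 < e -> exists2 s, uniq s & forall n, norm2 m (off s (u n)) <= e) ->
  l2_cvg m u f.
Proof.
move=> uf lu tight.
have offc s : pcvg (fun n => off s (u n)) (off s f).
  by move=> x; rewrite /off; case: ifP => // _; exact: ccvg_cst.
have offf s e : uniq s -> (forall n, norm2 m (off s (u n)) <= e) ->
    l2 m (off s f) /\ norm2 m (off s f) <= e.
  move=> us h; apply: (fatou_norm2 m0 (N := 0) (offc s)) => [n _|n _]; first exact: (l2_off m0).
  exact: h.
have lf : l2 m f.
  have [s us h] := tight 1 ltr01.
  by have [/(l2_offE m0 us)] := offf s 1 us h.
apply/(l2_cvgP m0); split => // e e0.
(* Off [s] the difference costs at most [2 * e / 8 + 2 * e / 8], and [e / 4] is spent on [s]; the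
   total stays below [e]. *)
have [s us h] := tight (e / 8) (divr_gt0 e0 (ltr0n _ 8)).
have [_ h'] := offf s _ us h.
have c : (fun n => \sum_(x <- s) m x * nsq (u n x - f x)) @ \oo --> (0 : R).
  elim: s {us h h'} => [|x s ih]; first by under eq_fun do rewrite big_nil; exact: cvg_cst.
  have hx : (fun n => m x * nsq (u n x - f x)) @ \oo --> m x * 0.
    by apply: cvgM; [exact: cvg_cst|apply/ccvg_nsqP].
  rewrite (_ : (fun n => _) =
    fun n => m x * nsq (u n x - f x) + \sum_(x <- s) m x * nsq (u n x - f x)).
    by rewrite -[X in _ --> X](addr0 (0 : R)) -[X in X + _](mulr0 (m x)); exact: cvgD.
  by apply/funext => n; rewrite big_cons.
have /cvg_epsP/(_ (e / 4))[|N hN] := c; first by rewrite divr_gt0.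
exists N => n /hN; rewrite subr0 => h1.
have {h1} := le_lt_trans (ler_norm _) h1 => h1.
rewrite (norm2_split m0 us (l2B m0 (lu n) lf)).
have -> : off s (fun x => u n x - f x) = fun x => off s (u n) x - off s f x.
  by apply/funext => x; rewrite /off; case: ifP => //; rewrite subrr.
have := norm2B_le m0 (l2_off m0 s (lu n)) (l2_off m0 s lf).
have := h n; lra.
Qed.

Lemma l2_cvg_dominated u f g : pcvg u f -> l2 m g ->
  (forall n x, nsq (u n x) <= nsq (g x)) -> l2_cvg m u f.
Proof.
move=> uf lg ug; apply: l2_cvg_tight => // [n|e e0].
  by apply: (l2_dom m0 (C := 1) _ lg) => x; rewrite mul1r.
have [s us /ltW h] := norm2_tail m0 lg e0; exists s => // n.
apply: le_trans h; rewrite -[leRHS]mul1r; apply: (norm2_dom m0) => [x|]; last exact: (l2_off m0).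
by rewrite mul1r /off; case: ifP.
Qed.

Lemma cauchy_real (w : nat -> R) :
  (forall e, 0 < e -> exists N, forall n k, (N <= n)%N -> (N <= k)%N -> `|w n - w k| < e) ->
  exists l : R, w @ \oo --> l.
Proof.
move=> h; suff : cvg (w @ \oo) by move=> c; exists (lim (w @ \oo)).
apply: cauchy_cvg; apply: cauchy_exP => e /h[N hN]; exists (w N).
by exists N => // n /= Nn; apply: hN.
Qed.

(** Point evaluations are bounded on l2, so a Cauchy sequence has a pointwise limit; Fatou, applied
    to [u n - u k] as [k] grows, turns the Cauchy bound into a bound for the distance to this
    limit. *)
Lemma l2_complete u : (forall n, l2 m (u n)) ->
  (forall e, 0 < e -> exists N, forall n k, (N <= n)%N -> (N <= k)%N ->
     norm2 m (fun x => u n x - u k x) < e) ->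
  exists f, l2_cvg m u f.
Proof.
move=> lu cau.
have pt x : exists l, ccvg (fun n => u n x) l.
  have small e : 0 < e -> exists N, forall n k, (N <= n)%N -> (N <= k)%N ->
      nsq (u n x - u k x) < e ^+ 2.
    move=> e0; have [|N hN] := cau (m x * e ^+ 2); first by rewrite mulr_gt0// exprn_gt0.
    exists N => n k Nn Nk; apply: (le_lt_trans (norm2_point m0 x (l2B m0 (lu n) (lu k)))).
    by rewrite ltr_pdivrMl//; exact: hN.
  have [|a ca] := @cauchy_real (fun n => re (u n x)).
    move=> e e0; have [N hN] := small e e0; exists N => n k Nn Nk.
    rewrite -reN -reD -(@ltr_pXn2r _ 2)// ?nnegrE ?(ltW e0)// real_normK ?num_real//.
    by apply: le_lt_trans (hN _ _ Nn Nk); exact: re_sq_le.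
  have [|b cb] := @cauchy_real (fun n => im (u n x)).
    move=> e e0; have [N hN] := small e e0; exists N => n k Nn Nk.
    rewrite -imN -imD -(@ltr_pXn2r _ 2)// ?nnegrE ?(ltW e0)// real_normK ?num_real//.
    by apply: le_lt_trans (hN _ _ Nn Nk); exact: im_sq_le.
  by exists (a +i* b).
have [f hf] := choice pt; exists f.
have ftail N e : (forall n k, (N <= n)%N -> (N <= k)%N -> norm2 m (fun x => u n x - u k x) < e) ->
    forall n, (N <= n)%N -> l2 m (fun x => u n x - f x) /\ norm2 m (fun x => u n x - f x) <= e.
  move=> h n Nn; apply: (fatou_norm2 m0 (N := N) (u := fun k x => u n x - u k x)).
  - by move=> x; apply: ccvgB => //; exact: ccvg_cst.
  - by move=> k _; exact: (l2B m0).
  - by move=> k Nk; apply/ltW/h.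
have lf : l2 m f.
  have [N hN] := cau 1 ltr01; have [l _] := ftail _ _ hN N (leqnn N).
  rewrite (_ : f = fun x => u N x - (u N x - f x)); first exact: (l2B m0).
  by apply/funext => x; ring.
apply/(l2_cvgP m0); split => // e e0.
have [N hN] := cau (e / 2) (divr_gt0 e0 (ltr0n _ 2)); exists N => n Nn.
by have [_ h] := ftail _ _ hN n Nn; apply: (le_lt_trans h); lra.
Qed.

End Inner.

(** * Diagonal extraction *)

Section Subsequences.
Variables (R : realType).

(** By Tychonoff the product of the segments [[- C x, C x]] is compact, so the sequence has a
    cluster point in the product topology, whose neighbourhoods restrict finitely many
    coordinates. *)
Lemma cluster_point_bounded (V : countType) (u : nat -> V -> R) (C : V -> R) :
  (forall n x, `|u n x| <= C x) ->
  exists p : V -> R, forall (s : seq V) (e : R) (N : nat), 0 < e ->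
    exists2 n, (N <= n)%N & forall x, x \in s -> `|p x - u n x| < e.
Proof.
move=> uC; pose T := prod_topology (fun _ : V => R : topologicalType).
have cpt : compact ([set f | forall x, f x \in `[- C x, C x]] : set T).
  have := @tychonoff V (fun=> R) (fun x => [set` `[- C x, C x]]) (fun x => @segment_compact _ _ _).
  exact.
pose F : set_system T := (u : nat -> T) @ \oo.
have [|p [_ clp]] := cpt F _.
  by exists 0%N => // n _ /= x; rewrite in_itv /= -ler_norml.
exists p => s e N e0.
have nb : nbhs (p : T) [set f : T | forall x, x \in s -> `|p x - f x| < e].
  elim: s => [|x s ih]; first by apply: filterS filterT => f _ x.
  have hx : nbhs (p : T) [set f : T | `|p x - f x| < e].
    have := @proj_continuous V (fun=> R) x p => /(_ (ball (p x) e)); apply.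
    exact: nbhsx_ballx.
  apply: filterS (filterI hx ih) => f [h1 h2] y; rewrite inE => /orP[/eqP ->//|].
  exact: h2.
have FN : F [set f : T | exists2 n, (N <= n)%N & f = u n].
  by exists N => // n /= Nn; exists n.
by have [f [[n Nn ->] h]] := clp _ _ FN nb; exists n.
Qed.

(** An increasing exhaustion of [V] by finite lists: the elements with code below [k]. *)
Definition upto (V : countType) k := pmap (@pickle_inv V) (iota 0 k).

Lemma upto_uniq (V : countType) k : uniq (upto V k).
Proof. exact/(pmap_uniq (@pickle_invK V))/iota_uniq. Qed.

Lemma mem_upto (V : countType) k (x : V) : (pickle x < k)%N -> x \in upto V k.
Proof.
by move=> xk; rewrite mem_pmap; apply/mapP; exists (pickle x); rewrite ?mem_iota ?pickleK_inv.
Qed.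

(** The cluster point replaces a diagonal argument: the [k]-th index is chosen after the previous
    one so that [u] is within [1 / (k + 1)] of the cluster point at the first [k] coordinates, and
    every coordinate is eventually among these. *)
Lemma diagonal_subsequence (V : countType) (u : nat -> cfun R V) (C : V -> R) :
  (forall n x, nsq (u n x) <= C x) ->
  exists (phi : nat -> nat) (f : cfun R V), {homo phi : n k / (n < k)%N} /\
    pcvg (fun n => u (phi n)) f.
Proof.
move=> uC.
(* Real and imaginary parts become separate real coordinates, indexed by the boolean, so that one
   cluster point serves both. *)
pose w n (q : V * bool) := if q.2 then re (u n q.1) else im (u n q.1).
have wC n q : `|w n q| <= Num.sqrt (C q.1).
  rewrite -sqrtr_sqr ler_wsqrtr// (le_trans _ (uC n q.1))// /w.
  by case: q.2; [exact: re_sq_le|exact: im_sq_le].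
have [p hp] := cluster_point_bounded wC.
pose s k := upto (V * bool)%type k.
(* The pair holds a lower bound for the next index and the stage, which fixes both the precision and
   the list of coordinates. *)
have step (Nk : nat * nat) : exists n, (Nk.1 <= n)%N /\
    forall q, q \in s Nk.2 -> `|p q - w n q| < Nk.2.+1%:R^-1.
  have [|n Nn h] := hp (s Nk.2) Nk.2.+1%:R^-1 Nk.1; last by exists n.
  by rewrite invr_gt0 ltr0Sn.
have [nxt hn] := choice step.
pose fix phi k := if k is k'.+1 then nxt ((phi k').+1, k) else nxt (0%N, 0%N).
have phiS k : (phi k < phi k.+1)%N by have [] := hn ((phi k).+1, k.+1).
have phiP k q : q \in s k -> `|p q - w (phi k) q| < k.+1%:R^-1.
  by case: k => [|k]; [have [_] := hn (0%N, 0%N)|have [_] := hn ((phi k).+1, k.+1)]; apply.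
exists phi, (fun x => p (x, true) +i* p (x, false)); split.
  exact: (homo_ltn ltn_trans).
have cw q : (fun k => w (phi k) q) @ \oo --> p q.
  apply/cvg_epsP => e e0.
  have [N _ hN] := near_infty_natSinv_lt (PosNum e0).
  exists (maxn N (pickle q).+1) => k; rewrite geq_max => /andP[Nk qk].
  rewrite distrC; apply: (lt_trans (phiP k q (mem_upto qk))); exact: hN.
by move=> x; split; [exact: (cw (x, true))|exact: (cw (x, false))].
Qed.

End Subsequences.

(** * Spectral resolutions *)

Import HBNNSimple.

(** * First moments of finite measures concentrated on a set *)

Section MeasureR.
Variable (R : realType).
Local Notation T := (measurableTypeR R).

(** Integrals are suprema over simple functions, which evaluate the set function only on measurable
    sets. This allows [spectral_mass], a bare set function, to be replaced by a genuine measure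
    under the integral. *)
Lemma integral_congr (mu nu : set T -> \bar R) (f : T -> \bar R) :
  (forall A, measurable A -> mu A = nu A) ->
  (\int[mu]_t f t = \int[nu]_t f t)%E.
Proof.
move=> e; have se (h : {nnsfun T >-> R}) : sintegral mu h = sintegral nu h.
  by rewrite /sintegral; apply: eq_fsbigr => x _; rewrite e.
by rewrite /integral; congr (ereal_sup _ - ereal_sup _)%E; apply/seteqP;
  split=> _ [h hf <-]; exists h.
Qed.

Section Concentrated.
Variables (nu : {measure set T -> \bar R}) (c : R).
Hypothesis nuT : nu [set: T] = c%:E.
Hypothesis sq_fin : (\int[nu]_t (t ^+ 2)%:E < +oo)%E.

Let integrable_cst (k : R) : nu.-integrable [set: T] (EFin \o cst k).
Proof.
apply/integrableP; split; first exact/measurable_EFinP.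
under eq_integral do rewrite /=.
by rewrite integral_cst// nuT -EFinM ltry.
Qed.

(** Since [|t| <= 1 + t ^+ 2], which follows from the squares of [t - 1] and [t + 1], a finite
    measure with finite second moment has a first moment. *)
Let integrable_id : nu.-integrable [set: T] (EFin \o (fun t : T => t : R)).
Proof.
have isq : nu.-integrable [set: T] (EFin \o (fun t : T => t ^+ 2 : R)).
  apply/integrableP; split; first by apply/measurable_EFinP; exact: exprn_measurable.
  by under eq_integral do rewrite /= ger0_norm ?sqr_ge0//.
apply: le_integrable (integrableD measurableT (integrable_cst 1) isq) => //=.
  by apply/measurable_EFinP; exact: measurable_id.
move=> t _; rewrite lee_fin (ger0_norm (addr_ge0 _ (sqr_ge0 _)))//.
have := sqr_ge0 (t - 1); have := sqr_ge0 (t + 1).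
by case: (ler0P t) => _; rewrite !expr2 => h1 h2; lra.
Qed.

Variables (D : set T) (s a : R).
Hypotheses (mD : measurable D) (nuD : nu (~` D) = 0%E).

(** The sign [s] will be 1 or -1, so that one statement bounds the first moment by [a * c] from
    below or from above. *)
Let g (t : T) : R := s * (t - a).

Let integrable_g : nu.-integrable [set: T] (EFin \o g).
Proof.
have h := integrableB measurableT integrable_id (integrable_cst a).
have := integrableZl measurableT s h; apply: eq_integrable => //.
Qed.

Let integral_g : (\int[nu]_(t in D) (g t)%:E)%E = (s * (fine (\int[nu]_t t%:E)%E - a * c))%:E.
Proof.
have -> : D = [set: T] `\` ~` D by rewrite setTD setCK.
rewrite -(negligible_integral _ _ integrable_g)//; last exact: measurableC.
rewrite (eq_integral (fun t : T => s%:E * (t%:E - a%:E))%E) => [|t _];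
  last by rewrite -EFinB -EFinM.
rewrite integralZl//; last exact: (integrableB measurableT integrable_id (integrable_cst a)).
rewrite (integralB measurableT integrable_id (integrable_cst a)).
rewrite [X in (_ - X)%E](_ : _ = (a * c)%:E); last by rewrite EFinM -nuT -integral_cst.
rewrite [RHS]EFinM EFinB fineK//; exact: (integrable_fin_num measurableT integrable_id).
Qed.

Lemma concentrated_le : (forall t, D t -> 0 <= g t) ->
  0 <= s * (fine (\int[nu]_t t%:E)%E - a * c).
Proof.
move=> g0; rewrite -lee_fin -integral_g; apply: integral_ge0 => t Dt.
by rewrite lee_fin g0.
Qed.

(** If the integral of the positive function [g] over [D] vanished, then [D] would be negligible;
    its complement is negligible as well, contradicting the total mass [c > 0]. *)
Lemma concentrated_lt : (forall t, D t -> 0 < g t) -> 0 < c ->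
  0 < s * (fine (\int[nu]_t t%:E)%E - a * c).
Proof.
move=> g0 c0; rewrite lt_neqAle concentrated_le ?andbT => [|t /g0/ltW//].
apply/negP => /eqP e.
have mg : measurable_fun D (EFin \o g).
  by have /integrableP[+ _] := integrable_g; exact: measurable_funS.
have /(ae_eq_integral_abs _ mD mg) : (\int[nu]_(t in D) `|(EFin \o g) t| = 0)%E.
  under eq_integral => t do [rewrite inE => Dt; rewrite gee0_abs; last by rewrite lee_fin ltW// g0].
  by rewrite integral_g -e.
move=> [N [mN N0 DN]].
have DsN : D `<=` N.
  move=> t Dt; apply: DN => /= /(_ Dt) [] /eqP; rewrite gt_eqF//; exact: g0.
have D0 : nu D = 0%E by apply: subset_measure0 DsN N0.
have U : nu (D `|` ~` D) = (nu D + nu (~` D))%E.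
  by apply: measureU => //; [exact: measurableC|exact: setICr].
move: U; rewrite D0 nuD adde0 setUv nuT => -[] c00.
by rewrite c00 ltxx in c0.
Qed.

End Concentrated.
End MeasureR.

Section SpectralMeasure.
Variables (R : realType) (V : countType) (m : V -> R).
Hypothesis m0 : forall x, 0 < m x.
Local Notation T := (measurableTypeR R).
Implicit Types (f g h : cfun R V) (A B : set T).

(** [<P f, f> = <P (P f), f> = <P f, P f>] by idempotence and symmetry. *)
Lemma projection_norm (P : cfun R V -> cfun R V) f : orthogonal_projection m P ->
  l2 m f -> inner m (P f) f = (norm2 m (P f))%:C.
Proof.
move=> [Pl _ PP Ps] lf; rewrite -(inner_self m) -{1}(PP f lf) Ps//; exact: Pl.
Qed.

Variable E : set T -> cfun R V -> cfun R V.
Hypothesis pvmE : projection_valued_measure m E.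

Lemma spectral_massE f A : l2 m f -> measurable A ->
  spectral_mass m E f A = (norm2 m (E A f))%:E.
Proof.
by move=> lf mA; have [/(_ A mA) oE _ _] := pvmE; rewrite /spectral_mass projection_norm.
Qed.

(* The partial sums of the constant family [set0] are [n *: E set0 f], and converge. *)
Lemma pvm_set0 f : l2 m f -> E set0 f = fun=> 0.
Proof.
move=> lf; have [_ _ /(_ (fun=> set0))] := pvmE.
move=> /(_ (fun=> measurable0)) h.
have {h} := h _ f lf; rewrite bigcup0// => /(_ _)/(l2_cvg_pcvg m0) h.
apply/funext => x.
have {h} [|cr ci] := h _ x; first by move=> i j _ _ [y []].
have shift (u : nat -> R) (l : R) : u @ \oo --> l -> (fun n => u n.+1) @ \oo --> l.
  move=> /cvg_epsP c; apply/cvg_epsP => e /c[N hN]; exists N => n Nn.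
  by apply: hN; rewrite (leq_trans Nn).
apply: (@ccvg_unique _ (fun n => \sum_(k < n.+1) E set0 f x - \sum_(k < n) E set0 f x)).
  rewrite (_ : (fun n => _) = fun=> E set0 f x); first exact: ccvg_cst.
  by apply/funext => n; rewrite big_ord_recr /= addrAC subrr add0r.
rewrite -[X in ccvg _ X](subrr (E set0 f x)); apply: ccvgB; last by split.
by split; [exact: (shift (fun n => re (\sum_(k < n) E set0 f x)))
          |exact: (shift (fun n => im (\sum_(k < n) E set0 f x)))].
Qed.

(** Countable additivity in l2 is paired with [f]: the inner product is continuous, and [<E A f, f>]
    is the squared norm of [E A f]. *)
Lemma pvm_measure f : l2 m f -> exists nu : {measure set T -> \bar R},
  forall A, measurable A -> nu A = (norm2 m (E A f))%:E.
Proof.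
move=> lf.
pose mu A : \bar R := if `[< measurable A >] then (norm2 m (E A f))%:E else 0%E.
have muE A : measurable A -> mu A = (norm2 m (E A f))%:E.
  by move=> mA; rewrite /mu; case: asboolP.
have mu0 : mu set0 = 0%E.
  rewrite muE// pvm_set0//; congr EFin.
  by rewrite (@norm2_fin _ _ m _ [::])// big_nil.
have mu_ge0 A : (0 <= mu A)%E by rewrite /mu; case: asboolP => // _; rewrite lee_fin norm2_ge0.
have mu_sigma : semi_sigma_additive mu.
  move=> F mF tF mUF; rewrite muE// [X in X @ _ --> _](_ : _ =
    fun n => (re (inner m (fun x => \sum_(k < n) E (F k) f x) f))%:E); last first.
    apply/funext; elim=> [|n ih].
      rewrite big_nil (_ : (fun x => _) = fun=> 0) ?inner0l//.
      by apply/funext => x; rewrite big_ord0.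
    have l2s k : l2 m (fun x => \sum_(i < k) E (F i) f x).
      by have [_ _ /(_ F mF tF f lf)[]] := pvmE.
    rewrite big_nat_recr// ih muE//.
    have -> : (fun x => \sum_(k < n.+1) E (F k) f x) =
      (fun x => \sum_(k < n) E (F k) f x + E (F n) f x).
      by apply/funext => x; rewrite big_ord_recr.
    have [/(_ _ (mF n)) oE _ _] := pvmE.
    rewrite innerDl//; last by have [/(_ f lf)] := oE.
    by rewrite projection_norm// reD.
  have [/(_ _ mUF) oE _ /(_ F mF tF f lf) cF] := pvmE.
  have [c _] := inner_cvg m0 cF (l2_cvg_cst m0 lf); rewrite projection_norm// /= in c.
  by apply: cvg_EFin => //; exact: nearW.
pose nu : {measure set T -> \bar R} :=
  HB.pack mu (isMeasure.Build _ T R mu mu0 mu_ge0 mu_sigma).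
by exists nu.
Qed.

End SpectralMeasure.

(** * Form bounds read off a spectral resolution *)

Section Resolution.
Variables (R : realType) (V : countType) (m : V -> R).
Hypothesis m0 : forall x, 0 < m x.
Local Notation T := (measurableTypeR R).
Implicit Types (f g h : cfun R V) (A B : set T).
Variables (H : operator R V) (E : set T -> cfun R V -> cfun R V).
Hypothesis resE : spectral_resolution m H E.
Let pvmE : projection_valued_measure m E. Proof. by case: resE. Qed.

(** Restates the domain and value clauses of [spectral_resolution] for a genuine measure, so that
    measure theory becomes applicable. *)
Lemma spectral_measure f : l2 m f -> exists nu : {measure set T -> \bar R},
  [/\ forall A, measurable A -> nu A = (norm2 m (E A f))%:E,
      nu [set: T] = (norm2 m f)%:E,
      (exists g, H (f, g)) <-> (\int[nu]_t (t ^+ 2)%:E < +oo)%E &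
      forall g, H (f, g) -> inner m g f = (fine (\int[nu]_t t%:E)%E)%:C].
Proof.
move=> lf; have [nu nuE] := pvm_measure m0 pvmE lf; have [_ domE HE] := resE.
have e A : measurable A -> spectral_mass m E f A = nu A.
  by move=> mA; rewrite nuE// (spectral_massE pvmE).
exists nu; split => //.
- by rewrite nuE//; have [_ /(_ f lf) -> _] := pvmE.
- rewrite domE (integral_congr _ e); split=> [[]//|]; by split.
- by move=> g /HE[_ ->]; rewrite (integral_congr _ e).
Qed.

(** The spectral measure of [f] lives on []lambda, +oo[], where [t - lambda] is positive, so its
    mean strictly exceeds [lambda] times its mass. *)
Lemma spectral_lower f g (lambda : R) : H (f, g) -> E `]-oo, lambda] f = (fun=> 0) ->
  0 < norm2 m f -> lambda * norm2 m f < re (inner m g f).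
Proof.
move=> Hfg Ef f0; have [_ domE _] := resE.
have [lf _] : l2 m f /\ (\int[spectral_mass m E f]_t (t ^+ 2)%:E < +oo)%E.
  by apply/domE; exists g.
have [nu [nuE nuT nusq ->//]] := spectral_measure lf.
have sq : (\int[nu]_t (t ^+ 2)%:E < +oo)%E by apply/nusq; exists g.
have nuD : nu (~` `]lambda, +oo[) = 0%E.
  rewrite setCitvr nuE// Ef; congr EFin.
  by rewrite (@norm2_fin _ _ m _ [::])// big_nil.
have := concentrated_lt (s := 1) (a := lambda) nuT sq (measurable_itv _) nuD _ f0.
rewrite mul1r subr_gt0 => h; apply: h => t /=.
by rewrite in_itv /= andbT mul1r subr_gt0.
Qed.

Lemma spectral_mass_compl (nu : {measure set T -> \bar R}) f D :
  (forall A, measurable A -> nu A = (norm2 m (E A f))%:E) ->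
  nu [set: T] = (norm2 m f)%:E ->
  measurable D -> E D f = f -> nu (~` D) = 0%E.
Proof.
move=> nuE nuT mD Df.
have U : nu (D `|` ~` D) = (nu D + nu (~` D))%E.
  by apply: measureU => //; [exact: measurableC|exact: setICr].
move: U; rewrite setUv nuT (nuE _ mD) Df (nuE (~` D)); last exact: measurableC.
rewrite -EFinD => -[] e; congr EFin; apply: (@addrI _ (norm2 m f)).
by rewrite -e addr0.
Qed.

Lemma sq_integral_bounded (nu : {measure set T -> \bar R}) D (c b : R) :
  nu [set: T] = c%:E -> measurable D -> nu (~` D) = 0%E ->
  (forall t, D t -> t ^+ 2 <= b) -> (\int[nu]_t (t ^+ 2)%:E < +oo)%E.
Proof.
move=> nuT mD nuD Db.
have msq : measurable_fun [set: T] (fun t : T => (t ^+ 2)%:E).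
  by apply/measurable_EFinP; exact: exprn_measurable.
rewrite (ge0_negligible_integral (measurableC mD))//; last by move=> t _; rewrite lee_fin sqr_ge0.
rewrite setTD setCK; apply: (@le_lt_trans _ _ (\int[nu]_(t in D) cst b%:E t)%E).
  apply: ge0_le_integral => //.
  - by move=> t _; rewrite lee_fin sqr_ge0.
  - by apply: measurable_funS msq.
rewrite integral_cst//.
have cD : (nu D <= c%:E)%E by rewrite -nuT le_measure ?inE.
have fD : nu D \is a fin_num by rewrite ge0_fin_numE// (le_lt_trans cD) ?ltry.
by rewrite -(fineK fD) -EFinM ltry.
Qed.

Hypothesis H_ge0 : forall f g, H (f, g) -> 0 <= re (inner m g f).

(** The lower end [- k] bounds the second moment, which puts [h = E f] into the domain of [H]. Then
    [<H h, h>] is non-negative by [H_ge0], but it is the first moment of a measure on negative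
    numbers; hence [h = 0]. *)
Lemma spectral_neg k f : l2 m f -> E `[- k%:R, 0[ f = fun=> 0.
Proof.
move=> lf; have mB : measurable (`[- k%:R, 0[%classic : set T) by [].
have [/(_ _ mB)[El _ EE _] _ _] := pvmE.
set h := E _ f; have lh : l2 m h by exact: El.
have Eh : E `[- k%:R, 0[ h = h by exact: EE.
have [nu [nuE nuT nusq nuH]] := spectral_measure lh.
have nuD := spectral_mass_compl nuE nuT mB Eh.
have sq : (\int[nu]_t (t ^+ 2)%:E < +oo)%E.
  apply: (sq_integral_bounded (b := k%:R ^+ 2) nuT mB nuD) => t /=;
    rewrite in_itv /= => /andP[t1 t2].
  by rewrite -sqrrN ler_pXn2r ?nnegrE//; lra.
have /nusq [g Hhg] := sq.
apply/funext => x; apply: (norm2_eq0 m0 lh).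
apply/eqP; apply: contrapT => /negP hn0.
have hp : 0 < norm2 m h by rewrite lt_neqAle eq_sym hn0 norm2_ge0.
have := concentrated_lt (s := -1) (a := 0) nuT sq mB nuD _ hp.
have := H_ge0 Hhg; rewrite (nuH _ Hhg) /= => h1.
rewrite mul0r subr0 mulN1r oppr_gt0 ltNge h1 /= => h2; have : false; last by [].
by apply: h2 => t /=; rewrite in_itv /= subr0 mulN1r oppr_gt0 => /andP[].
Qed.

(** Membership of [f] in the domain needs a finite second moment. The negative half-line is a
    countable union of the bounded intervals of [spectral_neg], so the spectral measure is
    concentrated on [[0, lambda]], where [t ^+ 2 <= lambda ^+ 2]. *)
Lemma spectral_upper f (lambda : R) : l2 m f -> E `]-oo, lambda] f = f ->
  exists2 g, H (f, g) & re (inner m g f) <= lambda * norm2 m f.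
Proof.
move=> lf Ef; have [nu [nuE nuT nusq nuH]] := spectral_measure lf.
have nup := spectral_mass_compl nuE nuT (measurable_itv _) Ef.
have nun : nu `]-oo, 0[%classic = 0%E.
  have -> : `]-oo, 0[%classic = \bigcup_k (`[- k%:R, 0[%classic : set T).
    apply/seteqP; split=> [t|t [k _]] /=; rewrite !in_itv /=; last by case/andP.
    move=> t0; exists (Num.truncn `|t|).+1 => //=; rewrite in_itv /= t0 andbT.
    have := truncnS_gt `|t|; rewrite ltr0_norm//; lra.
  apply/(negligibleP); first exact: bigcup_measurable.
  apply: negligible_bigcup => k; apply/negligibleP => //.
  have : nu (`[- k%:R, 0[%classic : set T) = (norm2 m (E `[- k%:R, 0[ f))%:E by exact: nuE.
  by rewrite spectral_neg// (@norm2_fin _ _ m _ [::])// big_nil.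
have mD : measurable (`[0, lambda]%classic : set T) by [].
have nuD : nu (~` `[0, lambda]) = 0%E.
  have s : ~` `[0, lambda]%classic `<=` `]-oo, 0[%classic `|` ~` (`]-oo, lambda]%classic : set T).
    move=> t /=; rewrite !in_itv /= => h; case: (ltP t 0) => t0; [by left|right].
    by move=> tl; apply: h; rewrite t0 tl.
  apply: (subset_measure0 (measurableC mD) _ s).
    by apply: measurableU => //; exact: measurableC.
  apply/eqP; rewrite eq_le measure_ge0 andbT.
  have mC : measurable (~` (`]-oo, lambda]%classic : set T)) by exact: measurableC.
  have := measureU2 nu (measurable_itv `]-oo, 0[) mC.
  by rewrite [X in (_ <= X + _)%E]nun [X in (_ <= _ + X)%E]nup adde0.
have sq : (\int[nu]_t (t ^+ 2)%:E < +oo)%E.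
  apply: (sq_integral_bounded (b := lambda ^+ 2) nuT mD nuD) => t /=;
    rewrite in_itv /= => /andP[t1 t2].
  by rewrite ler_pXn2r ?nnegrE//; lra.
have /nusq [g Hfg] := sq; exists g => //; rewrite nuH//=.
have := concentrated_le (s := -1) (a := lambda) nuT sq mD nuD.
rewrite mulN1r opprB subr_ge0; apply => t /=.
by rewrite in_itv /= mulN1r opprB subr_ge0 => /andP[].
Qed.

End Resolution.

(** * Operators diagonal in an orthonormal basis *)

Section Discrete.
Variables (R : realType) (W : countType) (lam : W -> R) (a : W -> R).
Hypothesis a0 : forall w, 0 <= a w.
Local Notation T := (measurableTypeR R).

(** Turns sums over [W] into series over [nat], the form in which [mseries] builds measures. *)
Lemma esum_pickle (b : W -> \bar R) : (forall w, (0 <= b w)%E) ->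
  \esum_(w in [set: W]) b w =
  (\sum_(0 <= n <oo) (if pickle_inv n is Some w then b w else 0))%E.
Proof.
move=> b0; pose b' n := if pickle_inv n is Some w then b w else 0%E.
have b'0 n : (0 <= b' n)%E by rewrite /b'; case: pickle_inv.
rewrite (nneseries_esumT b'0).
have bij : set_bij [set: W] (range (@pickle W)) (@pickle W).
  split => [w _|w w' _ _ e|n [w _ <-]]; [by exists w| |by exists w].
  exact: (pcan_inj (@pickleK W)).
rewrite -[LHS](_ : \esum_(w in [set: W]) b' (pickle w) = _); last first.
  by apply: eq_esum => w _; rewrite /b' pickleK_inv.
rewrite -(reindex_esum _ _ _ b' bij) esum_mkcond.
apply: eq_esum => n _; case: ifPn => // /negP h; rewrite /b'.
case e : pickle_inv => [w|//]; exfalso; apply: h; rewrite inE; exists w => //.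
by have := @pickle_invK W n; rewrite /oapp e.
Qed.

(** Codes of no element of [W] get the point 0 with weight 0, and so contribute nothing to the
    measure. *)
Let point n : T := if @pickle_inv W n is Some w then lam w else 0.
Let weight_ n : R := if @pickle_inv W n is Some w then a w else 0.
Let weight_ge0 n : 0 <= weight_ n. Proof. by rewrite /weight_; case: pickle_inv. Qed.

Definition discrete_measure : {measure set T -> \bar R} :=
  mseries (fun n => mscale (NngNum (weight_ge0 n)) (dirac (point n) : {measure set T -> \bar R})) 0.

Lemma integral_discrete (phi : T -> \bar R) : measurable_fun [set: T] phi ->
  (forall t, (0 <= phi t)%E) ->
  (\int[discrete_measure]_t phi t = \esum_(w in [set: W]) ((a w)%:E * phi (lam w)))%E.
Proof.
move=> mphi phi0; rewrite ge0_integral_measure_series// esum_pickle; last first.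
  by move=> w; rewrite mule_ge0// lee_fin.
apply: eq_eseriesr => n _; rewrite ge0_integral_mscale// integral_dirac// diracT mul1e /=.
by rewrite /weight_ /point; case: pickle_inv => //; rewrite mul0e.
Qed.

Lemma discrete_measureE (A : set T) : measurable A ->
  discrete_measure A = \esum_(w in [set: W]) (if lam w \in A then a w else 0)%:E.
Proof.
move=> mA; rewrite -(setIT A) -integral_indic// integral_discrete; last first.
- by move=> t; rewrite lee_fin.
- by apply/measurable_EFinP; exact: measurable_indic.
by apply: eq_esum => w _; rewrite setIT -EFinM indicE; case: (lam w \in A); rewrite ?mulr1 ?mulr0.
Qed.

End Discrete.

Section Diagonal.
Variables (R : realType) (V W : countType) (m : V -> R) (m' : W -> R) (lam : W -> R).
Hypotheses (m0 : forall x, 0 < m x) (m'0 : forall w, 0 < m' w) (lam0 : forall w, 0 <= lam w).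
Variables (c : cfun R V -> cfun R W) (d : cfun R W -> cfun R V).
Local Notation T := (measurableTypeR R).
Implicit Types (f g h : cfun R V) (F G : cfun R W).
Hypotheses (dK : cancel c d) (cK : cancel d c).
Hypothesis c_lin : forall (z : R[i]) f g, c (fun x => z * f x + g x) = fun w => z * c f w + c g w.
Hypothesis c_l2 : forall f, l2 m f <-> l2 m' (c f).
Hypothesis c_norm : forall f, l2 m f -> norm2 m' (c f) = norm2 m f.

(** Polarisation: comparing the norms of [f + z * g] and of its image leaves the real parts of
    [conjc z] times the inner products; [z = 1] and [z = 'i] give the two parts. *)
Lemma isometry_inner f g : l2 m f -> l2 m g -> inner m' (c f) (c g) = inner m f g.
Proof.
move=> lf lg; have lcf : l2 m' (c f) by exact/c_l2. have lcg : l2 m' (c g) by exact/c_l2.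
have h (z : R[i]) : re (conjc z * inner m' (c f) (c g)) = re (conjc z * inner m f g).
  have e : (fun x => f x + z * g x) = (fun x => z * g x + f x).
    by apply/funext => x; rewrite addrC.
  have e' : (fun x => c f x + z * c g x) = (fun x => z * c g x + c f x).
    by apply/funext => x; rewrite addrC.
  have : norm2 m' (fun x => c f x + z * c g x) = norm2 m (fun x => f x + z * g x).
    by rewrite e e' -c_lin c_norm//; apply: (l2D m0) => //; exact: (l2Z m0).
  rewrite !norm2D// !c_norm//; lra.
apply: eq_c; first by have := h 1; rewrite conjc1 !mul1r.
by have := h 'i; rewrite !ReIm /= !mul0r !sub0r mulN1r mulN1r !opprK.
Qed.

Lemma isometryB f g : c (fun x => f x - g x) = fun w => c f w - c g w.
Proof.
have -> : (fun x => f x - g x) = fun x => (-1) * g x + f x.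
  by apply/funext => x; rewrite mulN1r addrC.
by rewrite c_lin; apply/funext => w; rewrite mulN1r addrC.
Qed.

Lemma isometry0 : c (fun=> 0) = fun=> 0.
Proof.
have -> : (fun=> 0) = (fun x : V => 0 - 0) :> cfun R V by apply/funext => x; rewrite subrr.
by rewrite isometryB; apply/funext => w; rewrite subrr.
Qed.

Lemma isometry_sum n (u : nat -> cfun R V) :
  c (fun x => \sum_(k < n) u k x) = fun w => \sum_(k < n) c (u k) w.
Proof.
elim: n => [|n ih].
  have -> : (fun x => \sum_(k < 0) u k x) = fun=> 0 by apply/funext => x; rewrite big_ord0.
  by rewrite isometry0; apply/funext => w; rewrite big_ord0.
have -> : (fun x => \sum_(k < n.+1) u k x) = fun x => 1 * u n x + \sum_(k < n) u k x.
  by apply/funext => x; rewrite big_ord_recr mul1r addrC.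
by rewrite c_lin ih; apply/funext => w; rewrite big_ord_recr mul1r addrC.
Qed.

Definition cut (A : set T) F : cfun R W := fun w => if lam w \in A then F w else 0.

Definition diag_projection (A : set T) f : cfun R V := d (cut A (c f)).
Local Notation E := diag_projection.

Lemma nsq_cut A F w : nsq (cut A F w) = if lam w \in A then nsq (F w) else 0.
Proof. by rewrite /cut; case: ifP; rewrite ?nsq0. Qed.

Lemma l2_cut A F : l2 m' F -> l2 m' (cut A F).
Proof.
apply: (l2_dom m'0 (C := 1)) => w; rewrite nsq_cut mul1r; case: ifP => // _; exact: nsq_ge0.
Qed.

Lemma diag_projectionE A f : c (E A f) = cut A (c f). Proof. exact: cK. Qed.

Lemma l2_diag_projection A f : l2 m f -> l2 m (E A f).
Proof. by move=> /c_l2 lf; apply/c_l2; rewrite diag_projectionE; exact: l2_cut. Qed.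

Lemma diag_orthogonal_projection A : orthogonal_projection m (E A).
Proof.
split.
- exact: l2_diag_projection.
- move=> z f g lf lg; apply: (can_inj dK); rewrite c_lin !diag_projectionE c_lin.
  by apply/funext => w; rewrite /cut; case: ifP => // _; rewrite mulr0 addr0.
- move=> f lf; apply: (can_inj dK); rewrite !diag_projectionE.
  by apply/funext => w; rewrite /cut; case: (lam w \in A).
- move=> f g lf lg; have lE h := @l2_diag_projection A h.
  rewrite -(isometry_inner (lE _ lf) lg) -(isometry_inner lf (lE _ lg))
    !diag_projectionE !innerE; congr csum.
  by apply/funext => w; rewrite /inner_term /cut; case: ifP; rewrite ?conjc0 ?(mulr0,mul0r).
Qed.

(** In coordinates, disjointness of the [A k] means that each [w] survives in at most one summand.
    Partial sums are then cut-offs of [c f]: eventually constant at each [w] and dominated by [c f],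
    which gives l2 convergence. *)
Lemma diag_pvm : projection_valued_measure m E.
Proof.
split.
- by move=> A _; exact: diag_orthogonal_projection.
- move=> f lf; apply: (can_inj dK); rewrite diag_projectionE.
  by apply/funext => w; rewrite /cut in_setT.
- move=> A mA tA f lf; set u := (X in l2_cvg _ X).
  have lcf : l2 m' (c f) by exact/c_l2.
  have cu n : c (u n) = fun w => \sum_(k < n) cut (A k) (c f) w.
    by rewrite (isometry_sum n (fun k => E (A k) f)); apply/funext => w;
      apply: eq_bigr => k _; rewrite diag_projectionE.
  have sumE w n : \sum_(k < n) cut (A k) (c f) w = cut (\bigcup_(k in `I_n) A k) (c f) w.
    elim: n => [|n ih]; first by rewrite big_ord0 II0 bigcup_set0 /cut in_set0.
    rewrite big_ord_recr /= ih IIS bigcup_setU bigcup_set1 /cut in_setU.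
    case: ifPn => h1; case: ifPn => h2; rewrite ?(addr0, add0r)//=.
    exfalso; move: h1 h2; rewrite !inE => -[k /= kn Ak] An.
    have := tA k n I I; case/(_ _)/Wrap => [|e]; first by exists (lam w).
    by rewrite e ltnn in kn.
  have cw : l2_cvg m' (fun n => c (u n)) (c (E (\bigcup_k A k) f)).
    apply: (l2_cvg_dominated m'0 (g := c f)) => // [w|n w]; last first.
      rewrite cu sumE nsq_cut; case: ifP => // _; exact: nsq_ge0.
    rewrite diag_projectionE /cut; case: ifPn => [|h].
      rewrite inE => -[j _ Aj].
      have e n : (j < n)%N -> c (u n) w = c f w.
        by move=> jn; rewrite cu sumE /cut ifT// inE; exists j.
      split; apply/cvg_epsP => r r0; exists j.+1 => n jn; by rewrite e// subrr normr0.
    have e n : c (u n) w = 0.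
      rewrite cu sumE /cut ifF//; apply/negbTE; apply: contra h; rewrite !inE.
      by move=> -[k _ Ak]; exists k.
    split; apply/cvg_epsP => r r0; exists 0%N => n _; by rewrite e subrr normr0.
  have lu n : l2 m (u n) by apply/c_l2; case: cw.
  have /(l2_cvgP m'0)[_ _ h] := cw.
  apply/(l2_cvgP m0); split => //; first exact: l2_diag_projection.
  move=> r /h[N hN]; exists N => n /hN.
  by rewrite -isometryB c_norm//; apply: (l2B m0) => //; exact: l2_diag_projection.
Qed.

Variable H : operator R V.
Hypothesis HE : forall f g, H (f, g) <->
  [/\ l2 m f, l2 m g & forall w, c g w = (lam w)%:C * c f w].

(** The spectral measure of [f]: each eigenvalue [lam w] carries the squared size of the
    corresponding coordinate. *)
Let mass f : {measure set T -> \bar R} :=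
  discrete_measure lam (fun w => sqw_ge0 m'0 (c f) w).

Let massE f A : l2 m f -> measurable A -> spectral_mass m E f A = mass f A.
Proof.
move=> lf mA; rewrite (spectral_massE diag_pvm)// discrete_measureE// -c_norm;
  last exact: l2_diag_projection.
have lcf : l2 m' (c (E A f)) by apply/c_l2; exact: l2_diag_projection.
rewrite /norm2 rsum_EFin; [|exact: sqw_ge0|exact/(l2E m'0)].
by apply: eq_esum => w _; rewrite /sq_weight diag_projectionE nsq_cut; case: ifP; rewrite ?mulr0.
Qed.

(** Against [mass f], the second moment is the squared norm of [lam * c f], whose finiteness is the
    domain condition of [HE], and the first moment is the inner product of [lam * c f] with
    [c f]. *)
Lemma diag_resolution : spectral_resolution m H E.
Proof.
split; first exact: diag_pvm.
- move=> f; split.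
    move=> [g /HE[lf lg e]]; split => //.
    rewrite (@integral_congr _ _ (mass f)); last by move=> A; exact: massE.
    rewrite integral_discrete; last 2 first.
    + by apply/measurable_EFinP; exact: exprn_measurable.
    + by move=> t; rewrite lee_fin sqr_ge0.
    have /c_l2 := lg; rewrite /l2 /= esumsqE.
    under eq_esum do rewrite /sq_weight e nsqM nsqC mulrCA mulrC EFinM.
    by [].
  move=> [lf]; rewrite (@integral_congr _ _ (mass f)); last by move=> A; exact: massE.
  rewrite integral_discrete; last 2 first.
  + by apply/measurable_EFinP; exact: exprn_measurable.
  + by move=> t; rewrite lee_fin sqr_ge0.
  move=> h; exists (d (fun w => (lam w)%:C * c f w)); apply/HE; split => //; last by rewrite cK.
  apply/c_l2; rewrite cK /l2 /= esumsqE.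
  by under eq_esum do rewrite /sq_weight nsqM nsqC mulrCA mulrC EFinM.
- move=> f g /HE[lf lg e]; split => //.
  rewrite (@integral_congr _ _ (mass f)); last by move=> A; exact: massE.
  have lcf : l2 m' (c f) by exact/c_l2. have lcg : l2 m' (c g) by exact/c_l2.
  have mid : measurable_fun [set: T] (fun t : T => (t : R)%:E).
    by apply/measurable_EFinP; exact: measurable_id.
  rewrite integralE integral_discrete; last 2 first.
  + exact: measurable_funepos.
  + by move=> t; exact: funepos_ge0.
  rewrite integral_discrete; last 2 first.
  + exact: measurable_funeneg.
  + by move=> t; exact: funeneg_ge0.
  (* The eigenvalues are non-negative, so the negative part of the integrand vanishes at every
     atom. *)
  rewrite [X in (_ - X)%E]esum1 => [|w _]; last first.
    by rewrite funenegE (max_idPr _) ?mule0// leeNl oppe0 lee_fin.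
  rewrite sube0 -isometry_inner//.
  have -> : fine (\esum_(w in [set: W]) ((sq_weight m' (c f) w)%:E * (EFin^\+ (lam w)))%E) =
     fine (\esum_(w in [set: W]) (lam w * sq_weight m' (c f) w)%:E).
    by congr fine; apply: eq_esum => w _; rewrite funeposE (max_idPl _) ?lee_fin// -EFinM mulrC.
  rewrite -rsum_ge0E; last by move=> w; rewrite mulr_ge0// sqw_ge0.
  apply: eq_c => /=.
    by apply: eq_rsum => w; rewrite re_it e /sq_weight /nsq !ReIm /=; ring.
  rewrite (@rsum_fin _ _ _ [::])// ?big_nil// => w _.
  by rewrite -/(inner_term m' _ _ _) im_it e !ReIm /=; ring.
Qed.

End Diagonal.

(** * Friedrichs extensions *)

Section Friedrichs.
Variables (R : realType) (V : countType) (m : V -> R).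
Hypothesis m0 : forall x, 0 < m x.
Implicit Types (f g h u v : cfun R V) (z w : R[i]) (us vs : nat -> cfun R V).
Variables (S : operator R V) (Dom : set (cfun R V)) (L : cfun R V -> cfun R V).
Hypothesis SE : forall p, S p <-> Dom p.1 /\ p.2 = L p.1.
Hypothesis Dom0 : Dom (fun=> 0).
Hypothesis Dom_lin : forall z u v, Dom u -> Dom v -> Dom (fun x => u x + z * v x).
Hypothesis L_lin : forall z u v, Dom u -> Dom v ->
  L (fun x => u x + z * v x) = fun x => L u x + z * L v x.
Hypothesis Dom_l2 : forall u, Dom u -> l2 m u.
Hypothesis L_l2 : forall u, Dom u -> l2 m (L u).
Hypothesis L_herm : forall u v, Dom u -> Dom v -> conjc (inner m (L u) v) = inner m (L v) u.
Hypothesis L_pos : forall u, Dom u -> 0 <= re (inner m (L u) u).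

Definition qform u v := inner m (L u) v.
Local Notation B := qform.
Definition quad u := re (B u u).
Local Notation Q := quad.

Lemma quad_ge0 u : Dom u -> 0 <= Q u. Proof. exact: L_pos. Qed.

Lemma qform_self u : Dom u -> B u u = (Q u)%:C.
Proof.
move=> Du; have h : - im (B u u) = im (B u u) by rewrite -imJ /B L_herm.
have h0 : im (B u u) = 0 by lra.
by apply: eq_c.
Qed.

Lemma qformDl z u v h : Dom u -> Dom v -> Dom h ->
  B (fun x => u x + z * v x) h = B u h + z * B v h.
Proof.
move=> Du Dv Dh; have [lLu lLv lh] := And3 (L_l2 Du) (L_l2 Dv) (Dom_l2 Dh).
by rewrite /B L_lin// innerDl ?innerZl//; exact: (l2Z m0).
Qed.

Lemma qformDr z u v h : Dom u -> Dom v -> Dom h ->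
  B h (fun x => u x + z * v x) = B h u + conjc z * B h v.
Proof.
move=> Du Dv Dh; have [lu lv lLh] := And3 (Dom_l2 Du) (Dom_l2 Dv) (L_l2 Dh).
by rewrite /B innerDr ?innerZr//; exact: (l2Z m0).
Qed.

Lemma quadD z u v : Dom u -> Dom v ->
  Q (fun x => u x + z * v x) = Q u + 2 * re (conjc z * B u v) + nsq z * Q v.
Proof.
move=> Du Dv; have Duv := Dom_lin z Du Dv.
rewrite /quad qformDl// !qformDr// (qform_self Du) (qform_self Dv).
by have := L_herm Du Dv; rewrite -/(B u v) -/(B v u) => <-; rewrite /nsq !ReIm /=; ring.
Qed.

Lemma quad0 : Q (fun=> 0) = 0. Proof. by rewrite /quad /B inner0r. Qed.

Lemma Dom_sub u v : Dom u -> Dom v -> Dom (fun x => u x - v x).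
Proof.
move=> Du Dv; have := Dom_lin (-1) Du Dv.
by rewrite (_ : (fun x => u x + -1 * v x) = (fun x => u x - v x))//;
  apply/funext => x; rewrite mulN1r.
Qed.

Lemma subE u v : (fun x => u x - v x) = (fun x => u x + -1 * v x).
Proof. by apply/funext => x; rewrite mulN1r. Qed.

Lemma L_sub u v : Dom u -> Dom v -> L (fun x => u x - v x) = fun x => L u x - L v x.
Proof. by move=> Du Dv; rewrite subE L_lin// -subE. Qed.

Lemma qformBl u v h : Dom u -> Dom v -> Dom h ->
  B (fun x => u x - v x) h = B u h - B v h.
Proof.
by move=> Du Dv Dh; rewrite /B L_sub// innerBl//; [exact: L_l2|exact: L_l2|exact: Dom_l2].
Qed.

Lemma qformBr u v h : Dom u -> Dom v -> Dom h ->
  B h (fun x => u x - v x) = B h u - B h v.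
Proof.
by move=> Du Dv Dh; rewrite /B innerBr//; [exact: Dom_l2|exact: Dom_l2|exact: L_l2].
Qed.

Lemma qform_cauchy_schwarz u v : Dom u -> Dom v -> nsq (B u v) <= Q u * Q v.
Proof.
move=> Du Dv; apply: discriminant_le; try exact: quad_ge0.
by move=> w; rewrite -quadD//; apply: quad_ge0; exact: Dom_lin.
Qed.

(** [Q] is non-negative at [u - z * v], and its values at [u + z * v] and [u - z * v] add up to the
    right-hand side. *)
Lemma quadD_le z u v : Dom u -> Dom v -> Q (fun x => u x + z * v x) <= 2 * Q u + 2 * (nsq z * Q v).
Proof.
move=> Du Dv; have := quad_ge0 (Dom_lin (- z) Du Dv); rewrite !quadD//.
by rewrite nsqN !ReIm /=; lra.
Qed.

Definition approx us f := [/\ forall n, Dom (us n), l2_cvg m us f &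
  forall e : R, 0 < e -> exists N, forall n k, (N <= n)%N -> (N <= k)%N ->
    Q (fun x => us n x - us k x) < e].

Lemma normc_real (a : R) : 0 <= a -> Normc.normc a%:C = a.
Proof. by move=> a0; rewrite normcE nsqC sqrtr_sqr ger0_norm. Qed.

Lemma form_approxP p f : form_approx m S p f <->
  (forall n, p n = ((p n).1, L (p n).1)) /\ approx (fun n => (p n).1) f.
Proof.
have key : (forall n, S (p n)) -> forall n k,
   Normc.normc (inner m ((p n).2 \- (p k).2) ((p n).1 \- (p k).1)) =
   Q (fun x => (p n).1 x - (p k).1 x).
  move=> Sp n k; have [/SE[Dn en] /SE[Dk ek]] := (Sp n, Sp k).
  rewrite -(normc_real (quad_ge0 (Dom_sub Dn Dk))) -qform_self; last exact: Dom_sub.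
  by rewrite /B L_sub// -en -ek.
split=> [[Sp cp cauchy]|[ep [Dp cp cauchy]]].
  split=> [n|]; first by have /SE[_ <-] := Sp n; exact: surjective_pairing.
  split => // [n|e e0]; first by have /SE[] := Sp n.
  by have [N hN] := cauchy e e0; exists N => n k Nn Nk; rewrite -key//; exact: hN.
have Sp n : S (p n) by apply/SE; split => //; rewrite {1}ep.
by split => // e e0; have [N hN] := cauchy e e0; exists N => n k Nn Nk; rewrite key//; exact: hN.
Qed.

Lemma approx_form us f : approx us f -> form_approx m S (fun n => (us n, L (us n))) f.
Proof. by move=> h; apply/form_approxP. Qed.

Lemma form_domP f : form_dom m S f <-> exists us, approx us f.
Proof.
split=> [[p /form_approxP[_ h]]|[us h]]; first by exists (fun n => (p n).1).
by exists (fun n => (us n, L (us n))); exact: approx_form.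
Qed.

Lemma approx_lin z us vs f g : approx us f -> approx vs g ->
  approx (fun n x => us n x + z * vs n x) (fun x => f x + z * g x).
Proof.
move=> [Du cu qu] [Dv cv qv]; split => [n||e e0].
- exact: Dom_lin.
- by apply: (l2_cvgD m0) => //; exact: (l2_cvgZ m0).
have z1 : 0 < 4 * (nsq z + 1) by rewrite mulr_gt0// ltr_pwDr// nsq_ge0.
have [N hN] := qu (e / 4) (divr_gt0 e0 (ltr0n _ 4)).
have [M hM] := qv (e / (4 * (nsq z + 1))) (divr_gt0 e0 z1).
exists (maxn N M) => n k; rewrite !geq_max => /andP[Nn Mn] /andP[Nk Mk].
rewrite (_ : (fun x => _) = fun x => (us n x - us k x) + z * (vs n x - vs k x)); last first.
  by apply/funext => x; ring.
apply: (le_lt_trans (quadD_le _ (Dom_sub (Du n) (Du k)) (Dom_sub (Dv n) (Dv k)))).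
have := hN _ _ Nn Nk; have := hM _ _ Mn Mk; rewrite ltr_pdivlMr// => h1 h2.
have := nsq_ge0 z; have := quad_ge0 (Dom_sub (Dv n) (Dv k)).
move: (Q _) (Q _) (nsq z) h1 h2 => a b c *; nra.
Qed.

Lemma approx_sub us vs f g : approx us f -> approx vs g ->
  approx (fun n x => us n x - vs n x) (fun x => f x - g x).
Proof.
move=> hu hv; have := approx_lin (-1) hu hv; rewrite -subE.
by rewrite (_ : (fun n x => us n x + -1 * vs n x) = fun n x => us n x - vs n x)//;
  apply/funext => n; rewrite -subE.
Qed.

Lemma approx_bounded us f : approx us f -> exists2 C, 0 < C & forall n, Q (us n) <= C.
Proof.
move=> [Du cu qu]; have [N hN] := qu 1 ltr01.
have fin k : exists2 C, 0 < C & forall n, (n < k)%N -> Q (us n) <= C.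
  elim: k => [|k [C C0 hC]]; first by exists 1.
  exists (Num.max C (Q (us k))); first by rewrite lt_max C0.
  move=> n; rewrite ltnS leq_eqVlt => /orP[/eqP ->|/hC nC].
    by rewrite le_max lexx orbT.
  by rewrite le_max nC.
have [C C0 hC] := fin N; exists (Num.max C (2 * 1 + 2 * Q (us N))).
  by rewrite lt_max C0.
move=> n; have [/hC nC|Nn] := ltnP n N; first by rewrite le_max nC.
rewrite le_max; apply/orP; right.
have -> : us n = fun x => (us n x - us N x) + 1 * us N x.
  by apply/funext => x; rewrite mul1r subrK.
apply: (le_trans (quadD_le _ (Dom_sub (Du n) (Du N)) (Du N))).
rewrite nsqC expr1n mul1r lerD2r ler_pM2l//; exact/ltW/hN.
Qed.

(* Closability: [Q u_n = B(u_n, u_n - u_k) + <L u_n, u_k>], where the first term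
   is small uniformly in k and the second one tends to 0 as k -> oo. *)
Lemma approx0_quad us : approx us (fun=> 0) -> (fun n => Q (us n)) @ \oo --> (0 : R).
Proof.
move=> h; have [C C0 hC] := approx_bounded h; have [Du cu qu] := h.
apply/cvg_epsP => e e0.
(* Chosen so that Cauchy-Schwarz bounds the square of [B (us n) (us n - us k)] by [C] times this
   constant, that is by [e ^+ 2 / 2]. *)
have e1 : 0 < e ^+ 2 / (2 * C) by rewrite divr_gt0// ?exprn_gt0// mulr_gt0.
have [N hN] := qu _ e1; exists N => n Nn; rewrite subr0 ger0_norm ?quad_ge0//.
have lim : (fun k => re (B (us n) (fun x => us n x - us k x)) ^+ 2) @ \oo --> Q (us n) ^+ 2.
  have c1 : (fun k => re (B (us n) (fun x => us n x - us k x))) @ \oo --> Q (us n).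
    have [c _] := inner_cvg m0 (l2_cvg_cst m0 (L_l2 (Du n)))
      (l2_cvgB m0 (l2_cvg_cst m0 (Dom_l2 (Du n))) cu).
    apply: cvg_trans c _.
    rewrite (_ : (fun x => us n x - 0) = us n)//; by apply/funext => x; rewrite subr0.
  by rewrite expr2; under eq_fun do rewrite expr2; exact: cvgM.
have : Q (us n) ^+ 2 <= e ^+ 2 / 2.
  apply: (cvg_le (N := N) lim) => k Nk.
  apply: (le_trans (re_sq_le _)).
  apply: (le_trans (qform_cauchy_schwarz (Du n) (Dom_sub (Du n) (Du k)))).
  have /ltW := hN _ _ Nn Nk; have := hC n; have := quad_ge0 (Du n).
  have := quad_ge0 (Dom_sub (Du n) (Du k)).
  move: (Q (us n)) (Q _) => a b b0 a0 aC bC.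
  apply: (le_trans (ler_pM a0 b0 aC bC)).
  by rewrite le_eqVlt; apply/orP; left; apply/eqP; field; lra.
have := quad_ge0 (Du n); move: (Q _) => a a0 ae; rewrite -(@ltr_pXn2r _ 2)// ?nnegrE ?(ltW e0)//.
by apply: (le_lt_trans ae); have := exprn_gt0 2 e0; lra.
Qed.

Lemma ccvg_small us vs C : (forall n, Dom (us n)) -> (forall n, Dom (vs n)) ->
  (fun n => Q (us n)) @ \oo --> (0 : R) -> (forall n, Q (vs n) <= C) ->
  ccvg (fun n => B (us n) (vs n)) 0.
Proof.
move=> Du Dv cu hC; apply/ccvg_nsqP.
have lim : (fun n => Q (us n) * C) @ \oo --> (0 : R).
  by rewrite -[X in _ --> X](mul0r C); apply: cvgM => //; exact: cvg_cst.
apply: (squeeze_cvgr _ (cvg_cst 0) lim); apply: nearW => n.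
rewrite nsq_ge0 /= subr0 (le_trans (qform_cauchy_schwarz (Du n) (Dv n)))//.
by rewrite ler_wpM2l ?quad_ge0.
Qed.

(** The difference is [B (u - u') v + B u' (v - v')]. Both differences approximate 0, so their [Q]
    tends to 0 by closability, while the other argument keeps [Q] bounded; the second term is
    reached through its conjugate. *)
Lemma qform_limit_unique us us' vs vs' f h : approx us f -> approx us' f ->
  approx vs h -> approx vs' h ->
  ccvg (fun n => B (us n) (vs n) - B (us' n) (vs' n)) 0.
Proof.
move=> au au' av av'.
have zero (k : cfun R V) : (fun x => k x - k x) = fun=> 0 by apply/funext => x; rewrite subrr.
have := approx_sub au au'; rewrite zero => du.
have := approx_sub av av'; rewrite zero => dv.
have [C _ hC] := approx_bounded av; have [C' _ hC'] := approx_bounded au'.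
have [[Du _ _] [Du' _ _] [Dv _ _] [Dv' _ _]] := And4 au au' av av'.
have c1 := ccvg_small (fun n => Dom_sub (Du n) (Du' n)) Dv (approx0_quad du) hC.
have c2 := ccvg_small (fun n => Dom_sub (Dv n) (Dv' n)) Du' (approx0_quad dv) hC'.
have := ccvgD c1 (ccvgJ c2); rewrite conjc0 addr0.
rewrite (_ : (fun n => _ + _) = (fun n => B (us n) (vs n) - B (us' n) (vs' n)))//.
apply/funext => n; have D1 := Dom_sub (Dv n) (Dv' n).
have -> : conjc (B (fun x => vs n x - vs' n x) (us' n)) = B (us' n) (fun x => vs n x - vs' n x).
  exact: L_herm.
by rewrite qformBl// qformBr//; ring.
Qed.

(** [closed_form] only asserts that some approximating sequences give [z]; by [qform_limit_unique]
    all of them do. *)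
Lemma closed_form_limit us vs f h z : closed_form m S f h z ->
  approx us f -> approx vs h -> ccvg (fun n => B (us n) (vs n)) z.
Proof.
move=> [p [q [/form_approxP[ep ap] /form_approxP[eq aq] /ccvgP c]]] au av.
have := ccvgD (qform_limit_unique au ap av aq) c; rewrite add0r.
rewrite (_ : (fun n => _ + _) = (fun n => B (us n) (vs n)))//; apply/funext => n.
by have -> : (p n).2 = L (p n).1; [rewrite {1}ep|rewrite -/(B _ _) subrK].
Qed.

Local Notation F := (friedrichs m S).

Lemma friedrichs_limit f g : F (f, g) -> exists2 us, approx us f &
  forall h vs, approx vs h -> ccvg (fun n => B (us n) (vs n)) (inner m g h).
Proof.
move=> [/form_domP[us au] lg hF]; exists us => // h vs av.
by apply: (closed_form_limit _ au av); apply: hF; apply/form_domP; exists vs.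
Qed.

Lemma friedrichs_l2 f g : F (f, g) -> l2 m f /\ l2 m g.
Proof. by move=> [/form_domP[us [_ [_ lf _] _]] lg _]. Qed.

Lemma friedrichs_ge0 f g : F (f, g) -> 0 <= re (inner m g f).
Proof.
move=> /friedrichs_limit[us au h]; have [c _] := h _ _ au; have [Du _ _] := au.
apply: (cvg_ge (N := 0) c) => n _; exact: quad_ge0.
Qed.

Lemma friedrichs_intro us f g : approx us f -> l2 m g ->
  (forall h vs, approx vs h -> ccvg (fun n => B (us n) (vs n)) (inner m g h)) -> F (f, g).
Proof.
move=> au lg h; split => //=; first by apply/form_domP; exists us.
move=> k /form_domP[vs av].
exists (fun n => (us n, L (us n))), (fun n => (vs n, L (vs n))); split.
- exact: approx_form.
- exact: approx_form.
- by apply/ccvgP; exact: h.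
Qed.

Section Resolvent.
Variable g : cfun R V.
Hypothesis lg : l2 m g.

(* The solution of [F f + f = g] minimises J; minimising sequences are Cauchy by
   the parallelogram identity. *)
Let J u := Q u + norm2 m u - 2 * re (inner m g u).

(** Completing the square: [J u + norm2 m g] is [Q u] plus the squared norm of [u - g]. *)
Let J_ge u : Dom u -> - norm2 m g <= J u.
Proof.
move=> Du; have lu := Dom_l2 Du.
have : 0 <= norm2 m (fun x => u x + -1 * g x) by exact: norm2_ge0.
rewrite (norm2D m0)// nsqN nsqC -(innerJ _ g u) /J.
have := quad_ge0 Du; rewrite !ReIm /=; lra.
Qed.

Let E := [set J u | u in Dom].
Let i0 := inf E.

Let has_infE : has_inf E.
Proof.
split; first by exists (J (fun=> 0)); exists (fun=> 0).
by exists (- norm2 m g) => _ [u Du <-]; exact: J_ge.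
Qed.

Let i0_le u : Dom u -> i0 <= J u.
Proof. by move=> Du; apply: inf_lbound; [case: has_infE|exists u]. Qed.

Let J_line u v w : Dom u -> Dom v -> J (fun x => u x + w * v x) =
  J u + 2 * re (conjc w * (B u v + inner m u v - inner m g v)) + nsq w * (Q v + norm2 m v).
Proof.
move=> Du Dv; have [lu lv] := (Dom_l2 Du, Dom_l2 Dv).
rewrite /J quadD// (norm2D m0)// innerDr ?innerZr//; last exact: (l2Z m0).
by rewrite !ReIm; ring.
Qed.

(** A quantitative Euler-Lagrange equation: [J] stays above [i0] on the whole complex line
    [u + w * v], so the discriminant bounds the first-order term by the distance of [J u] to the
    infimum. *)
Let variation u v : Dom u -> Dom v ->
  nsq (B u v + inner m u v - inner m g v) <= (J u - i0) * (Q v + norm2 m v).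
Proof.
move=> Du Dv; apply: discriminant_le => [||w].
- by rewrite subr_ge0 i0_le.
- exact: (addr_ge0 (quad_ge0 Dv) (norm2_ge0 m0 v)).
- have := i0_le (Dom_lin w Du Dv); rewrite J_line//; lra.
Qed.

Let parallelogram u v : Dom u -> Dom v ->
  Q (fun x => u x - v x) + norm2 m (fun x => u x - v x) <= 2 * (J u - i0) + 2 * (J v - i0).
Proof.
move=> Du Dv; have [lu lv] := (Dom_l2 Du, Dom_l2 Dv).
have re_real (a : R) z : re (conjc a%:C * z) = a * re z by rewrite !ReIm /= oppr0 mul0r subr0.
(* The midpoint of [u] and [v], written as a step from [u] along [u - v]. There [J] equals the mean
   of [J u] and [J v] minus a quarter of the left-hand side, and it is at least [i0]. *)
have D2 := Dom_lin (- 2^-1)%:C Du (Dom_sub Du Dv).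
have := i0_le D2; rewrite J_line//; last exact: Dom_sub.
have -> : J v = J u + 2 * re (conjc (-1)%:C *
      (B u (fun x => u x - v x) + inner m u (fun x => u x - v x) - inner m g (fun x => u x - v x))) +
    nsq (-1)%:C * (Q (fun x => u x - v x) + norm2 m (fun x => u x - v x)).
  rewrite -J_line//; last exact: Dom_sub.
  by congr J; apply/funext => x; rewrite rmorphN1; ring.
rewrite !nsqC !re_real; move: (re _) => t; move: (Q _ + norm2 m _) => a; lra.
Qed.

Lemma friedrichs_resolvent : exists f, F (f, fun x => g x - f x).
Proof.
have min n : exists u, Dom u /\ J u < i0 + n.+1%:R^-1.
  have n0 : 0 < n.+1%:R^-1 :> R by rewrite invr_gt0.
  by have [_ [u Du <-] h] := inf_adherent n0 has_infE; exists u.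
have [us /all_and2[Du hu]] := choice min.
have small e : 0 < e -> exists N, forall n, (N <= n)%N -> J (us n) - i0 < e.
  move=> e0; have [N _ hN] := near_infty_natSinv_lt (PosNum e0).
  by exists N => n /hN /= h; have := hu n; rewrite -ltrBlDl => /lt_trans; apply.
have cauchy e : 0 < e -> exists N, forall n k, (N <= n)%N -> (N <= k)%N ->
    Q (fun x => us n x - us k x) + norm2 m (fun x => us n x - us k x) < e.
  move=> e0; have [N hN] := small (e / 4) (divr_gt0 e0 (ltr0n _ 4)).
  exists N => n k /hN h1 /hN h2; apply: (le_lt_trans (parallelogram (Du n) (Du k))); lra.
have [|f cf] := l2_complete m0 (fun n => Dom_l2 (Du n)).
  move=> e /cauchy[N hN]; exists N => n k Nn Nk; apply: le_lt_trans (hN _ _ Nn Nk).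
  by rewrite lerDr; apply: quad_ge0; exact: Dom_sub.
have au : approx us f.
  split => // e /cauchy[N hN]; exists N => n k Nn Nk; apply: le_lt_trans (hN _ _ Nn Nk).
  by rewrite lerDl norm2_ge0.
have [_ lf _] := cf.
exists f; apply: (friedrichs_intro au); first exact: (l2B m0).
move=> h vs av; have [Dv cv _] := av; have [_ lh _] := cv.
have [C C0 hC] := approx_bounded av; have [C' hC'] := l2_cvg_bounded m0 cv.
have C'0 : 0 <= C' by rewrite (le_trans (norm2_ge0 m0 (vs 0)) (hC' 0)).
(* The residual of the equation, tested on [vs], vanishes in the limit: [variation] bounds it by
   [J (us n) - i0], which tends to 0, times the bound [C + C'] for [vs]. *)
have key : ccvg (fun n => B (us n) (vs n) + inner m (us n) (vs n) - inner m g (vs n)) 0.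
  apply/ccvg_nsqP; apply/cvg_epsP => e e0.
  have c1 : 0 < C + C' by rewrite ltr_pwDl.
  have [N hN] := small (e / (C + C')) (divr_gt0 e0 c1); exists N => n /hN.
  rewrite ltr_pdivlMr// !subr0 ger0_norm ?nsq_ge0// => h1.
  apply: (le_lt_trans (variation (Du n) (Dv n))); apply: le_lt_trans h1.
  by rewrite ler_wpM2l ?lerD// subr_ge0 i0_le.
have := ccvgD (ccvgB key (inner_cvg m0 cf cv)) (inner_cvg m0 (l2_cvg_cst m0 lg) cv).
rewrite add0r addrC -innerBl// (_ : (fun n => _ - _ + _) = (fun n => B (us n) (vs n)))//.
by apply/funext => n; ring.
Qed.

(** Non-negativity gives [norm2 m f <= re <g, f>]; inserted into the expansion of the squared norm
    of [g - f], which is non-negative, this yields the claim. *)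
Lemma friedrichs_resolvent_bound f : F (f, fun x => g x - f x) -> norm2 m f <= norm2 m g.
Proof.
move=> Ff; have [lf _] := friedrichs_l2 Ff; have := friedrichs_ge0 Ff.
rewrite innerBl// inner_self !ReIm /=.
have : 0 <= norm2 m (fun x => g x + -1 * f x) by exact: norm2_ge0.
by rewrite (norm2D m0)// nsqN nsqC !ReIm /=; lra.
Qed.

(** For [h = f - f'] the non-negative values [Q (us n - us' n)] converge to [<- h, h>], that is to
    minus the squared norm of [h]. *)
Lemma friedrichs_resolvent_unique f f' : F (f, fun x => g x - f x) ->
  F (f', fun x => g x - f' x) -> f = f'.
Proof.
move=> Ff Ff'; have [lf lgf] := friedrichs_l2 Ff; have [lf' lgf'] := friedrichs_l2 Ff'.
have [us au hu] := friedrichs_limit Ff; have [us' au' hu'] := friedrichs_limit Ff'.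
have [[Du _ _] [Du' _ _]] := (au, au').
have ad := approx_sub au au'; have lh := l2B m0 lf lf'.
have := ccvgB (hu _ _ ad) (hu' _ _ ad); rewrite -innerBl//.
rewrite (_ : (fun n => _ - _) = fun n => (Q (fun x => us n x - us' n x))%:C); last first.
  apply/funext => n; rewrite -qform_self; last exact: Dom_sub.
  have Dd := Dom_sub (Du n) (Du' n).
  by rewrite qformBl.
rewrite (_ : (fun x => g x - f x - _) = fun x => - (f x - f' x)); last by apply/funext => x; ring.
rewrite innerNl// inner_self => -[/= c _].
have : norm2 m (fun x => f x - f' x) <= 0.
  rewrite -oppr_ge0; apply: (cvg_ge (N := 0) c) => n _.
  by apply: quad_ge0; exact: Dom_sub.
move=> n0; apply/funext => x; apply/eqP; rewrite -subr_eq0; apply/eqP.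
by apply: (norm2_eq0 m0 lh); apply/eqP; rewrite eq_le n0 norm2_ge0.
Qed.

End Resolvent.

Lemma friedrichs_resolvent_set : resolvent_set m F (-1).
Proof.
have e (f g : cfun R V) : (fun x => g x + -1 * f x) = fun x => g x - f x by rewrite -subE.
split=> [g lg|].
  have [f Ff] := friedrichs_resolvent lg; exists f; split.
    by rewrite /resolvent /= e.
  by move=> f'; rewrite /resolvent /= e => Ff'; exact: (friedrichs_resolvent_unique Ff Ff').
exists 1 => -[g f]; rewrite /resolvent /= e mul1r => Ff.
have [lf lgf] := friedrichs_l2 Ff.
have lg : l2 m g.
  have -> : g = fun x => (g x - f x) + f x by apply/funext => x; rewrite subrK.
  exact: (l2D m0).
by rewrite !(l2normE m0) ler_wsqrtr//; exact: friedrichs_resolvent_bound.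
Qed.

(** Constant sequences are admissible in the form, so the defining identity can be tested on
    [g - L f] itself, whose norm then vanishes. *)
Lemma friedrichs_everywhere : (forall f, l2 m f -> Dom f) ->
  forall f g, F (f, g) <-> l2 m f /\ g = L f.
Proof.
move=> all f g.
have cst k : l2 m k -> approx (fun=> k) k.
  move=> lk; split => [n||e e0]; [exact: all|exact: (l2_cvg_cst m0)|].
  exists 0%N => n n' _ _; rewrite (_ : (fun x => _) = fun=> 0) ?quad0//.
  by apply/funext => x; rewrite subrr.
split=> [Ff|[lf ->]].
  have [lf lg] := friedrichs_l2 Ff; split => //.
  have [_ _ hF] := Ff.
  have lL := L_l2 (all _ lf); have ld := l2B m0 lg lL.
  have : ccvg (fun=> B f (fun x => g x - L f x)) (inner m g (fun x => g x - L f x)).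
    by apply: (closed_form_limit _ (cst _ lf) (cst _ ld)); apply: hF;
      apply/form_domP; exists (fun=> (fun x => g x - L f x)); exact: cst.
  move=> /(ccvg_unique (ccvg_cst _)) /eqP; rewrite eq_sym -subr_eq0 -innerBl// inner_self.
  move=> /eqP [n0]; apply/funext => x; apply/eqP; rewrite -subr_eq0; apply/eqP.
  exact: (norm2_eq0 m0 ld).
apply: (friedrichs_intro (cst _ lf)); first by apply: L_l2; exact: all.
by move=> h vs [_ cv _]; apply: (inner_cvg m0) => //;
  apply: (l2_cvg_cst m0); apply: L_l2; exact: all.
Qed.

End Friedrichs.

(** * Magnetic Laplacians *)

Section Angles.
Variable R : realType.
Local Notation ang := {ideal_quot (@twopiZ R)}.
Implicit Types (a b : ang) (r : R).

Lemma twopiZP r : reflect (exists k : int, r = k%:~R * (2 * pi)) (r \in @twopiZ R).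
Proof. exact: asboolP. Qed.

Lemma cos_sin_twopiZ r : r \in @twopiZ R -> cos r = 1 /\ sin r = 0.
Proof.
have nat_case n : cos (n%:R * (2 * pi) : R) = 1 /\ sin (n%:R * (2 * pi) : R) = 0.
  elim: n => [|n [ihc ihs]]; first by rewrite mul0r cos0 sin0.
  rewrite -natr1 mulrDl mul1r cosD sinD ihc ihs [2 * pi]mulr_natl cos2pi sin2pi.
  by rewrite !mulr1 !mul0r !mulr0 subr0 addr0.
move=> /twopiZP[[n|n] ->]; first exact: nat_case.
have [hc hs] := nat_case n.+1.
by rewrite NegzE mulrNz mulNr cosN sinN hc hs oppr0.
Qed.

(** After reduction to [s] in [[0, 2 pi[], the half-angle formula gives [cos s = 1 - 2 sin(s/2)^2],
    and [sin (s / 2)] is positive unless [s = 0]. *)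
Lemma twopiZ_cos r : cos r = 1 -> r \in @twopiZ R.
Proof.
move=> c1; pose k := Num.floor (r / (2 * pi)).
have p2 : 0 < 2 * pi :> R by rewrite mulr_gt0// pi_gt0.
pose s := r - k%:~R * (2 * pi).
have kZ : k%:~R * (2 * pi) \in @twopiZ R by apply/twopiZP; exists k.
have [ck sk] := cos_sin_twopiZ kZ.
have cs : cos s = 1 by rewrite /s cosB c1 ck sk mulr0 addr0 mulr1.
have /andP[s0 s2] : 0 <= s < 2 * pi.
  have /andP[] := floor_itv (r / (2 * pi));
    rewrite -/k ler_pdivlMr// ltr_pdivrMr// intrD mulrDl mul1r /s.
  by move=> *; apply/andP; split; lra.
apply/twopiZP; exists k; apply/eqP; rewrite -subr_eq0 -/s; apply/eqP.
apply/eqP; apply: contrapT => /negP sn0.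
have sp : 0 < s / 2 < pi.
  have s1 : 0 < s by rewrite lt_neqAle s0 eq_sym sn0.
  by apply/andP; split; lra.
have := sin_gt0_pi sp; have : cos s = cos (s / 2) ^+ 2 *+ 2 - 1.
  by rewrite -cos_mulr2n; congr cos; lra.
have := cos2Dsin2 (s / 2); rewrite cs; move: (sin _) (cos _) => x y h1 h2 x0.
have : 0 < x ^+ 2 by rewrite exprn_gt0.
by lra.
Qed.

(** [expi] evaluates at a chosen representative, which differs from [r] by an integer multiple of
    [2 * pi]. *)
Lemma expi_pi r : expi (\pi_ang r)%qT = cos r +i* sin r.
Proof.
have h : repr (\pi_ang r)%qT - r \in @twopiZ R by rewrite Quotient.idealrBE reprK.
have [c s] := cos_sin_twopiZ h.
rewrite /expi; move: (repr _) c s => q c s.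
have -> : q = (q - r) + r by rewrite subrK.
by rewrite (cosD (q - r)) (sinD (q - r)) c s !mul1r !mul0r subr0 add0r.
Qed.

Lemma expi0 : expi (0 : ang) = 1.
Proof.
have <- : (\pi_ang 0)%qT = 0 by rewrite raddf0.
by rewrite expi_pi cos0 sin0.
Qed.

Lemma expiD a b : expi (a + b) = expi a * expi b.
Proof.
have <- : (\pi_ang (repr a + repr b))%qT = a + b by rewrite raddfD /= !reprK.
by rewrite expi_pi cosD sinD; apply: eq_c => //=; rewrite addrC.
Qed.

Lemma expiN a : expi (- a) = conjc (expi a).
Proof.
have <- : (\pi_ang (- repr a))%qT = - a by rewrite raddfN /= !reprK.
by rewrite expi_pi cosN sinN.
Qed.

Lemma expi_norm a : expi a * conjc (expi a) = 1.
Proof. by rewrite -expiN -expiD subrr expi0. Qed.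

Lemma expi_eq1 a : expi a = 1 -> a = 0.
Proof.
move=> /(congr1 (@complex.Re R)) /= /twopiZ_cos h.
rewrite -(reprK a) -[0](raddf0 (\pi_ang)%qT) ; apply/eqP.
by rewrite -Quotient.idealrBE subr0.
Qed.

End Angles.

Opaque inner.

(** * The magnetic form on finitely supported functions *)

Section GraphForm.
Variables (R : realType) (V : countType) (G : wgraph R V) (th : potential G).
Hypothesis lf : locally_finite G.
Implicit Types (u v f : cfun R V) (s : seq V).
Local Notation m := (mass G).
Local Notation L := (laplacian th).

Let m0 := @mass_gt0 R V G.

Definition phase x y := expi (th x y).
Definition Cc : set (cfun R V) := [set u | finite_set [set x | u x != 0]].

Lemma phaseJ x y : conjc (phase x y) = phase y x.
Proof. by rewrite /phase -expiN -theta_anti. Qed.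

Lemma phaseV x y : phase x y * phase y x = 1.
Proof. by rewrite -(phaseJ x y) /phase expi_norm. Qed.

Lemma adj_sym x y : adj G x y = adj G y x.
Proof. by rewrite /adj edge_sym. Qed.

Lemma nadj_edge x y : ~~ adj G x y -> edge G x y = 0.
Proof. by rewrite /adj -leNgt => h; apply/eqP; rewrite eq_le h edge_ge0. Qed.

Lemma laplacianE u x s : uniq s -> (forall y, adj G x y -> y \in s) ->
  L u x = (m x)^-1%:C * \sum_(y <- s) (edge G x y)%:C * (u x - phase x y * u y).
Proof.
move=> us hs; rewrite /laplacian (fsbigE s)//.
  by congr (_ * _); apply: eq_bigl => y; rewrite in_setT.
move=> y _ ys; rewrite nadj_edge ?mul0r//; apply: contra ys; exact: hs.
Qed.

(** Every edge touching the support of [u] has both ends in [s], so the edge sums of [u] can be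
    taken over [s] times [s]. *)
Definition covers s u := forall x, u x != 0 -> x \in s /\ forall y, adj G x y -> y \in s.

Lemma covers_exists u v (s0 : seq V) : Cc u -> Cc v ->
  exists s, [/\ uniq s, covers s u, covers s v & {subset s0 <= s}].
Proof.
move=> /finite_seqP[t ht] /finite_seqP[t' ht'].
have nbE x : exists l : seq V, forall y, adj G x y -> y \in l.
  by have /finite_seqP[l hl] := lf x; exists l => y xy;
    have : [set y | adj G x y] y by []; rewrite hl.
have [nb hnb] := choice nbE.
exists (undup (s0 ++ (t ++ t') ++ flatten (map nb (t ++ t')))); split.
- exact: undup_uniq.
- move=> x ux; have xt : x \in t by have : [set x | u x != 0] x by []; rewrite ht.
  split=> [|y /hnb xy]; rewrite mem_undup !mem_cat; first by rewrite xt !orbT.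
  do 2 (apply/orP; right); apply/flattenP; exists (nb x) => //.
  by apply: map_f; rewrite mem_cat xt.
- move=> x ux; have xt : x \in t' by have : [set x | v x != 0] x by []; rewrite ht'.
  split=> [|y /hnb xy]; rewrite mem_undup !mem_cat; first by rewrite xt !orbT.
  do 2 (apply/orP; right); apply/flattenP; exists (nb x) => //.
  by apply: map_f; rewrite mem_cat xt orbT.
- by move=> x xs; rewrite mem_undup mem_cat xs.
Qed.

Lemma covers_off s u x : covers s u -> x \notin s -> u x = 0.
Proof. by move=> h; apply: contraNeq => /h[]. Qed.

Lemma inner_laplacian u v s : uniq s -> covers s v ->
  inner m (L u) v =
  \sum_(x <- s) \sum_(y <- s) (edge G x y)%:C * (u x - phase x y * u y) * conjc (v x).
Proof.
move=> us cv; rewrite (inner_finr m _ us); last by move=> x; exact: covers_off.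
apply: eq_bigr => x _; have [->|vx] := eqVneq (v x) 0.
  by rewrite conjc0 mulr0 big1// => y _; rewrite mulr0.
have [_ nx] := cv x vx; rewrite (laplacianE _ us nx) -big_distrl/=.
by rewrite !mulrA -rmorphM mulfV ?gt_eqF ?m0// mul1r.
Qed.

(** Twice the polarised magnetic form, since each edge is counted in both directions. *)
Definition dform s u v : R[i] :=
  \sum_(x <- s) \sum_(y <- s) (edge G x y)%:C * (u x - phase x y * u y) *
     conjc (v x - phase x y * v y).

(** The discrete Green formula: adding the sum with [x] and [y] exchanged, the two halves combine
    because the phases along an edge and its reverse are inverse to each other. *)
Lemma inner_dform u v s : uniq s -> covers s v -> 2 * inner m (L u) v = dform s u v.
Proof.
move=> us cv; rewrite (inner_laplacian _ us cv) mulr_natl mulr2n.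
rewrite {2}exchange_big /= -big_split /=; apply: eq_bigr => x _.
rewrite -big_split /=; apply: eq_bigr => y _.
rewrite (edge_sym G y x) conjB conjM phaseJ.
have e := phaseV x y; move: (phase x y) (phase y x) e => p q e.
move: (u x) (u y) (conjc _) (conjc _) (_%:C) => a b c d r.
apply/eqP; rewrite -subr_eq0.
rewrite (_ : _ - _ = r * b * c * (1 - p * q)); last by ring.
by rewrite e subrr mulr0.
Qed.

Lemma dform_ge0 s u : re (dform s u u) =
  \sum_(x <- s) \sum_(y <- s) edge G x y * nsq (u x - phase x y * u y).
Proof.
rewrite /dform re_sum; apply: eq_bigr => x _; rewrite re_sum; apply: eq_bigr => y _.
by rewrite -mulrA mulcJ reM /= mul0r subr0.
Qed.

Lemma dformJ s u v : conjc (dform s u v) = dform s v u.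
Proof.
rewrite /dform conj_sum; apply: eq_bigr => x _; rewrite conj_sum; apply: eq_bigr => y _.
by rewrite !conjM conjK conjR mulrAC.
Qed.

Lemma Cc_l2 u : Cc u -> l2 m u.
Proof.
move=> Cu; have [s [us cu _ _]] := covers_exists [::] Cu Cu.
by apply: (l2_fin m0 us) => x; exact: covers_off.
Qed.

Lemma Cc0 : Cc (fun=> 0).
Proof.
by rewrite /Cc /= (_ : [set x | _] = set0)//; apply/seteqP; split => x //=; rewrite eqxx.
Qed.

Lemma Cc_lin z u v : Cc u -> Cc v -> Cc (fun x => u x + z * v x).
Proof.
move=> Cu Cv; apply: (@sub_finite_set _ _ ([set x | u x != 0] `|` [set x | v x != 0])); last first.
  by rewrite finite_setU.
move=> x /=; have [-> h|] := eqVneq (u x) 0; last by left.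
by right; apply: contraNneq h => ->; rewrite mulr0 addr0.
Qed.

Lemma nbr_seq x : exists2 s, uniq s & forall y, adj G x y -> y \in s.
Proof.
have /finite_seqP[l hl] := lf x; exists (undup l); first exact: undup_uniq.
by move=> y xy; rewrite mem_undup; have : [set y | adj G x y] y by []; rewrite hl.
Qed.

Lemma laplacian_lin z u v : L (fun x => u x + z * v x) = fun x => L u x + z * L v x.
Proof.
apply/funext => x; have [s us hs] := nbr_seq x; rewrite !(laplacianE _ us hs).
rewrite mulrCA -mulrDr; congr (_ * _); rewrite big_distrr -big_split /=.
by apply: eq_bigr => y _; ring.
Qed.

(** A vertex outside a covering list is neither in the support of [u] nor adjacent to it, so the
    Laplacian vanishes there. *)
Lemma Cc_laplacian u : Cc u -> Cc (L u).
Proof.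
move=> Cu; have [s [us cu _ _]] := covers_exists [::] Cu Cu.
apply: (@sub_finite_set _ _ [set` s]) => // x /=; apply: contraNT => xs.
have [t ut ht] := nbr_seq x; rewrite (laplacianE _ ut ht) big1 ?mulr0// => y _.
rewrite (covers_off cu xs) sub0r.
have [/cu[_ h]|/negbNE/eqP ->] := boolP (u y != 0); last by rewrite mulr0 oppr0 mulr0.
have [yx|/nadj_edge ->] := boolP (adj G x y); last by rewrite mul0r.
by move: xs; rewrite h// adj_sym.
Qed.

Lemma laplacian_herm u v : Cc u -> Cc v -> conjc (inner m (L u) v) = inner m (L v) u.
Proof.
move=> Cu Cv; have [s [us cu cv _]] := covers_exists [::] Cu Cv.
have e1 := inner_dform v us cu; have e2 := inner_dform u us cv.
apply: (@mulfI _ (2 : R[i])); first by rewrite pnatr_eq0.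
by rewrite e1 -dformJ -e2 conjM conjc_nat.
Qed.

Lemma laplacian_quad u s : uniq s -> covers s u -> re (inner m (L u) u) =
  2^-1 * \sum_(x <- s) \sum_(y <- s) edge G x y * nsq (u x - phase x y * u y).
Proof.
move=> us cu; rewrite -dform_ge0 -(inner_dform u us cu) mulr_natl mulr2n reD.
by field.
Qed.

Lemma laplacian_pos u : Cc u -> 0 <= re (inner m (L u) u).
Proof.
move=> Cu; have [s [us cu _ _]] := covers_exists [::] Cu Cu.
rewrite (laplacian_quad us cu) mulr_ge0// sumr_ge0// => x _; rewrite sumr_ge0// => y _.
by rewrite mulr_ge0 ?edge_ge0 ?nsq_ge0.
Qed.

Lemma laplacian_CcP p : laplacian_Cc th p <-> Cc p.1 /\ p.2 = L p.1.
Proof. by []. Qed.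

End GraphForm.

(** * Parallel sections and holonomy *)

Section Harmonic.
Variables (R : realType) (V : countType) (G : wgraph R V) (th : potential G).
Implicit Types (u : cfun R V) (x y : V) (p : seq V).

Lemma holonomy_cons x y p : holonomy th x (y :: p) = th x y + holonomy th y p.
Proof. by rewrite /holonomy /= big_cons. Qed.

Lemma parallel_section u x p :
  (forall x y, adj G x y -> u x = phase th x y * u y) -> path (adj G) x p ->
  u x = expi (holonomy th x p) * u (last x p).
Proof.
move=> h; elim: p x => [|y p ih] x /=.
  by move=> _; rewrite /holonomy big_nil expi0 mul1r.
by move=> /andP[/h xy /ih yp]; rewrite holonomy_cons expiD -mulrA -yp.
Qed.

(** A parallel [u] that vanishes at one vertex vanishes everywhere, by transport along walks in the
    connected graph. Otherwise [u x] can be cancelled for every base point [x], and each cycle has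
    holonomy 0. *)
Lemma no_parallel_section u : connected_graph G -> ~ trivial_holonomy th ->
  (forall x y, adj G x y -> u x = phase th x y * u y) -> u = fun=> 0.
Proof.
move=> conn hol h; apply: contrapT => un0; apply: hol => x p px lp.
apply: expi_eq1.
have [ux|ux] := eqVneq (u x) 0; last first.
  apply: (mulIf ux); rewrite mul1r -[X in _ * u X = _]lp -parallel_section//.
exfalso; apply: un0; apply/funext => y.
have [n [q [qy lq _]]] := conn y x.
by rewrite (parallel_section h qy) lq ux mulr0.
Qed.

End Harmonic.

(** * Eigenbasis of the Laplacian of a finite graph *)

Section Eigenbasis.
Variables (R : realType) (V : countType) (G : wgraph R V) (th : potential G).
Hypothesis finV : finite_set [set: V].
Local Notation m := (mass G).
Local Notation L := (laplacian th).
Let m0 := @mass_gt0 R V G.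

Lemma finite_locally_finite : locally_finite G.
Proof. by move=> x; apply: sub_finite_set finV. Qed.
Let lf := finite_locally_finite.

Lemma finite_Cc u : Cc (R := R) (V := V) u.
Proof. by apply: sub_finite_set finV. Qed.

Lemma finite_l2 u : l2 m u.
Proof. exact: (Cc_l2 lf (finite_Cc u)). Qed.

(** The spectral theorem gives [A = P^-1 D P] with [P] unitary and [D] real. The eigenvectors are
    the conjugated rows of [P], and the first two clauses say that the adjoint of [P] is a right and
    a left inverse. *)
Lemma hermitian_diagonalization n (A : 'M[R[i]]_n) : (forall i j, A i j = conjc (A j i)) ->
  exists (P : 'M[R[i]]_n) (mu : 'I_n -> R),
  [/\ forall k l, \sum_i P k i * conjc (P l i) = (k == l)%:R,
      forall i j, \sum_k conjc (P k i) * P k j = (i == j)%:R &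
      forall k i, \sum_j A i j * conjc (P k j) = (mu k)%:C * conjc (P k i)].
Proof.
move=> hA; have herm : A \is hermsymmx.
  rewrite qualifE /= expr0 scale1r; apply/eqP/matrixP => i j.
  by rewrite !mxE [LHS]hA.
have /orthomx_spectralP := hermitian_normalmx herm.
have /unitarymxP := spectral_unitarymx A.
have := hermitian_spectral_diag_real herm.
move: (spectralmx A) (spectral_diag A) => P D Dr PP.
have PP' := mulmx1C PP.
have Pu : P \in unitmx by have [] := mulmx1_unit PP.
have -> : invmx P = (P ^t Num.conj)%sesqui.
  by rewrite -[LHS]mulmx1 -PP mulmxA mulVmx// mul1mx.
move=> AE; exists P, (fun k => re (D 0 k)); split.
- move=> k l; have /matrixP/(_ k l) := PP; rewrite !mxE => <-.
  by apply: eq_bigr => i _; rewrite !mxE.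
- move=> i j; have /matrixP/(_ i j) := PP'; rewrite !mxE => <-.
  by apply: eq_bigr => k _; rewrite !mxE.
- move=> k i.
  have AP : A *m (P ^t Num.conj)%sesqui = (P ^t Num.conj)%sesqui *m diag_mx D.
    by rewrite {1}AE -!mulmxA PP mulmx1.
  have /matrixP/(_ i k) := AP; rewrite mul_mx_diag !mxE => e.
  transitivity (\sum_j A i j * (P ^t Num.conj)%sesqui j k).
    by apply: eq_bigr => j _; rewrite !mxE.
  rewrite e mulrC; congr (_ * _).
  have /mxOverP/(_ 0 k) := Dr; move=> /complex_realP[r ->]; by [].
Qed.

Lemma laplacian_sum (I : Type) (t : seq I) (a : I -> R[i]) (u : I -> cfun R V) :
  L (fun x => \sum_(i <- t) a i * u i x) = fun x => \sum_(i <- t) a i * L (u i) x.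
Proof.
elim: t => [|i t ih].
  have -> : (fun x : V => \sum_(i <- [::]) a i * u i x) = fun x => 0 + (-1) * 0.
    by apply/funext => x; rewrite big_nil mulr0 addr0.
  rewrite (laplacian_lin th lf) ; apply/funext => x; rewrite big_nil mulN1r subrr//.
have -> : (fun x => \sum_(j <- i :: t) a j * u j x) =
    fun x => (\sum_(j <- t) a j * u j x) + a i * u i x.
  by apply/funext => x; rewrite big_cons addrC.
by rewrite (laplacian_lin th lf) ih; apply/funext => x; rewrite big_cons addrC.
Qed.

Lemma laplacian_eigenbasis : exists (n : nat) (phi : 'I_n -> cfun R V) (mu : 'I_n -> R) (s : seq V),
  [/\ uniq s /\ (forall x, x \in s),
      forall k, L (phi k) = fun y => (mu k)%:C * phi k y,
      forall k l, inner m (phi k) (phi l) = (k == l)%:R &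
      forall y y', \sum_k phi k y * conjc (phi k y') * (m y')%:C = (y == y')%:R].
Proof.
have /finite_seqP[s0 hs0] := finV.
pose s := undup s0.
have us : uniq s by exact: undup_uniq.
have hs x : x \in s by rewrite mem_undup; have : [set: V] x by []; rewrite hs0.
pose e (i : 'I_(size s)) := tnth (in_tuple s) i.
have ixs y : (index y s < size s)%N by rewrite index_mem.
pose ix y := Ordinal (ixs y).
have eK y : e (ix y) = y by rewrite /e (tnth_nth y) /= nth_index.
have ixK i : ix (e i) = i.
  by apply: val_inj; rewrite /= /e (tnth_nth (e i)) index_uniq.
have sumE (F : V -> R[i]) : \sum_(y <- s) F y = \sum_i F (e i) by rewrite big_tnth.
pose d y : cfun R V := fun x => (x == y)%:R.
have dE y f : inner m f (d y) = (m y)%:C * f y.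
  rewrite (@inner_finr _ _ m f (d y) [:: y])//; last by move=> x; rewrite inE /d => /negbTE ->.
  by rewrite big_seq1 /d eqxx conjc1 mulr1.
pose r y := (Num.sqrt (m y))%:C.
have rr y : r y * r y = (m y)%:C by rewrite -rmorphM -expr2 sqr_sqrtr// ltW.
have r0 y : r y != 0 by rewrite eq_complex /= eqxx andbT gt_eqF// sqrtr_gt0.
have rJ y : conjc (r y) = r y by exact: conjR.
(* The point masses [d y] have norm [r y], the square root of the mass; normalising them makes the
   matrix of [L] hermitian. The same factor is divided out of the eigenvectors of [A]. *)
pose A : 'M[R[i]]_(size s) :=
  \matrix_(i, j) (inner m (L (d (e j))) (d (e i)) / (r (e i) * r (e j))).
have [|P [mu [Po Pc Pe]]] := @hermitian_diagonalization _ A.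
  move=> i j; rewrite !mxE conjM conjc_inv conjM !rJ (laplacian_herm th lf) ?(mulrC (r (e j)))//;
  exact: finite_Cc.
exists (size s), (fun k y => conjc (P k (ix y)) / r y), mu, s; split => //.
- move=> k.
  have expand : (fun y => conjc (P k (ix y)) / r y) =
     fun y => \sum_(j <- enum 'I_(size s)) (conjc (P k j) / r (e j)) * d (e j) y.
    apply/funext => y; rewrite big_enum /= (bigD1 (ix y))//= eK /d eqxx mulr1 big1 ?addr0// => j jy.
    rewrite (negbTE (_ : y != e j)) ?mulr0//.
    by apply: contra jy => /eqP ->; rewrite ixK.
  rewrite {1}expand laplacian_sum; apply/funext => y.
  have key i : \sum_(j <- enum 'I_(size s)) conjc (P k j) / r (e j) * L (d (e j)) (e i) =
     (mu k)%:C * (conjc (P k i) / r (e i)).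
    rewrite big_enum /= mulrA -Pe big_distrl /=; apply: eq_bigr => j _.
    rewrite mxE dE -rr; field; by rewrite !r0.
  by rewrite -{1}(eK y) key eK.
- move=> k l; rewrite (@inner_finr _ _ m _ _ s)//; last by move=> x; rewrite hs.
  rewrite sumE -(eq_sym l) -Po; apply: eq_bigr => i _.
  rewrite ixK conjM conjK conjc_inv rJ -rr; field; exact: r0.
- move=> y y'.
  transitivity ((ix y == ix y')%:R * (r y' / r y)); last first.
    rewrite (can_eq eK); case: eqP => [->|_]; last by rewrite mul0r.
    by rewrite mul1r divff.
  rewrite -Pc big_distrl /=; apply: eq_bigr => k _.
  by rewrite conjM conjK conjc_inv rJ -rr; field; rewrite !r0.
Qed.

End Eigenbasis.

Section FiniteFactor.
Variables (R : realType) (V : countType) (G : wgraph R V) (th : potential G).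
Hypothesis finV : finite_set [set: V].
Local Notation m := (mass G).
Local Notation L := (laplacian th).
Let m0 := @mass_gt0 R V G.
Let lf := finite_locally_finite G finV.

Lemma eigenvalue_gt0 (u : cfun R V) (mu : R) : connected_graph G -> ~ trivial_holonomy th ->
  L u = (fun x => mu%:C * u x) -> inner m u u = 1 -> 0 < mu.
Proof.
move=> conn hol Lu u1; have lu := finite_l2 G finV u.
have qE : re (inner m (L u) u) = mu by rewrite Lu innerZl// u1 mulr1.
have Cu := finite_Cc finV u.
rewrite lt_neqAle -{2}qE (laplacian_pos th lf Cu) andbT eq_sym; apply/eqP => mu0.
have [s [us cu _ _]] := covers_exists lf [::] Cu Cu.
have := laplacian_quad th us cu; rewrite qE mu0 => /esym/eqP.
rewrite mulf_eq0 invr_eq0 pnatr_eq0 /= => /eqP h.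
suff u0 : u = fun=> 0 by move: u1; rewrite u0 inner0l => /eqP; rewrite eq_sym oner_eq0.
apply: (no_parallel_section conn hol) => x y xy.
have term0 a b : 0 <= edge G a b * nsq (u a - phase th a b * u b).
  by rewrite mulr_ge0 ?edge_ge0 ?nsq_ge0.
(* An edge not inside [s] cannot touch the support of [u], so [u] vanishes at both of its ends; only
   edges inside [s] use the vanishing of the form. *)
have [xs|xs] := boolP (x \in s); last first.
  have ux := covers_off cu xs.
  have [uy|/cu[_ hy]] := eqVneq (u y) 0; first by rewrite ux uy mulr0.
  by move: xs; rewrite hy// adj_sym.
have hx : \sum_(b <- s) edge G x b * nsq (u x - phase th x b * u b) = 0.
  by move/eqP: h; rewrite psumr_eq0 => [/allP/(_ x xs)/implyP/(_ isT)/eqP|a _];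
    last exact: sumr_ge0.
have [ys|ys] := boolP (y \in s).
  move/eqP: hx; rewrite psumr_eq0 => [/allP/(_ y ys)/implyP/(_ isT)|b _]; last exact: term0.
  rewrite mulf_eq0 gt_eqF//= nsq_eq0 subr_eq0 => /eqP //.
have uy := covers_off cu ys; rewrite uy mulr0.
have [//|/cu[_ hy]] := eqVneq (u x) 0.
by move: ys; rewrite hy.
Qed.

Lemma finite_magnetic_laplacian f g : magnetic_laplacian th (f, g) <-> g = L f.
Proof.
have h := friedrichs_everywhere m0 (laplacian_CcP th) (@Cc_lin R V)
  (fun z u v _ _ => laplacian_lin th lf z u v)
  (fun u Cu => Cc_l2 lf Cu) (fun u Cu => Cc_l2 lf (Cc_laplacian th lf Cu))
  (fun u v Cu Cv => laplacian_herm th lf Cu Cv) (fun u Cu => laplacian_pos th lf Cu)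
  (fun f _ => finite_Cc finV f).
rewrite /magnetic_laplacian h; split=> [[]//|->]; split => //; exact: finite_l2.
Qed.

End FiniteFactor.

(** * The tensor product with a finite graph *)

Section Product.
Variables (R : realType) (V1 V2 : countType) (G1 : wgraph R V1) (G2 : wgraph R V2).
Variables (th1 : potential G1) (th2 : potential G2) (I : set V2).
Hypotheses (lf1 : locally_finite G1) (nl1 : loopless G1) (finV2 : finite_set [set: V2]).
Variables (n : nat) (phi : 'I_n -> cfun R V2) (mu : 'I_n -> R) (s2 : seq V2).
Hypotheses (us2 : uniq s2) (s2P : forall y, y \in s2).
Local Notation m1 := (mass G1).
Local Notation m2 := (mass G2).
Local Notation m := (prod_mass m1 m2).
Local Notation L2 := (laplacian th2).
Hypothesis phiE : forall k, L2 (phi k) = fun y => (mu k)%:C * phi k y.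
Hypothesis phi_ortho : forall k l, inner m2 (phi k) (phi l) = (k == l)%:R.
Hypothesis phi_complete : forall y y',
  \sum_k phi k y * conjc (phi k y') * (m2 y')%:C = (y == y')%:R.
Local Notation V := (V1 * V2)%type.
Local Notation W := (V1 * 'I_n)%type.
Implicit Types (f g u v : cfun R V) (F : cfun R W).

Let lf2 := @finite_locally_finite R V2 G2 finV2.
Let m1_gt0 := @mass_gt0 R V1 G1.
Let m2_gt0 := @mass_gt0 R V2 G2.

(* Coordinates with respect to the vectors [delta_x (x) phi_k]; [coord_eigen] are
   the eigenvalues of [m1^-1 (x) Delta_2]. *)
Definition coord f : cfun R W := fun w => inner m2 (fun y => f (w.1, y)) (phi w.2).
Definition uncoord F : cfun R V := fun p => \sum_k F (p.1, k) * phi k p.2.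
Definition coord_mass (w : W) : R := m1 w.1.
Definition coord_eigen (w : W) : R := mu w.2 / m1 w.1.
Local Notation c := coord.
Local Notation d := uncoord.
Local Notation m' := coord_mass.
Local Notation lam := coord_eigen.

Let m_gt0 p : 0 < m p. Proof. by rewrite mulr_gt0. Qed.
Let m'_gt0 w : 0 < m' w. Proof. exact: m1_gt0. Qed.

Lemma inner2E (f g : cfun R V2) : inner m2 f g = \sum_(y <- s2) (m2 y)%:C * f y * conjc (g y).
Proof. by apply: inner_finr => // y; rewrite s2P. Qed.

Lemma coordK : cancel c d.
Proof.
move=> f; apply/funext => -[x y]; rewrite /d /=.
transitivity (\sum_(y' <- s2) f (x, y') * (y == y')%:R); last first.
  rewrite (bigD1_seq y)//= eqxx mulr1 big1 ?addr0// => y'; rewrite eq_sym => /negbTE ->.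
  by rewrite mulr0.
under eq_bigr do rewrite /c inner2E big_distrl /=.
rewrite exchange_big /=; apply: eq_bigr => y' _; rewrite -phi_complete big_distrr /=.
by apply: eq_bigr => k _; ring.
Qed.

Lemma uncoordK : cancel d c.
Proof.
move=> F; apply/funext => -[x k]; rewrite /c /= inner2E /d /=.
transitivity (\sum_l F (x, l) * inner m2 (phi l) (phi k)); last first.
  rewrite (bigD1 k)//= phi_ortho eqxx mulr1 big1 ?addr0// => l lk.
  by rewrite phi_ortho (negbTE lk) mulr0.
under [RHS]eq_bigr do rewrite inner2E big_distrr /=.
rewrite [RHS]exchange_big /=; apply: eq_bigr => y _; rewrite big_distrr big_distrl /=.
by apply: eq_bigr => l _; ring.
Qed.

Lemma coord_lin (z : R[i]) f g : c (fun p => z * f p + g p) = fun w => z * c f w + c g w.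
Proof.
apply/funext => -[x k]; by rewrite /c innerDl// ?innerZl//; exact: finite_l2.
Qed.

Lemma fiber_parseval f x :
  \sum_(y <- s2) m2 y * nsq (f (x, y)) = \sum_k nsq (c f (x, k)).
Proof.
suff : (\sum_(y <- s2) m2 y * nsq (f (x, y)))%:C = (\sum_k nsq (c f (x, k)))%:C :> R[i].
  by move=> [].
rewrite !rmorph_sum /=.
transitivity (\sum_(y <- s2) \sum_k (m2 y)%:C * f (x, y) * conjc (c f (x, k) * phi k y)).
  apply: eq_bigr => y _; have fE : f (x, y) = \sum_k c f (x, k) * phi k y.
    by rewrite -{1}(coordK f).
  by rewrite rmorphM /= -mulcJ {2}fE mulrA conj_sum big_distrr.
rewrite exchange_big /=; apply: eq_bigr => k _.
rewrite -mulcJ; have e : c f (x, k) = \sum_(y <- s2) (m2 y)%:C * f (x, y) * conjc (phi k y).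
  exact: inner2E.
rewrite [X in X * _]e mulr_suml; apply: eq_bigr => y _; rewrite conjM; ring.
Qed.

(** Tonelli for a finite second factor, whose inner sum becomes an ordinary sum over the enumeration
    [t]. *)
Lemma esum_prod_fin (A B : countType) (t : seq B) (a : A * B -> R) :
  uniq t -> (forall y, y \in t) -> (forall p, 0 <= a p) ->
  \esum_(p in [set: A * B]) (a p)%:E = \esum_(x in [set: A]) (\sum_(y <- t) a (x, y))%:E.
Proof.
move=> ut tP a0.
have := @esum_esum R A B [set: A] (fun=> [set: B]) (fun x y => (a (x, y))%:E).
have -> : [set: A] `*`` (fun=> [set: B]) = [set: A * B] by apply/seteqP; split.
have -> : \esum_(p in [set: A * B]) (a p)%:E = \esum_(k in [set: A * B]) (a (k.1, k.2))%:E.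
  by apply: eq_esum => -[].
move=> <-; last by move=> *; rewrite lee_fin.
apply: eq_esum => x _.
have fB : finite_set [set: B].
  by rewrite (_ : [set: B] = [set` t])//; apply/seteqP; split => y //= _; exact: tP.
rewrite esum_fset//; last by move=> *; rewrite lee_fin.
rewrite fsumEFin//; congr EFin; rewrite (fsbigE t)//; last by move=> y _; rewrite tP.
by apply: eq_bigl => y; rewrite in_setT.
Qed.

Lemma coord_esumsq f : esumsq m' (c f) = esumsq m f.
Proof.
rewrite !esumsqE (@esum_prod_fin _ _ s2)//; last by move=> p; exact: (sqw_ge0 m_gt0).
rewrite (@esum_prod_fin _ _ (enum 'I_n))//; last 3 first.
- exact: enum_uniq.
- by move=> k; rewrite mem_enum.
- by move=> p; exact: (sqw_ge0 m'_gt0).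
apply: eq_esum => x _; congr EFin; rewrite /sq_weight /prod_mass /m' /=.
under [RHS]eq_bigr do rewrite -mulrA; rewrite -!big_distrr /=; congr (_ * _).
by rewrite fiber_parseval big_enum.
Qed.

Lemma coord_l2 f : l2 m f <-> l2 m' (c f).
Proof. by rewrite /l2 /= coord_esumsq. Qed.

Lemma coord_norm2 f : norm2 m' (c f) = norm2 m f.
Proof.
have e (A : countType) (w : A -> R) (h : cfun R A) : (forall a, 0 < w a) ->
    norm2 w h = fine (esumsq w h).
  by move=> w0; rewrite esumsqE /norm2 rsum_ge0E// => a; exact: sqw_ge0.
by rewrite (e _ _ _ m'_gt0) (e _ _ _ m_gt0) coord_esumsq.
Qed.

Definition fiber_laplacian f : cfun R V :=
  fun p => ((m1 p.1)^-1)%:C * L2 (fun y => f (p.1, y)) p.2.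

(** Symmetry of the fibre Laplacian moves it onto the eigenvector [phi k], where it acts as the real
    number [mu k]. *)
Lemma coord_fiber_laplacian f : c (fiber_laplacian f) = fun w => (lam w)%:C * c f w.
Proof.
apply/funext => -[x k]; rewrite /c /fiber_laplacian /=.
rewrite innerZl//; try exact: finite_l2.
have Cf := finite_Cc finV2.
rewrite -(laplacian_herm th2 lf2 (Cf _ (phi k)) (Cf _ _)) phiE innerZl//; try exact: finite_l2.
rewrite conjM conjR innerJ mulrA -rmorphM; congr (_%:C * _).
by rewrite /lam mulrC.
Qed.

Local Notation K := (tensor_op m1 m2 (mult_op m1 (fun x => (m1 x)^-1)) (magnetic_laplacian th2)).

Lemma coord_cvg (u : nat -> cfun R V) f : pcvg u f -> pcvg (fun n => c (u n)) (c f).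
Proof.
move=> uf w; rewrite /c inner2E (_ : (fun n => _) = (fun n =>
  \sum_(y <- s2) (m2 y)%:C * u n (w.1, y) * conjc (phi w.2 y))); last first.
  by apply/funext => k; rewrite inner2E.
apply: ccvg_sum => y; apply: ccvgM; last exact: ccvg_cst.
by apply: ccvgM; [exact: ccvg_cst|exact: uf].
Qed.

Lemma algebraic_tensor_coord p :
  algebraic_tensor (mult_op m1 (fun x => (m1 x)^-1)) (magnetic_laplacian th2) p ->
  p.2 = fiber_laplacian p.1.
Proof.
move=> [k [a [b [ab p1 p2]]]]; apply/funext => -[x y]; rewrite p2 /fiber_laplacian /=.
have -> : (fun y => p.1 (x, y)) = fun y => \sum_(i <- index_enum 'I_k) (a i).1 x * (b i).1 y.
  by apply/funext => y'; rewrite p1.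
rewrite (laplacian_sum th2 finV2) big_distrr /=; apply: eq_bigr => i _.
have [[_ _ ->] hb] := ab i.
have -> : (b i).2 = L2 (b i).1.
  by apply/(finite_magnetic_laplacian th2 finV2); rewrite -surjective_pairing.
by rewrite mulrA.
Qed.

(** The coordinate relation passes to limits, since each coordinate is a finite sum over a fibre.
    Conversely, truncating [f] and [g] to finitely many fibres gives pairs in the algebraic tensor
    product, and these truncations converge in l2. *)
Lemma tensor_coordP f g : K (f, g) <->
  [/\ l2 m f, l2 m g & forall w, c g w = (lam w)%:C * c f w].
Proof.
split.
  move=> [u uT [cu cg]]; have [_ lf _] := cu; have [_ lg _] := cg; split => // w.
  have h := coord_cvg (l2_cvg_pcvg m_gt0 cu) w; have h' := coord_cvg (l2_cvg_pcvg m_gt0 cg) w.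
  apply: (ccvg_unique h'); rewrite (_ : (fun n => _) = (fun n => (lam w)%:C * c (u n).1 w)).
    by apply: ccvgM => //; exact: ccvg_cst.
  by apply/funext => k; rewrite (algebraic_tensor_coord (uT k)) coord_fiber_laplacian.
move=> [lf lg e].
have gE : g = fiber_laplacian f.
  by apply: (can_inj coordK); rewrite coord_fiber_laplacian; exact/funext.
pose cutN (h : cfun R V) N : cfun R V := fun p => if p.1 \in upto V1 N then h p else 0.
have cut_cvg h : l2 m h -> l2_cvg m (cutN h) h.
  move=> lh; apply: (l2_cvg_dominated m_gt0 (g := h)) => // [p|k p]; last first.
    by rewrite /cutN; case: ifP => //; rewrite nsq0 nsq_ge0.
  split; apply/cvg_epsP => r r0; exists (pickle p.1).+1 => k hk;
    by rewrite /cutN mem_upto// subrr normr0.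
exists (fun N => (cutN f N, cutN g N)); last by split; exact: cut_cvg.
move=> N; pose t := upto V1 N; pose delta x : cfun R V1 := fun x' => (x' == x)%:R.
have pick (F : V1 -> R[i]) x :
    \sum_(i < size t) (x == tnth (in_tuple t) i)%:R * F (tnth (in_tuple t) i) =
    if x \in t then F x else 0.
  rewrite -(big_tnth _ _ t xpredT (fun x' => (x == x')%:R * F x')).
  case: ifPn => xt.
    rewrite (bigD1_seq x)//=; last exact: upto_uniq.
    by rewrite eqxx mul1r big1 ?addr0// => x'; rewrite eq_sym => /negbTE ->; rewrite mul0r.
  rewrite big_seq big1// => x' x't; rewrite (negbTE (_ : x != x')) ?mul0r//.
  by apply: contra xt => /eqP ->.
have ld x (z : R[i]) : l2 m1 (fun x' => z * delta x x').
  apply: (l2_fin m1_gt0 (s := [:: x])) => // x'; rewrite inE /delta => /negbTE ->.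
  by rewrite mulr0.
(* The truncation of [f] is the sum over [x] in [t] of [delta x] tensored with the restriction of
   [f] to the fibre over [x]. *)
exists (size t), (fun i => let x := tnth (in_tuple t) i in
    (delta x, fun x' => ((m1 x)^-1)%:C * delta x x')),
  (fun i => let x := tnth (in_tuple t) i in
    ((fun y => f (x, y)), L2 (fun y => f (x, y)))); split.
- move=> i; split; last exact/(finite_magnetic_laplacian th2 finV2).
  split => /=; [|exact: ld|].
    have := ld (tnth (in_tuple t) i) 1.
    rewrite (_ : (fun x' => _) = delta (tnth (in_tuple t) i))//.
    by apply/funext => x'; rewrite mul1r.
  by move=> x; rewrite /delta; case: eqP => [->//|_]; rewrite !mulr0.
- by move=> [x y] /=; rewrite (pick (fun x => f (x, y))).
- move=> [x y] /=; rewrite gE.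
  rewrite (_ : cutN _ _ _ = if x \in t then fiber_laplacian f (x, y) else 0)//.
  rewrite -(pick (fun x => fiber_laplacian f (x, y))); apply: eq_bigr => i _.
  by rewrite /fiber_laplacian /= mulrCA mulrA.
Qed.

Lemma tensor_resolution : (forall k, 0 <= mu k) -> exists E, spectral_resolution m K E.
Proof.
move=> mu0; exists (diag_projection lam c d).
apply: (diag_resolution m_gt0 m'_gt0 _ coordK uncoordK coord_lin coord_l2
  (fun f _ => coord_norm2 f)).
  by move=> w; rewrite divr_ge0// ltW.
exact: tensor_coordP.
Qed.

End Product.

(** * The product through I *)

Section MagneticLaplacian.
Variables (R : realType) (V : countType) (G : wgraph R V) (th : potential G).
Hypothesis lf : locally_finite G.
Local Notation m := (mass G).
Local Notation L := (laplacian th).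
Local Notation D := (magnetic_laplacian th).
Let m0 := @mass_gt0 R V G.
Let lin := fun (z : R[i]) (u v : cfun R V) (_ : Cc u) (_ : Cc v) => laplacian_lin th lf z u v.
Let dom_l2 := fun (u : cfun R V) (Cu : Cc u) => Cc_l2 lf Cu.
Let lap_l2 := fun (u : cfun R V) (Cu : Cc u) => Cc_l2 lf (Cc_laplacian th lf Cu).
Let herm := fun (u v : cfun R V) (Cu : Cc u) (Cv : Cc v) => laplacian_herm th lf Cu Cv.
Let pos := fun (u : cfun R V) (Cu : Cc u) => laplacian_pos th lf Cu.

Lemma magnetic_laplacian_l2 f g : D (f, g) -> l2 m f /\ l2 m g.
Proof. exact: (friedrichs_l2 (laplacian_CcP th) (@Cc_lin R V) lin herm pos). Qed.

Lemma magnetic_laplacian_ge0 f g : D (f, g) -> 0 <= re (inner m g f).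
Proof. exact: (friedrichs_ge0 m0 (laplacian_CcP th) (@Cc_lin R V) lin dom_l2 lap_l2 herm pos). Qed.

(** Keeps what a lower bound for [<g, f>] uses: pointwise convergence of finitely supported
    functions together with convergence of their energies. *)
Lemma magnetic_laplacian_limit f g : D (f, g) -> exists us : nat -> cfun R V,
  [/\ forall n, Cc (us n), pcvg us f &
      (fun n => re (inner m (L (us n)) (us n))) @ \oo --> re (inner m g f)].
Proof.
move=> /(friedrichs_limit m0 (laplacian_CcP th) (@Cc_lin R V) lin dom_l2 lap_l2 herm pos)[us au h].
have [Cu cu _] := au; have [c _] := h _ _ au.
by exists us; split => //; exact: l2_cvg_pcvg.
Qed.

Lemma magnetic_laplacian_resolvent_set : resolvent_set m D (-1).
Proof.
exact: (friedrichs_resolvent_set m0 (laplacian_CcP th) (Cc0 R V) (@Cc_lin R V)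
  lin dom_l2 lap_l2 herm pos).
Qed.

Lemma magnetic_laplacian_resolvent_bound f g : l2 m g -> D (f, fun x => g x - f x) ->
  norm2 m f <= norm2 m g.
Proof.
move=> lg; exact: (friedrichs_resolvent_bound m0 (laplacian_CcP th) (@Cc_lin R V)
  lin dom_l2 lap_l2 herm pos lg).
Qed.

End MagneticLaplacian.

(** * Finiteness of balls and of the sets of large mass *)

Section Balls.
Variables (R : realType) (V : countType) (G : wgraph R V) (o : V).
Hypotheses (lf : locally_finite G) (conn : connected_graph G).

Lemma finite_walks k : finite_set [set x | walk G o x k].
Proof.
elim: k => [|k ih].
  apply: (@sub_finite_set _ _ [set o]) => // x [p [_ <- /eqP]].
  by rewrite size_eq0 => /eqP ->.
apply: (@sub_finite_set _ _ (\bigcup_(z in [set z | walk G o z k]) [set y | adj G z y])).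
  move=> x [p [+ + sp]]; case/lastP: p sp => // p y; rewrite size_rcons => -[sp].
  rewrite rcons_path last_rcons => /andP[op py] yx.
  by exists (last o p); [exists p|rewrite /= -yx].
exact: bigcup_finite.
Qed.

(** [gdist] is an [xget] with default 0; connectedness supplies a shortest walk, so the distance is
    realised and the ball is covered by the ends of walks of fewer than [r] steps. *)
Lemma finite_ball r : finite_set [set x | (gdist G o x < r)%N].
Proof.
apply: (@sub_finite_set _ _ (\bigcup_(k in `I_r) [set x | walk G o x k])); last first.
  by apply: bigcup_finite => // k _; exact: finite_walks.
move=> x /= xr; exists (gdist G o x) => //=; rewrite /gdist; case: xgetP => [k _ [//]|h].
have ex : exists k, `[< walk G o x k >] by have [k hk] := conn o x; exists k; exact/asboolP.
exfalso; apply: (h (ex_minn ex)); case: ex_minnP => k /asboolP wk min.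
by split => // l wl; apply: min; exact/asboolP.
Qed.

Lemma large_mass_finite (e : R) : 0 < e ->
  mass G x @[x --> graph_infinity G o] --> (0 : R) -> finite_set [set x | e <= mass G x].
Proof.
move=> e0 c.
have [r _ hr] : graph_infinity G o [set x | `|mass G x| < e].
  have := c _ (nbhsx_ballx (0 : R) e e0); rewrite /nbhs /= /ball /= => -[r rT h].
  by exists r => // x /h /=; rewrite sub0r normrN.
apply: sub_finite_set (finite_ball r) => x /= ex; rewrite ltnNge; apply/negP => rx.
have := hr x rx; rewrite /= ger0_norm ?ltNge ?ex//; exact/ltW/mass_gt0.
Qed.

End Balls.

(** * Finite sums, lists and linear algebra for the counting argument *)

Lemma sum_seq_sub (R : numDomainType) (T : eqType) (r s : seq T) (F : T -> R) :
  uniq r -> uniq s ->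
  {subset r <= s} -> (forall x, 0 <= F x) -> \sum_(x <- r) F x <= \sum_(x <- s) F x.
Proof.
move=> ur us rs F0; rewrite [leRHS](bigID (mem r))/=.
have -> : \sum_(x <- s | x \in r) F x = \sum_(x <- r) F x.
  rewrite -big_filter; apply/perm_big/uniq_perm; rewrite ?filter_uniq// => x.
  by rewrite mem_filter andb_idr// => /rs.
by rewrite lerDl sumr_ge0.
Qed.

(** Compares the number of solutions of [Q] with [N] without assuming it finite: a list that misses
    some solution can be extended by it. *)
Lemma list_or_exhausted (T : eqType) (Q : T -> Prop) N :
  (exists t : seq T, [/\ uniq t, size t = N & forall w, w \in t -> Q w]) \/
  (exists t : seq T, [/\ uniq t, (size t < N)%N & forall w, Q w -> w \in t]).
Proof.
elim: N => [|N [[t [ut st tQ]]|[t [ut st tQ]]]]; first by left; exists [::].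
  have [h|/existsNP[w /not_implyP[Qw /negP wt]]] := pselect (forall w, Q w -> w \in t).
    by right; exists t; rewrite st.
  left; exists (w :: t); rewrite /= wt ut st; split => // w'.
  by rewrite inE => /orP[/eqP ->//|/tQ].
by right; exists t; rewrite ltnW.
Qed.

Lemma kernel_vector (F : fieldType) N k (M : 'I_N -> 'I_k -> F) : (k < N)%N ->
  exists a : 'I_N -> F, (exists i, a i != 0) /\ forall j, \sum_i a i * M i j = 0.
Proof.
move=> kN; pose A := \matrix_(i, j) M i j.
have : kermx A != 0.
  rewrite -mxrank_eq0 mxrank_ker subn_eq0 -ltnNge.
  by rewrite (leq_ltn_trans (rank_leq_col A)).
move=> /rowV0Pn[v /sub_kermxP vA v0]; exists (fun i => v 0 i); split.
  apply: contrapT => h; move/eqP: v0; apply; apply/rowP => i; rewrite mxE.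
  by apply/eqP; apply: contrapT => /negP vi; apply: h; exists i.
move=> j; have /matrixP/(_ 0 j) := vA; rewrite !mxE => e; apply: etrans e.
by apply: eq_bigr => i _; rewrite mxE.
Qed.

Lemma l2_sum (R : realType) (V : countType) (m : V -> R) (m0 : forall x, 0 < m x)
  N (a : 'I_N -> R[i]) (v : 'I_N -> cfun R V) (s : seq 'I_N) : (forall i, l2 m (v i)) ->
  l2 m (fun x => \sum_(i <- s) a i * v i x).
Proof.
move=> lv; elim: s => [|i s ih].
  rewrite (_ : (fun x => _) = fun=> 0); first exact: (l2_0 m0).
  by apply/funext => x; rewrite big_nil.
rewrite (_ : (fun x => _) = fun x => a i * v i x + \sum_(i <- s) a i * v i x).
  by apply: (l2D m0) => //; exact: (l2Z m0).
by apply/funext => x; rewrite big_cons.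
Qed.

Lemma projection_sum (R : realType) (V : countType) (m : V -> R) (m0 : forall x, 0 < m x)
  (P : cfun R V -> cfun R V) N (a : 'I_N -> R[i]) (v : 'I_N -> cfun R V) (s : seq 'I_N) :
  orthogonal_projection m P -> (forall i, l2 m (v i)) ->
  P (fun x => \sum_(i <- s) a i * v i x) = fun x => \sum_(i <- s) a i * P (v i) x.
Proof.
move=> [Pl Plin _ _] lv; have l0 := l2_0 m0.
have P0 : P (fun=> 0) = fun=> 0.
  have := Plin 1 _ _ l0 l0; rewrite mulr0 addr0 => e; apply/funext => x.
  have /(congr1 (fun h => h x)) := e; rewrite mul1r => /eqP.
  by rewrite -subr_eq0 opprD addrA subrr add0r oppr_eq0 => /eqP.
elim: s => [|i s ih].
  rewrite (_ : (fun x => _) = fun=> 0) ?P0; last by apply/funext => x; rewrite big_nil.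
  by apply/funext => x; rewrite big_nil.
rewrite (_ : (fun x => _) = fun x => a i * v i x + \sum_(i <- s) a i * v i x).
  rewrite Plin//; last exact: l2_sum.
  by rewrite ih; apply/funext => x; rewrite big_cons.
by apply/funext => x; rewrite big_cons.
Qed.

(** * Comparison of the product Laplacian with its fibre part *)

Section ProductLaplacian.
Variables (R : realType) (V1 V2 : countType) (G1 : wgraph R V1) (G2 : wgraph R V2).
Variables (th1 : potential G1) (th2 : potential G2) (I : set V2).
Hypotheses (lf1 : locally_finite G1) (nl1 : loopless G1) (finV2 : finite_set [set: V2]).
Variables (n : nat) (phi : 'I_n -> cfun R V2) (mu : 'I_n -> R) (s2 : seq V2).
Hypotheses (us2 : uniq s2) (s2P : forall y, y \in s2).
Local Notation m1 := (mass G1).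
Local Notation m2 := (mass G2).
Local Notation m := (prod_mass m1 m2).
Local Notation L2 := (laplacian th2).
Hypothesis phiE : forall k, L2 (phi k) = fun y => (mu k)%:C * phi k y.
Hypothesis phi_ortho : forall k l, inner m2 (phi k) (phi l) = (k == l)%:R.
Hypothesis phi_complete : forall y y',
  \sum_k phi k y * conjc (phi k y') * (m2 y')%:C = (y == y')%:R.
Hypothesis mu_gt0 : forall k, 0 < mu k.
Local Notation V := (V1 * V2)%type.
Local Notation W := (V1 * 'I_n)%type.
Implicit Types (f g u v : cfun R V) (F : cfun R W).
Local Notation c := (coord G2 phi).
Local Notation d := (uncoord phi).
Local Notation m' := (@coord_mass R V1 G1 n).
Local Notation lam := (coord_eigen G1 mu).
Local Notation G := (prod_graph G1 G2 I).
Local Notation th := (prod_potential I th1 th2).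
Local Notation D := (magnetic_laplacian th).
Local Notation K := (tensor_op m1 m2 (mult_op m1 (fun x => (m1 x)^-1)) (magnetic_laplacian th2)).

Let lf2 := finite_locally_finite G2 finV2.
Let m1_gt0 := @mass_gt0 R V1 G1.
Let m_gt0 : forall p, 0 < m p := @mass_gt0 R V G.
Let m'_gt0 w : 0 < m' w. Proof. exact: m1_gt0. Qed.
Let dK : cancel (@coord R V1 V2 G2 n phi) (@uncoord R V1 V2 n phi) := coordK us2 s2P phi_complete.
Let cK : cancel (@uncoord R V1 V2 n phi) (@coord R V1 V2 G2 n phi) := uncoordK us2 s2P phi_ortho.
Let c_l2 := coord_l2 G1 us2 s2P phi_complete.
Let c_norm2 := coord_norm2 G1 us2 s2P phi_complete.

Lemma prod_locally_finite : locally_finite G.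
Proof.
move=> [x y].
apply: (@sub_finite_set _ _ (([set x' | adj G1 x x'] `|` [set x]) `*` [set: V2])).
  move=> [x' y'] /=; rewrite /adj /= /prod_edge /= => xy; split => //.
  have [->|xx'] := eqVneq x x'; [by right|left].
  move: xy; rewrite (negbTE xx') mul0r addr0 => h.
  rewrite lt_neqAle edge_ge0 andbT eq_sym; apply: contraTneq h => ->.
  by rewrite !mul0r ltxx.
by apply: finite_setX => //; rewrite finite_setU; split.
Qed.
Let lf := prod_locally_finite.

(** The [G1] term is a loop at [x], hence 0. *)
Lemma prod_edge_fiber x y y' : edge G (x, y) (x, y') = edge G2 y y'.
Proof. by rewrite /= /prod_edge /= nl1 !mul0r add0r eqxx mul1r. Qed.

Lemma prod_phase_fiber x y y' : edge G2 y y' != 0 ->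
  phase th (x, y) (x, y') = phase th2 y y'.
Proof.
move=> e; rewrite /phase /= /prod_theta ifF; last first.
  by have := prod_edge_fiber x y y'; rewrite /= => ->; exact/negbTE.
by rewrite /= (theta_off th1 (nl1 x)) mul0rn add0r eqxx.
Qed.

Lemma fiber_quad u x : re (inner m2 (L2 (fun y => u (x, y))) (fun y => u (x, y))) =
  \sum_k mu k * nsq (c u (x, k)).
Proof.
have Cf := finite_Cc finV2.
set v := fun y => u (x, y).
have vE : v = fun y => \sum_(k <- index_enum 'I_n) c u (x, k) * phi k y.
  by apply/funext => y; rewrite /v -{1}(dK u).
rewrite {1}vE (laplacian_sum th2 finV2).
have -> : (fun y => \sum_(k <- index_enum 'I_n) c u (x, k) * L2 (phi k) y) =
   fun y => \sum_k (mu k)%:C * c u (x, k) * phi k y.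
  by apply/funext => y; apply: eq_bigr => k _; rewrite phiE; ring.
rewrite (inner2E G2 us2 s2P).
transitivity (re (\sum_k (mu k)%:C * (c u (x, k) * conjc (c u (x, k))))); last first.
  by rewrite re_sum; apply: eq_bigr => k _; rewrite mulcJ -rmorphM.
congr complex.Re.
transitivity (\sum_(y <- s2) \sum_k (m2 y)%:C * ((mu k)%:C * c u (x, k) * phi k y) * conjc (v y)).
  by apply: eq_bigr => y _; rewrite mulr_sumr mulr_suml.
rewrite exchange_big; apply: eq_bigr => k _.
have -> : conjc (c u (x, k)) = inner m2 (phi k) v by rewrite /coord innerJ.
rewrite (inner2E G2 us2 s2P) mulrA mulr_sumr; apply: eq_bigr => y _; ring.
Qed.

Lemma quad_lower_fibers u (t1 : seq V1) : Cc u -> uniq t1 ->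
  \sum_(x <- t1) \sum_k mu k * nsq (c u (x, k)) <= re (inner m (laplacian th u) u).
Proof.
move=> Cu ut1; pose r : seq V := [seq (x, y) | x <- t1, y <- s2].
have [s [us cu _ rs]] := covers_exists lf r Cu Cu.
rewrite (laplacian_quad th us cu).
pose T (p q : V) := edge G p q * nsq (u p - phase th p q * u q).
have T0 p q : 0 <= T p q by rewrite mulr_ge0 ?edge_ge0 ?nsq_ge0.
have -> : \sum_(x <- t1) \sum_k mu k * nsq (c u (x, k)) =
   2^-1 * \sum_(p <- r) \sum_(y' <- s2) T p (p.1, y').
  rewrite /r big_allpairs mulr_sumr; apply: eq_bigr => x _; rewrite -fiber_quad.
  have Cx : Cc (fun y => u (x, y)) by exact: finite_Cc.
  rewrite (@laplacian_quad _ _ _ th2 _ s2) //.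
  congr (_ * _); apply: eq_bigr => y _; apply: eq_bigr => y' _.
  rewrite /T /= -[prod_edge _ _ _ _ _]/(edge G (x, y) (x, y')) prod_edge_fiber.
  by have [->|e] := eqVneq (edge G2 y y') 0; [rewrite !mul0r|rewrite prod_phase_fiber].
rewrite ler_pM2l ?invr_gt0//.
(* All terms are non-negative: first the second endpoint is released from the fibre of [p] to all of
   [s], then the first from the box [r] to [s]. *)
apply: (@le_trans _ _ (\sum_(p <- r) \sum_(q <- s) T p q)).
  rewrite big_seq [leRHS]big_seq; apply: ler_sum => p pr.
  rewrite -(big_map (fun y' => (p.1, y')) xpredT (T p)); apply: sum_seq_sub => //.
    by rewrite map_inj_uniq// => y y' [].
  move=> _ /mapP[y' _ ->]; apply: rs; move/allpairsP: pr => [[x y] [/= xt _ ->]] /=.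
  by apply/allpairsP; exists (x, y'); split.
apply: sum_seq_sub => // [|p]; last exact: sumr_ge0.
by apply: allpairs_uniq => // -[? ?] [? ?] _ _ [-> ->].
Qed.

(** The finite set [t] sits inside a box of full fibres. The weights are [mu] and not [lam], because
    the coordinate mass [m1 x] cancels the division in [lam]. *)
Lemma quad_lower u (t : seq W) : Cc u -> uniq t ->
  \sum_(w <- t) mu w.2 * nsq (c u w) <= re (inner m (laplacian th u) u).
Proof.
move=> Cu ut; apply: le_trans (quad_lower_fibers Cu (undup_uniq (map fst t))).
set t1 := undup _.
have -> : \sum_(x <- t1) \sum_k mu k * nsq (c u (x, k)) =
    \sum_(w <- [seq (x, k) | x <- t1, k <- index_enum 'I_n]) mu w.2 * nsq (c u w).
  by rewrite big_allpairs.
apply: sum_seq_sub => //.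
- apply: allpairs_uniq; rewrite ?undup_uniq ?index_enum_uniq//.
  by move=> [? ?] [? ?] _ _ [-> ->].
- move=> [x k] xk; apply/allpairsP; exists (x, k); rewrite mem_undup mem_index_enum; split => //.
  by apply/mapP; exists (x, k).
- by move=> w; rewrite mulr_ge0 ?nsq_ge0// ltW.
Qed.

(** The left-hand side involves finitely many coordinates, so it is continuous under pointwise
    convergence, and the bound for finitely supported functions passes to the operator domain. *)
Lemma magnetic_lower f g (t : seq W) : D (f, g) -> uniq t ->
  \sum_(w <- t) mu w.2 * nsq (c f w) <= re (inner m g f).
Proof.
move=> /(magnetic_laplacian_limit lf)[us [Cu uf q]] ut.
have cf := coord_cvg G2 phi us2 s2P uf.
have h : (fun k => \sum_(w <- t) mu w.2 * nsq (c (us k) w)) @ \oo -->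
   \sum_(w <- t) mu w.2 * nsq (c f w).
  elim: t {ut} => [|w t ih].
    by rewrite big_nil; under eq_fun do rewrite big_nil; exact: cvg_cst.
  rewrite big_cons; under eq_fun do rewrite big_cons.
  by apply: cvgD => //; apply: cvgM; [exact: cvg_cst|exact: ccvg_nsq].
rewrite -subr_ge0; apply: (cvg_ge (N := 0) (cvgB q h)) => k _.
by rewrite subr_ge0 quad_lower.
Qed.

Lemma product_compact : (forall e : R, 0 < e -> finite_set [set x | e <= m1 x]) ->
  compact_op m (resolvent D (-1)).
Proof.
move=> fin u hu [M hM]; pose g k := (u k).1; pose f k := (u k).2.
have Dfg k : D (f k, fun p => g k p - f k p).
  have := hu k; rewrite /resolvent /=.
  by rewrite (_ : (fun p => _) = fun p => g k p - f k p)//; apply/funext => p; rewrite mulN1r.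
have lf' k := (magnetic_laplacian_l2 lf (Dfg k)).1.
have lg k : l2 m (g k).
  have -> : g k = fun p => (g k p - f k p) + f k p by apply/funext => p; rewrite subrK.
  by apply: (l2D m_gt0) => //; have [] := magnetic_laplacian_l2 lf (Dfg k).
pose B := M ^+ 2.
have gB k : norm2 m (g k) <= B.
  rewrite -(l2norm_sq m_gt0) ler_pXn2r ?nnegrE ?hM// ?(l2normE m_gt0) ?sqrtr_ge0//.
  by rewrite (le_trans _ (hM k))// (l2normE m_gt0) sqrtr_ge0.
have B0 : 0 <= B by rewrite sqr_ge0.
have fB k : norm2 m (f k) <= B.
  exact: (le_trans (magnetic_laplacian_resolvent_bound lf (lg k) (Dfg k)) (gB k)).
(* Here [<g - f, f>] is at most half of [norm2 m g - norm2 m f], because the squared norm of [g - f]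
   is non-negative. *)
have low k (t : seq W) : uniq t -> \sum_(w <- t) mu w.2 * nsq (c (f k) w) <= B.
  move=> ut; apply: (le_trans (magnetic_lower (Dfg k) ut)).
  rewrite (innerBl m_gt0)// inner_self reD reN.
  have : 0 <= norm2 m (fun p => g k p + -1 * f k p) by exact: (norm2_ge0 m_gt0).
  rewrite (norm2D m_gt0)// nsqN nsqC reM reJ imJ /= .
  have := gB k; have := norm2_ge0 m_gt0 (f k); lra.
have bounded k p : nsq (f k p) <= (m p)^-1 * B.
  by apply: (le_trans (norm2_point m_gt0 p (lf' k))); rewrite ler_wpM2l// invr_ge0 ltW.
have [sub [h [hom ph]]] := diagonal_subsequence bounded.
exists sub, h; split => //; apply: (l2_cvg_tight m_gt0 ph) => // e e0.
(* One constant dominating every [(mu k)^-1]. *)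
pose Cm := \sum_k (mu k)^-1.
have Cm0 : 0 <= Cm by apply: sumr_ge0 => k _; rewrite invr_ge0 ltW.
have Cmk k : 1 <= Cm * mu k.
  rewrite -ler_pdivrMr// div1r /Cm (bigD1 k)//= lerDl sumr_ge0// => l _.
  by rewrite invr_ge0 ltW.
have CB0 : 0 < Cm * B + 1 by rewrite ltr_pwDr// mulr_ge0.
(* Makes the tail bound [r * Cm * B] at most [e]; the added 1 keeps the denominator positive. *)
pose r := e / (Cm * B + 1); have r0 : 0 < r by rewrite divr_gt0.
have /finite_seqP[t0 ht0] := fin r r0.
have t0P x : (x \in t0) = (r <= m1 x).
  apply/idP/idP => [xt|rx]; first by have : [set` t0] x by []; rewrite -ht0.
  by have : [set x | r <= m1 x] x by []; rewrite ht0.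
(* A union of complete fibres, so that cutting [f] off [t] simply kills the coordinates with
   [r <= m1 w.1]. *)
pose t : seq V := [seq (x, y) | x <- undup t0, y <- s2].
have tP (x : V1) (y : V2) : ((x, y) \in t) = (r <= m1 x).
  rewrite -t0P -mem_undup /t; apply/idP/idP => [|xt].
    by case/allpairsP => -[x' y'] [/= xt _ [-> _]].
  by apply/allpairsP; exists (x, y).
exists t; first by apply: allpairs_uniq; rewrite ?undup_uniq// => -[? ?] [? ?] _ _ [-> ->].
move=> k; rewrite -c_norm2.
have cE w : c (off t (f (sub k))) w = if r <= m1 w.1 then 0 else c (f (sub k)) w.
  have fE y : off t (f (sub k)) (w.1, y) = if r <= m1 w.1 then 0 else f (sub k) (w.1, y).
    by rewrite /off tP.
  rewrite /coord; have [rw|rw] := leP r (m1 w.1).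
    have -> : (fun y => off t (f (sub k)) (w.1, y)) = fun=> 0.
      by apply/funext => y; rewrite fE rw.
    by rewrite inner0l.
  have -> // : (fun y => off t (f (sub k)) (w.1, y)) = fun y => f (sub k) (w.1, y).
  by apply/funext => y; rewrite fE leNgt rw.
suff bound q : uniq q -> \sum_(w <- q) m' w * nsq (c (off t (f (sub k))) w) <= e.
  by case: (norm2_le_seq m'_gt0 bound).
move=> uq; apply: (@le_trans _ _ (r * Cm * \sum_(w <- q) mu w.2 * nsq (c (f (sub k)) w))).
  rewrite mulr_sumr; apply: ler_sum => -[x l] _; rewrite cE /=.
  have rC : 0 <= r * Cm by rewrite mulr_ge0// ltW.
  have [rx|xr] := leP r (m1 x).
    by rewrite nsq0 mulr0 (mulr_ge0 rC)// (mulr_ge0 (ltW (mu_gt0 l)))// nsq_ge0.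
  rewrite mulrA ler_wpM2r ?nsq_ge0// (le_trans (ltW xr))// -mulrA ler_peMr//; exact: ltW.
apply: (@le_trans _ _ (r * Cm * B)); first by rewrite ler_wpM2l ?low// mulr_ge0// ltW.
rewrite /r -mulrA mulrAC ler_pdivrMr// ler_wpM2l ?(ltW e0)//; lra.
Qed.

(** The resolution behind [counting_function] is an arbitrary choice, so the eigenvectors [psi] are
    not known to be fixed by [E]; their images under [E] are used instead. If a combination [f] of
    the [psi] is killed by [E], then [spectral_lower] makes its energy exceed [lambda] times its
    squared norm unless [f = 0], whereas its eigenvalues are at most [lambda]. *)
Lemma tensor_count lambda N (t : seq W) : uniq t -> size t = N ->
  (forall w, w \in t -> lam w <= lambda) ->
  (N%:R%:E <= counting_function m K lambda)%E.
Proof.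
move=> ut st tl; apply: ereal_sup_ubound; exists N => //=.
have [E0 resE0] : exists E, spectral_resolution m K E.
  exact: (tensor_resolution G1 finV2 us2 s2P phiE phi_ortho phi_complete (fun k => ltW (mu_gt0 k))).
pose E := xget (fun _ _ _ => 0) [set E | spectral_resolution m K E].
have resE : spectral_resolution m K E by apply: xgetPex; exists E0.
have [pvmE _ _] := resE; have [/(_ `]-oo, lambda]%classic (measurable_itv _)) oE _ _] := pvmE.
pose w_ (i : 'I_N) := tnth (in_tuple t) (cast_ord (esym st) i).
have wt i : w_ i \in t by exact: mem_tnth.
have w_inj : injective w_.
  move=> i j; have x0 : W := w_ i; rewrite /w_ !(tnth_nth x0) /= => /eqP.
  by rewrite nth_uniq ?st// => /eqP; exact: val_inj.
pose psi i : cfun R V := d (fun w => (w == w_ i)%:R).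
have cpsi i w : c (psi i) w = (w == w_ i)%:R by rewrite /psi cK.
have lpsi i : l2 m (psi i).
  apply/c_l2; apply: (l2_fin m'_gt0 (s := [:: w_ i])) => // w.
  by rewrite inE cpsi => /negbTE ->.
exists (fun i => E `]-oo, lambda]%classic (psi i)); split.
  by move=> i; exists (psi i).
move=> a; set f : cfun R V := fun p => \sum_i a i * psi i p => a0.
have lf_ : l2 m f by exact: (l2_sum m_gt0).
have Ef : E `]-oo, lambda]%classic f = fun=> 0.
  by rewrite /f (projection_sum m_gt0 _ _ oE lpsi); apply/funext => p; exact: a0.
have cf w : c f w = \sum_i a i * (w == w_ i)%:R.
  have -> : f = d (fun w => \sum_i a i * (w == w_ i)%:R).
    apply/funext => p; rewrite /f /uncoord.
    under eq_bigr do rewrite /psi /uncoord mulr_sumr.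
    rewrite exchange_big; apply: eq_bigr => k _; rewrite mulr_suml.
    by apply: eq_bigr => i _; rewrite mulrA.
  by rewrite cK.
have cfw i : c f (w_ i) = a i.
  rewrite cf (bigD1 i)//= eqxx mulr1 big1 ?addr0// => j ji.
  by rewrite (inj_eq w_inj) eq_sym (negbTE ji) mulr0.
have cf0 w : w \notin t -> c f w = 0.
  move=> wnt; rewrite cf big1// => i _; rewrite (negbTE (_ : w != w_ i)) ?mulr0//.
  by apply: contra wnt => /eqP ->.
suff f0 : norm2 m f = 0.
  move=> i; rewrite -cfw -[c f](_ : c (fun=> 0) = c f); last first.
    by congr c; apply/funext => p; rewrite (norm2_eq0 m_gt0 lf_ f0).
  by rewrite /coord inner0l.
apply/eqP; apply: contrapT => /negP n0.
have np : 0 < norm2 m f by rewrite lt_neqAle eq_sym n0 (norm2_ge0 m_gt0).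
pose G' : cfun R V := d (fun w => (lam w)%:C * c f w).
have cG w : c G' w = (lam w)%:C * c f w by rewrite /G' cK.
have lG : l2 m G'
  by apply/c_l2; apply: (l2_fin m'_gt0 ut) => w /cf0; rewrite cG => ->; rewrite mulr0.
have Kf : K (f, G') by apply/(tensor_coordP G1 finV2 us2 s2P phiE phi_complete).
have := spectral_lower m_gt0 resE Kf Ef np; apply/negP; rewrite -leNgt.
have iso := isometry_inner m_gt0 m'_gt0 (coord_lin G2 finV2 phi) c_l2 (fun f _ => c_norm2 f) lG lf_.
rewrite -iso (inner_finr m' _ ut cf0) re_sum -c_norm2 (@norm2_fin _ _ m' _ _ ut cf0) mulr_sumr.
rewrite big_seq [leRHS]big_seq; apply: ler_sum => w wt'.
rewrite cG;
  have -> : (m' w)%:C * ((lam w)%:C * c f w) * conjc (c f w) = (m' w * lam w * nsq (c f w))%:C.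
  by rewrite !rmorphM /= -mulcJ; ring.
rewrite /= mulrA ler_wpM2r ?nsq_ge0// mulrC ler_wpM2r ?tl//; exact/ltW/m'_gt0.
Qed.

Lemma counting_le lambda : 0 <= lambda ->
  (counting_function m D lambda <= counting_function m K lambda)%E.
Proof.
move=> l0; apply: ge_ereal_sup => _ [N [v [hv free]] <-].
have [[t [ut st tl]]|[t [ut st tl]]] := list_or_exhausted (fun w => lam w <= lambda) N.
  exact: tensor_count ut st tl.
exfalso; have N0 : (0 < N)%N by exact: leq_ltn_trans st.
pose E := xget (fun _ _ _ => 0) [set E | spectral_resolution m D E].
have vE i : exists2 f, l2 m f & E `]-oo, lambda]%classic f = v i by exact: hv.
(* Without a resolution of [D] the projection is the zero map, its range is trivial, and no free
   family of [N > 0] vectors exists in it. *)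
have [resE|noE] := pselect (exists E, spectral_resolution m D E); last first.
  have E0 : E = fun _ _ _ => 0 by rewrite /E xgetPN// => E' h; apply: noE; exists E'.
  have zero p : \sum_(i < N) 1 * v i p = 0.
    by rewrite big1// => i _; have [f _ <-] := vE i; rewrite E0 mulr0.
  by have /eqP := free (fun=> 1) zero (Ordinal N0); rewrite oner_eq0.
have {}resE : spectral_resolution m D E by exact: xgetPex.
have [pvmE _ _] := resE; have [/(_ `]-oo, lambda]%classic (measurable_itv _)) oE _ _] := pvmE.
have lv i : l2 m (v i) by have [f lf_ <-] := vE i; have [/(_ f lf_)] := oE.
have Ev i : E `]-oo, lambda]%classic (v i) = v i.
  by have [f lf_ <-] := vE i; have [_ _ /(_ f lf_)] := oE.
(* There are fewer conditions [c f w = 0], for [w] in [t], than the [N] coefficients, so a nonzero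
   combination [f] satisfies all of them; it is nonzero as a vector by freeness. *)
have [a [[i0 ai0] ka]] := @kernel_vector _ N (size t) (fun i j => c (v i) (tnth (in_tuple t) j)) st.
pose f : cfun R V := fun p => \sum_i a i * v i p.
have lf_ : l2 m f by exact: (l2_sum m_gt0).
have Ef : E `]-oo, lambda]%classic f = f.
  rewrite {1}/f (projection_sum m_gt0 _ _ oE lv); apply/funext => p.
  by apply: eq_bigr => i _; rewrite Ev.
have cf w : c f w = \sum_i a i * c (v i) w.
  rewrite {1}/coord (inner2E G2 us2 s2P).
  transitivity (\sum_(y <- s2) \sum_i a i * ((mass G2 y)%:C * v i (w.1, y) * conjc (phi w.2 y))).
    apply: eq_bigr => y _; rewrite /f mulr_sumr mulr_suml; apply: eq_bigr => i _; ring.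
  rewrite exchange_big; apply: eq_bigr => i _; rewrite -mulr_sumr; congr (_ * _).
  by rewrite /coord (inner2E G2 us2 s2P).
have cft w : w \in t -> c f w = 0.
  by move=> /(tnthP (in_tuple t))[j ->]; rewrite cf ka.
have fn0 : exists w, c f w != 0.
  apply: contrapT => h; move/eqP: ai0; apply; apply: free => p.
  rewrite -/(f p) -(dK f) /uncoord big1// => k _.
  have [->|ck] := eqVneq (c f (p.1, k)) 0; first by rewrite mul0r.
  by exfalso; apply: h; exists (p.1, k).
have [w0 cw0] := fn0.
have lw0 : lambda < lam w0.
  by rewrite ltNge; apply/negP => /tl/cft/eqP; exact/negP.
have [g Dg up] := spectral_upper m_gt0 resE (@magnetic_laplacian_ge0 _ _ _ th lf) lf_ Ef.
(* The strict gain from one nonzero coordinate [w0], whose eigenvalue exceeds [lambda] because [w0]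
   is outside [t]. It gives a margin independent of the finite set [r] below, so strictness survives
   the supremum over [r]. *)
pose e := m' w0 * (lam w0 - lambda) * nsq (c f w0).
have e0 : 0 < e.
  rewrite mulr_gt0 ?mulr_gt0 ?m'_gt0 ?subr_gt0//.
  by rewrite lt_neqAle nsq_ge0 eq_sym nsq_eq0 cw0.
have lower (r : seq W) : uniq r ->
  \sum_(w <- r) lambda * (m' w * nsq (c f w)) <= lambda * norm2 m f - e.
  (* Adding [w0] to [r] only increases the sum, as [lambda] is non-negative, and ensures that the
     gain [e] is collected. *)
  move=> ur; pose r' := undup (w0 :: r).
  have ur' : uniq r' by exact: undup_uniq.
  have w0r : w0 \in r' by rewrite mem_undup mem_head.
  apply: (@le_trans _ _ (\sum_(w <- r') lambda * (m' w * nsq (c f w)))).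
    apply: sum_seq_sub => // [w wr|w]; first by rewrite mem_undup inE wr orbT.
    by rewrite !mulr_ge0 ?nsq_ge0// ltW.
  rewrite lerBrDr; apply: le_trans (le_trans (magnetic_lower Dg ur') up).
  rewrite (bigD1_seq w0)//= [leRHS](bigD1_seq w0)//= addrAC.
  have mlam w : mu w.2 = m' w * lam w.
    by rewrite /coord_eigen /coord_mass mulrC divfK// gt_eqF// m1_gt0.
  apply: lerD; first by rewrite mlam /e le_eqVlt; apply/orP; left; apply/eqP; ring.
  apply: ler_sum => w _; rewrite mlam mulrA [lambda * _]mulrC.
  have [wt|/negP wt] := boolP (w \in t); first by rewrite cft// nsq0 !mulr0.
  rewrite ler_wpM2r ?nsq_ge0// ler_wpM2l ?(ltW (m'_gt0 w))// leNgt.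
  by apply/negP => /ltW/tl.
have lcf : l2 m' (c f) by exact/c_l2.
(* The supremum of [lower] over finite lists is the squared norm of [c f] times [lambda], which
   contradicts [e > 0]. *)
have : lambda * norm2 m f <= lambda * norm2 m f - e.
  rewrite -{1}c_norm2 /norm2 -rsumZ; last exact/(l2E m'_gt0).
  apply: rsum_le_seq => // w; by rewrite mulr_ge0// (sqw_ge0 m'_gt0).
by lra.
Qed.

End ProductLaplacian.

Theorem proposition2p11 (R : realType) (V1 V2 : countType)
    (G1 : wgraph R V1) (G2 : wgraph R V2)
    (lf1 : locally_finite G1) (conn1 : connected_graph G1) (nl1 : loopless G1)
    (lf2 : locally_finite G2) (conn2 : connected_graph G2) (nl2 : loopless G2)
    (th1 : potential G1) (th2 : potential G2)
    (I : set V2) (I_nonempty : I !=set0)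
    (o : V1)
    (mass1_to0 : mass G1 x @[x --> graph_infinity G1 o] --> (0 : R))
    (finG2 : finite_set [set: V2])
    (hol2 : ~ trivial_holonomy th2) :
  let G := prod_graph G1 G2 I in
  let Delta := magnetic_laplacian (prod_potential I th1 th2) in
  let K := tensor_op (mass G1) (mass G2)
             (mult_op (mass G1) (fun x => (mass G1 x)^-1))
             (magnetic_laplacian th2) in
  compact_resolvent (mass G) Delta /\
  forall lambda : R, 0 <= lambda ->
    (counting_function (mass G) K lambda >= counting_function (mass G) Delta lambda)%E.
Proof.
move=> G Delta K.
have [n [phi [mu [s [[us sP] phiE ortho compl]]]]] := laplacian_eigenbasis th2 finG2.
have mu0 k : 0 < mu k.
  by apply: (eigenvalue_gt0 finG2 conn2 hol2 (phiE k)); rewrite ortho eqxx.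
split; last first.
  by move=> lambda; exact: (counting_le th1 I lf1 nl1 finG2 us sP phiE ortho compl mu0).
exists (-1).
  by apply: magnetic_laplacian_resolvent_set; exact: prod_locally_finite.
apply: (@product_compact _ _ _ _ _ th1 _ I lf1 nl1 finG2 _ _ _ _ us sP phiE compl mu0) => e e0.
exact: (large_mass_finite lf1 conn1 e0 mass1_to0).
Qed.
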